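(* Let $i$ be a cominuscule node, let $v_i\in W$ be the smallest element with $v_i(\varpi_i^\vee)=w_0(\varpi_i^\vee)$, let $\tau_i=v_it_{-\varpi_i^\vee}\in Z$, and write $\tau_i(x)=\tau_ix\tau_i^{-1}$ for $x\in W_{\rm aff}$. Then $\tau_i(v_i)\in W_{\rm aff}^-$ and $$j(\xi_{\tau_i(v_i)})=\sum_{w\le_Lv_i}\ \sum_{v\le v_i^{-1}}\tau_i\big(\xi^v(v_i^{-1})\big)\,A_{\tau_i(w)v_iw^{-1}}\,A_v,$$ where $w,v$ range over elements of $W$, $\le$ is the Bruhat order and $\le_L$ is the left weak Bruhat order.
   Context: Let $\mathfrak g$ be a simple complex Lie algebra with simple roots $\alpha_1,\dots,\alpha_r$, highest root $\Theta$, Weyl group $W$ with longest element $w_0$, weight lattice $P$, coroot and coweight lattices $Q^\vee\subset P^\vee$, fundamental coweights $\varpi_i^\vee$, and $S=\mathrm{Sym}(P)$. A node $i$ is cominuscule if $\langle\varpi_i^\vee,\alpha\rangle\in\{0,1\}$ for all positive roots $\alpha$. Left weak order: $w\le_Lv$ iff $\ell(v)=\ell(vw^{-1})+\ell(w)$. $\widetilde W_{\rm aff}=P^\vee\rtimes W\supset W_{\rm aff}=Q^\vee\rtimes W$, with $t_{\lambda^\vee}$ the translation by $\lambda^\vee$; $W_{\rm aff}$ is a Coxeter group with generators $s_1,\dots,s_r$, $s_0=t_{\Theta^\vee}s_\Theta$. $Z\subset\widetilde W_{\rm aff}$ is the stabilizer of the fundamental alcove; conjugation by an element of $Z$ preserves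 $W_{\rm aff}$ and permutes its Coxeter generators. $W_{\rm aff}^-$ is the set of minimal length representatives of $W_{\rm aff}/W$. $\widetilde W_{\rm aff}$ acts on $S$ by $(wt_{\lambda^\vee})(s)=w(s)$; in particular $\tau_i(s)=v_i(s)$ for $s\in S$. Let $Q_{\rm aff}=\bigoplus_{w\in W_{\rm aff}}\mathrm{Frac}(S)\delta_w$ with $\delta_u\delta_v=\delta_{uv}$, $\delta_us=u(s)\delta_u$. Put $A_i=\frac1{\alpha_i}(\delta_e-\delta_{s_i})$ for $1\le i\le r$, $A_0=\frac{-1}\Theta(\delta_e-\delta_{s_0})$, and $A_w=A_{i_1}\cdots A_{i_\ell}$ for a reduced expression $w=s_{i_1}\cdots s_{i_\ell}\in W_{\rm aff}$. $\mathbb A_{\rm aff}=\bigoplus_{w\in W_{\rm aff}}S\,A_w$ is the affine nil-Hecke ring, and $Z_{\mathbb A_{\rm aff}}(S)$ is the centralizer of $S$ in it. The functions $\xi^v$ ($v\in W$) on $W$ are dual to the $A_v$: the elements $\xi^v(u)\in S$ are defined by $\delta_u=\sum_{v\le u}\xi^v(u)A_v$ for $u\in W$. $H_*^T(\Omega K)$, the $T$-equivariant homology of the affine Grassmannian $\Omega K$ of the simply connected group of $\mathfrak g$, is a free $S$-module with Schubert basis $(\xi_x)_{x\in W_{\rm aff}^-}$; $j:H_*^T(\Omega K)\to Z_{\mathbb A_{\rm aff}}(S)$ is the $S$-algebra isomorphism for which $j(\xi_x)$ is the unique element of $Z_{\mathbb A_{\rm aff}}(S)$ congruent to $A_x$ modulo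 $\sum_{y\in W\setminus\{e\}}\mathbb A_{\rm aff}A_y$ (existence and uniqueness are known). *)

(* Defs.v *)
From HB Require Import structures.
From Stdlib Require Import Relations.
From mathcomp Require Import all_boot all_order all_algebra.
From mathcomp Require Import fraction finmap boolp classical_sets fsbigop.
From mathcomp Require Import monalg mpoly.

Set Implicit Arguments.
Unset Strict Implicit.
Unset Printing Implicit Defensive.

Import GRing.Theory.
Local Open Scope ring_scope.

(* A simple complex Lie algebra with a choice of simple roots enters only
   through its root datum, written in coordinates of rank r:
   - weights are columns in the basis of fundamental weights, so that the
     weight lattice P is 'cV[int]_r;
   - coweights are rows in the dual basis of simple coroots, so that the coroot
     lattice Q^v is 'rV[int]_r and the coweight lattice P^v lies in 'rV[rat]_r;
   - the pairing of a row with a column is their matrix product. *)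
Definition pair r (y : 'rV[int]_r) (m : 'cV[int]_r) : int := (y *m m) 0 0.

Definition qpair r (x : 'rV[rat]_r) (m : 'cV[int]_r) : rat :=
  (x *m map_mx intr m) 0 0.

(* A nonnegative integer combination of the family e. *)
Definition nat_comb r (e : 'I_r -> 'cV[int]_r) (m : 'cV[int]_r) : Prop :=
  exists c : 'I_r -> nat, m = \sum_i e i *+ c i.

(* Reduced irreducible crystallographic root systems with a base; coroot is
   meaningful only on roots. *)
Record simple_datum (r : nat) := SimpleDatum {
  roots : seq 'cV[int]_r;
  coroot : 'cV[int]_r -> 'rV[int]_r;
  simple : 'I_r -> 'cV[int]_r;
  highest : 'cV[int]_r;
  rank_gt0 : (0 < r)%N;
  pair_coroot : {in roots, forall a, pair (coroot a) a = 2};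
  roots_reflect : {in roots &, forall a b,
    b - pair (coroot a) b *: a \in roots};
  coroots_reflect : {in roots &, forall a b,
    coroot (b - pair (coroot a) b *: a) =
    coroot b - pair (coroot b) a *: coroot a};
  roots_reduced : {in roots &, forall a b, forall m n : int,
    m != 0 -> m *: a = n *: b -> b = a \/ b = - a};
  roots_irreducible : forall p : pred 'cV[int]_r,
    {in roots &, forall a b, p a -> ~~ p b -> pair (coroot a) b = 0} ->
    {in roots, forall a, p a} \/ {in roots, forall a, ~~ p a};
  simple_root : forall i, simple i \in roots;
  coroot_simple : forall i, coroot (simple i) = delta_mx 0 i;
  simple_free : forall c : 'I_r -> int,
    \sum_i c i *: simple i = 0 -> forall i, c i = 0;
  roots_signed : {in roots, forall a,
    nat_comb simple a \/ nat_comb simple (- a)};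
  highest_root : highest \in roots;
  highest_max : {in roots, forall a, nat_comb simple (highest - a)}
}.

(* The group of affine transformations of 'rV[rat]_r whose linear part comes
   from GL(P); it contains the extended affine Weyl group.  A triple (w, w', x)
   with w' = w^-1 stands for the product t_x w, where w acts on columns by
   m |-> w *m m, and contragrediently on rows by y |-> y *m w^-1. *)
Record aff (r : nat) := Aff {
  aff_val : 'M[int]_r * 'M[int]_r * 'rV[rat]_r;
  _ : aff_val.1.1 *m aff_val.1.2 == 1%:M }.

HB.instance Definition _ r := [isSub for @aff_val r].
HB.instance Definition _ r := [Choice of aff r by <:].

Section AffGroup.
Variable r : nat.
Implicit Types g h : aff r.

Definition lin g : 'M[int]_r := (val g).1.1.
Definition linV g : 'M[int]_r := (val g).1.2.
Definition tr g : 'rV[rat]_r := (val g).2.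

Lemma linK g : lin g *m linV g = 1%:M.
Proof. by case: g => v p; apply/eqP. Qed.

Lemma linVK g : linV g *m lin g = 1%:M.
Proof. exact: mulmx1C (linK g). Qed.

(* the affine action on the rational span of the coweights *)
Definition act_cowt g (x : 'rV[rat]_r) : 'rV[rat]_r :=
  x *m map_mx intr (linV g) + tr g.

Fact aff1_subproof : (1%:M : 'M[int]_r) *m 1%:M == 1%:M.
Proof. by rewrite mulmx1. Qed.
Definition aff1 : aff r := Aff (aff_val := (1%:M, 1%:M, 0)) aff1_subproof.

Fact affM_subproof g h : (lin g *m lin h) *m (linV h *m linV g) == 1%:M.
Proof. by rewrite mulmxA -(mulmxA (lin g)) linK mulmx1 linK. Qed.
Definition affM g h : aff r :=
  Aff (aff_val := (lin g *m lin h, linV h *m linV g, act_cowt g (tr h)))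
      (affM_subproof g h).

Fact affV_subproof g : linV g *m lin g == 1%:M.
Proof. by rewrite linVK. Qed.
Definition affV g : aff r :=
  Aff (aff_val := (linV g, lin g, - (tr g *m map_mx intr (lin g))))
      (affV_subproof g).

Fact affMA : associative affM.
Proof.
case=> [[[a a'] x] pa] [[[b b'] y] pb] [[[c c'] z] pc]; apply: val_inj.
rewrite /affM /act_cowt /lin /linV /tr /= !mulmxA; congr (_, _, _).
by rewrite map_mxM mulmxDl !mulmxA addrA.
Qed.

Fact aff1M : left_id aff1 affM.
Proof.
case=> [[[a b] x] p]; apply: val_inj.
by rewrite /affM /act_cowt /lin /linV /tr /= mul1mx mulmx1 map_mx1 mulmx1 addr0.
Qed.

Fact affM1 : right_id aff1 affM.
Proof.
case=> [[[a b] x] p]; apply: val_inj.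
by rewrite /affM /act_cowt /lin /linV /tr /= mul1mx mulmx1 mul0mx add0r.
Qed.

Fact affVM : left_inverse aff1 affV affM.
Proof.
move=> g; apply: val_inj; rewrite /affM /act_cowt /=.
congr (_, _, _); [exact: linVK | exact: linVK | exact: subrr].
Qed.

Fact affMV : right_inverse aff1 affV affM.
Proof.
move=> g; apply: val_inj; rewrite /affM /act_cowt /=.
congr (_, _, _); [exact: linK | exact: linK |].
rewrite /tr /= mulNmx -mulmxA -map_mxM.
by rewrite linK map_mx1 mulmx1 addNr.
Qed.

HB.instance Definition _ :=
  isGroup.Build (aff r) affMA aff1M affM1 affVM affMV.

Fact transl_subproof : (1%:M : 'M[int]_r) *m 1%:M == 1%:M.
Proof. by rewrite mulmx1. Qed.
Definition transl (x : 'rV[rat]_r) : aff r :=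
  Aff (aff_val := (1%:M, 1%:M, x)) transl_subproof.

(* the value 1 is irrelevant: it is only taken when pair c a <> 2 *)
Definition reflection (a : 'cV[int]_r) (c : 'rV[int]_r) : aff r :=
  let s : 'M[int]_r := 1%:M - a *m c in
  insubd (1%g : aff r) (s, s, 0 : 'rV[rat]_r).

End AffGroup.

(* Word length in a group with respect to generators s (0 on elements that are
   not products of generators). *)
Section Length.
Variables (I : choiceType) (G : groupType) (s : I -> G).
Implicit Types (g : G) (t : seq I).

Definition word t : G := (\prod_(i <- t) s i)%g.

Definition length g : nat :=
  if pselect (exists n, `[< exists t, word t = g /\ size t = n >]) is left e
  then ex_minn e else 0.

Definition reduced_word g t : Prop := word t = g /\ size t = length g.

End Length.

Section AffineWeyl.
Variables (r : nat) (D : simple_datum r).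
Implicit Types (g w u v x : aff r) (i : 'I_r) (a : 'cV[int]_r).

Definition positive_root a : Prop := a \in roots D /\ nat_comb (simple D) a.

Definition refl a : aff r := reflection a (coroot D a).

Definition weyl w : Prop :=
  exists2 t : seq 'cV[int]_r,
    {subset t <= roots D} & w = (\prod_(a <- t) refl a)%g.

Definition coroot_lattice (y : 'rV[rat]_r) : Prop :=
  exists z : 'rV[int]_r, y = map_mx intr z.

Definition coweight_lattice (y : 'rV[rat]_r) : Prop :=
  {in roots D, forall a, qpair y a \is a Num.int}.

Definition affine_weyl g : Prop :=
  exists y w, [/\ coroot_lattice y, weyl w & g = (transl y * w)%g].

Definition ext_affine_weyl g : Prop :=
  exists y w, [/\ coweight_lattice y, weyl w & g = (transl y * w)%g].

(* Coxeter generators: the index None is the affine node. *)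
Definition weyl_gen i : aff r := refl (simple D i).

Definition affine_gen (o : option 'I_r) : aff r :=
  if o is Some i then weyl_gen i
  else (transl (map_mx intr (coroot D (highest D))) * refl (highest D))%g.

Definition lenW : aff r -> nat := length weyl_gen.
Definition lenA : aff r -> nat := length affine_gen.

Definition weak_left w v : Prop := lenW v = (lenW (v * w^-1)%g + lenW w)%N.

Definition bruhat_step u v : Prop :=
  exists2 a, a \in roots D & v = (u * refl a)%g /\ (lenW u < lenW v)%N.

Definition bruhat : aff r -> aff r -> Prop := clos_refl_trans (aff r) bruhat_step.

Definition longest w0 : Prop :=
  weyl w0 /\ forall w, weyl w -> (lenW w <= lenW w0)%N.

Definition affine_weyl_min g : Prop :=
  affine_weyl g /\ forall w, weyl w -> (lenA g <= lenA (g * w)%g)%N.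

(* the rational points of the open fundamental alcove *)
Definition alcove (y : 'rV[rat]_r) : Prop :=
  (forall i, 0 < qpair y (simple D i)) /\ qpair y (highest D) < 1.

Definition alcove_stab g : Prop :=
  ext_affine_weyl g /\ forall y, alcove (act_cowt g y) <-> alcove y.

(* The basis dual to the simple roots: the columns of the matrix being inverted
   are the simple roots. *)
Definition fund_cowt i : 'rV[rat]_r :=
  row i (invmx (\matrix_(j, k) (simple D k j 0)%:~R)).

Definition cominuscule i : Prop :=
  forall a, positive_root a ->
    qpair (fund_cowt i) a = 0 \/ qpair (fund_cowt i) a = 1.

End AffineWeyl.

(* S = Sym(P), with one indeterminate per fundamental weight *)
Notation symP r := {mpoly int[r]}.
Notation fracP r := {fraction symP r}.

(* The twisted group algebra of aff r over Frac(S), with product tmul below;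
   Q_aff is its subspace of elements supported on the affine Weyl group. *)
Notation twisted r := {malg (fracP r)[aff r]}.

Section NilHecke.
Variables (r : nat) (D : simple_datum r).
Implicit Types (g w x : aff r) (m : 'cV[int]_r).

Definition wt m : symP r := \sum_i m i 0 *: 'X_i.

(* translations act trivially *)
Definition act g (s : symP r) : symP r :=
  s \mPo [tuple wt (col i (lin g)) | i < r].

Definition act_frac g (q : fracP r) : fracP r :=
  tofrac (act g (repr q).1) / tofrac (act g (repr q).2).

Definition delta g : twisted r := << g >>.

Definition tmul (a b : twisted r) : twisted r :=
  \sum_(u <- monalg.msupp a) \sum_(v <- monalg.msupp b)
     << monalg.mcoeff u a * act_frac u (monalg.mcoeff v b) *g (u * v)%g >>.

Definition scal (s : symP r) (a : twisted r) : twisted r := tofrac s *: a.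

Definition nil_gen (o : option 'I_r) : twisted r :=
  let d := delta 1%g - delta (affine_gen D o) in
  if o is Some i then (tofrac (wt (simple D i)))^-1 *: d
  else (-1 / tofrac (wt (highest D))) *: d.

(* A_x, for x in the affine Weyl group, by means of a chosen reduced word *)
Definition nil_elt x : twisted r :=
  \big[tmul/delta 1%g]_(o <- xget [::] [set t | reduced_word (affine_gen D) x t])
     nil_gen o.

Definition nil_hecke (a : twisted r) : Prop :=
  exists2 t : seq (symP r * aff r),
    forall p, p \in t -> affine_weyl D p.2
    & a = \sum_(p <- t) scal p.1 (nil_elt p.2).

Definition centralizes_S (a : twisted r) : Prop :=
  forall s : symP r, tmul a (scal s (delta 1%g)) = tmul (scal s (delta 1%g)) a.

Definition centralizer (a : twisted r) : Prop := nil_hecke a /\ centralizes_S a.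

(* the left ideal \sum_(y in W \ {e}) A_aff A_y *)
Definition weyl_ideal (a : twisted r) : Prop :=
  exists2 t : seq (twisted r * aff r),
    forall p, p \in t -> [/\ nil_hecke p.1, weyl D p.2 & p.2 <> 1%g]
    & a = \sum_(p <- t) tmul p.1 (nil_elt p.2).

(* xi v u is the value at u of the function xi^v dual to A_v *)
Definition dual_functions (xi : aff r -> aff r -> symP r) : Prop :=
  forall u, weyl D u ->
    delta u = \sum_(v \in [set v | weyl D v /\ bruhat D v u])
                scal (xi v u) (nil_elt v).

(* H with the family xi indexed by W_aff^- and the map j stands for the
   T-equivariant homology of the affine Grassmannian with its Schubert basis
   and its isomorphism onto the centralizer.  The last clause determines
   j (xi x). *)
Record grassmannian_homology (H : algType (symP r)) (xi : aff r -> H)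
    (j : H -> twisted r) : Prop := GrassmannianHomology {
  schubert_basis : forall h : H, exists! c : {malg (symP r)[aff r]},
    (forall x, x \in monalg.msupp c -> affine_weyl_min D x) /\
    h = \sum_(x <- monalg.msupp c) monalg.mcoeff x c *: xi x;
  j_linear : forall s h k, j (s *: h + k) = scal s (j h) + j k;
  j_mul : forall h k, j (h * k) = tmul (j h) (j k);
  j_one : j 1 = delta 1%g;
  j_inj : injective j;
  j_image : forall a, centralizer a <-> exists h, j h = a;
  j_schubert : forall x, affine_weyl_min D x ->
    weyl_ideal (j (xi x) - nil_elt x)
}.

End NilHecke.

(* Main.v *)
(* Write v = v_i, tau = v t_(-fi) with fi the i-th fundamental coweight, and let
   J be the sum of the terms A_w tau^-1 A_(v w^-1) over w <=_L v; these are the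
   A_(t_mu) for mu in the orbit W fi.  Since tau A_w = A_(tau(w)) tau, and the
   expansion of v^-1 in the A_y has coefficients xi^y(v^-1) in S, the right-hand
   side of the formula is tau J v^-1 as soon as J commutes with S.

   For a finite node j one has A_j A_(t_mu) = A_(t_(s_j mu)) A_j, whence
   A_j J = J A_j.  The coefficients of J over t_(v fi) W come from the
   single term w = v, where only the translation survives; comparing coefficients
   in A_j J = J A_j carries this to the other points of the orbit, so J is
   supported on translations, which act trivially on S.

   An element supported on translations is determined by its augmentations over
   the cosets t_mu W.  These kill the left ideal generated by the A_y with y <> e
   in W, and of the right-hand side they retain only A_(tau(v)), as they do of
   j(xi_(tau(v))). *)

Require Import Defs.
From HB Require Import structures.
From mathcomp Require Import all_boot all_order all_algebra.
From mathcomp Require Import fraction finmap boolp classical_sets cardinality fsbigop.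
From mathcomp Require Import monalg mpoly.
From mathcomp Require Import zify ring lra.

Set Implicit Arguments.
Unset Strict Implicit.
Unset Printing Implicit Defensive.

Import GRing.Theory Num.Theory Order.TTheory.
Local Open Scope ring_scope.

(** The elements A_x are defined through a chosen reduced word, so everything rests on independence
    of that word. This is proved uniformly in the order of the product of two generators: the
    difference of the two sides of a braid relation can only live at a single group element, and the
    sum of its coefficients is zero.

    Lengths are handled through signs of affine roots. The sign pattern of v is known exactly: among
    the positive roots it reverses those on which fi takes the value 1. The translation part of tau
    shifts constant terms by the same values 0 or 1, so tau preserves all signs, permutes the affine
    simple roots and hence the A_o.

    Since tau lies outside W_aff in general, the computation takes place in the twisted algebra of
    the whole group of affine transformations, where tau is invertible.

    The exchange A_j A_(t_mu) = A_(t_(s_j mu)) A_j has two regimes. If s_j fixes mu, then A_j can be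
    carried through the three factors of A_(t_mu) from left to right, turning into another simple A
    at each passage. Otherwise both sides vanish or both equal A_(s_j t_mu), according to the sign
    of a single root. *)

Local Notation msupp := monalg.msupp.
Local Notation mcoeff := monalg.mcoeff.
Local Notation malgP := monalg.malgP.

(** * Twisted group algebras *)

Section TwistedGroupAlgebra.
Variables (G : groupType) (F : fieldType) (a : G -> F -> F).
Hypothesis aD : forall g, {morph a g : x y / x + y}.
Hypothesis aM : forall g, {morph a g : x y / x * y}.
Hypothesis a_1 : forall g, a g 1 = 1.
Hypothesis a1 : forall x, a 1%g x = x.
Hypothesis aA : forall g h x, a (g * h)%g x = a g (a h x).

Local Notation T := {malg F[G]}.
Implicit Types (x y z : T) (g h : G) (c d : F).

Definition twisted_mul x y : T :=
  \sum_(u <- msupp x) \sum_(v <- msupp y)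
     << mcoeff u x * a u (mcoeff v y) *g (u * v)%g >>.

Let a0 g : a g 0 = 0.
Proof. by apply: (@addrI _ (a g 0)); rewrite -aD !addr0. Qed.

(** Terms outside the supports vanish, so both sums may run over larger common sets. Additivity
    needs this, because the support of a sum can be smaller than the union of the supports. *)
Lemma twisted_mul_widen (A B : {fset G}) x y :
  (msupp x `<=` A)%fset -> (msupp y `<=` B)%fset ->
  twisted_mul x y = \sum_(u <- A) \sum_(v <- B)
     << mcoeff u x * a u (mcoeff v y) *g (u * v)%g >>.
Proof.
move=> sA sB; rewrite /twisted_mul (big_fset_incl _ sA) /=; last first.
  by move=> u _ /mcoeff_outdom ->; rewrite big1 // => v _; rewrite mul0r monalgU0.
apply/eq_bigr => u _; apply/big_fset_incl => // v _ /mcoeff_outdom ->.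
by rewrite a0 mulr0 monalgU0.
Qed.

Lemma twisted_mulDl : left_distributive twisted_mul +%R.
Proof.
move=> x y z.
rewrite (@twisted_mul_widen (msupp x `|` msupp y)%fset (msupp z)) ?monalg.msuppD_le //.
rewrite (@twisted_mul_widen (msupp x `|` msupp y)%fset (msupp z) x) ?fsubsetUl //.
rewrite (@twisted_mul_widen (msupp x `|` msupp y)%fset (msupp z) y) ?fsubsetUr //.
rewrite -big_split /=; apply/eq_bigr=> u _; rewrite -big_split /=.
by apply/eq_bigr=> v _; rewrite monalg.mcoeffD mulrDl monalgUD.
Qed.

Lemma twisted_mulDr : right_distributive twisted_mul +%R.
Proof.
move=> z x y.
rewrite (@twisted_mul_widen (msupp z) (msupp x `|` msupp y)%fset) ?monalg.msuppD_le //.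
rewrite (@twisted_mul_widen (msupp z) (msupp x `|` msupp y)%fset z x) ?fsubsetUl //.
rewrite (@twisted_mul_widen (msupp z) (msupp x `|` msupp y)%fset z y) ?fsubsetUr //.
rewrite -big_split /=; apply/eq_bigr=> u _; rewrite -big_split /=.
by apply/eq_bigr=> v _; rewrite monalg.mcoeffD aD mulrDr monalgUD.
Qed.

Lemma twisted_mul0l y : twisted_mul 0 y = 0.
Proof. by rewrite /twisted_mul monalg.msupp0 big_seq_fset0. Qed.

Lemma twisted_mul0r x : twisted_mul x 0 = 0.
Proof.
by rewrite /twisted_mul big1 // => u _; rewrite monalg.msupp0 big_seq_fset0.
Qed.

Lemma twisted_mulUU c d g h :
  twisted_mul << c *g g >> << d *g h >> = << c * a g d *g (g * h)%g >>.
Proof.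
by rewrite (twisted_mul_widen msuppU_le msuppU_le) !big_seq_fset1 !mcoeffUU.
Qed.

Lemma twisted_suml I (s : seq I) (f : I -> T) y :
  twisted_mul (\sum_(i <- s) f i) y = \sum_(i <- s) twisted_mul (f i) y.
Proof.
exact: (big_morph (twisted_mul^~ y) (fun _ _ => twisted_mulDl _ _ _)
  (twisted_mul0l y)).
Qed.

Lemma twisted_sumr I (s : seq I) (f : I -> T) x :
  twisted_mul x (\sum_(i <- s) f i) = \sum_(i <- s) twisted_mul x (f i).
Proof.
exact: (big_morph (twisted_mul x) (fun _ _ => twisted_mulDr _ _ _)
  (twisted_mul0r x)).
Qed.

Lemma twisted_mul1l : left_id (<< 1%g >> : T) twisted_mul.
Proof.
move=> x; rewrite [x]monalgE twisted_sumr; apply/eq_bigr => u _.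
by rewrite twisted_mulUU a1 mul1r mul1g.
Qed.

Lemma twisted_mul1r : right_id (<< 1%g >> : T) twisted_mul.
Proof.
move=> x; rewrite [x]monalgE twisted_suml; apply/eq_bigr => u _.
by rewrite twisted_mulUU a_1 mulr1 mulg1.
Qed.

Lemma twisted_mulA : associative twisted_mul.
Proof.
move=> x y z; rewrite [x]monalgE !twisted_suml; apply/eq_bigr => u _.
rewrite [y]monalgE !(twisted_suml, twisted_sumr); apply/eq_bigr => v _.
rewrite [z]monalgE !(twisted_suml, twisted_sumr); apply/eq_bigr => w _.
by rewrite !twisted_mulUU aM aA mulrA mulgA.
Qed.

Lemma twisted_coefMU x c h g :
  mcoeff g (twisted_mul x << c *g h >>) =
  mcoeff (g * h^-1)%g x * a (g * h^-1)%g c.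
Proof.
rewrite {1}[x]monalgE twisted_suml raddf_sum /=.
under eq_bigr do rewrite twisted_mulUU mcoeffU.
case: (boolP ((g * h^-1)%g \in msupp x)) => [xS|/[dup] xS /mcoeff_outdom ->].
  rewrite (big_fsetD1 _ xS) /= mulgVK eqxx mulr1n big1_fset ?addr0 // => u.
  rewrite in_fsetD1 => /andP[/eqP uP _] _; case: eqP => // E.
  by case: uP; rewrite -E mulgK.
rewrite mul0r big1_seq // => u /andP[_ uS]; case: eqP => // E.
by rewrite -E mulgK uS in xS.
Qed.

Lemma twisted_coefUM x c h g :
  mcoeff g (twisted_mul << c *g h >> x) = c * a h (mcoeff (h^-1 * g)%g x).
Proof.
rewrite {1}[x]monalgE twisted_sumr raddf_sum /=.
under eq_bigr do rewrite twisted_mulUU mcoeffU.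
case: (boolP ((h^-1 * g)%g \in msupp x)) => [xS|/[dup] xS /mcoeff_outdom ->].
  rewrite (big_fsetD1 _ xS) /= mulVKg eqxx mulr1n big1_fset ?addr0 // => u.
  rewrite in_fsetD1 => /andP[/eqP uP _] _; case: eqP => // E.
  by case: uP; rewrite -E mulKg.
rewrite a0 mulr0 big1_seq // => u /andP[_ uS]; case: eqP => // E.
by rewrite -E mulKg uS in xS.
Qed.

Lemma twisted_coefM x y g : mcoeff g (twisted_mul x y) != 0 ->
  exists u v, [/\ mcoeff u x != 0, mcoeff v y != 0 & g = (u * v)%g].
Proof.
rewrite /twisted_mul raddf_sum /= => /eqP nz; apply: contrapT => H; case: nz.
rewrite big1_seq // => u /andP[_ uS]; rewrite raddf_sum big1_seq //= => v vS.
rewrite mcoeffU; case: eqP => // E; case: H; exists u, v.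
by rewrite !mcoeff_neq0.
Qed.

End TwistedGroupAlgebra.

(** All that the nil-Hecke calculus needs of Frac(S) and its group action; the concrete fraction
    field is substituted only at the end. *)
Record fieldAction (G : groupType) := FieldAction {
  fa_field :> fieldType;
  fa_act : G -> fa_field -> fa_field;
  fa_actD : forall g, {morph fa_act g : x y / x + y};
  fa_actM : forall g, {morph fa_act g : x y / x * y};
  fa_act_1 : forall g, fa_act g 1 = 1;
  fa_act1 : forall x, fa_act 1%g x = x;
  fa_actA : forall g h x, fa_act (g * h)%g x = fa_act g (fa_act h x) }.

Section TwistedRing.
Variables (G : groupType) (K : fieldAction G).
Implicit Types (g h : G) (c d : K) (p : pred G).
Local Notation ac := (@fa_act G K).

Lemma fa_act_is_zmod_morphism g : zmod_morphism (@fa_act G K g).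
Proof.
have a0 : fa_act g (0 : K) = 0 by apply: (@addrI _ (fa_act g 0)); rewrite -fa_actD !addr0.
by move=> c d; apply: (canRL (addrK _)); rewrite -fa_actD subrK.
Qed.
Lemma fa_act_is_monoid_morphism g : monoid_morphism (@fa_act G K g).
Proof. by split; [apply: fa_act_1 | apply: fa_actM]. Qed.
HB.instance Definition _ g := GRing.isZmodMorphism.Build K K (@fa_act G K g)
  (fa_act_is_zmod_morphism g).
HB.instance Definition _ g := GRing.isMonoidMorphism.Build K K (@fa_act G K g)
  (fa_act_is_monoid_morphism g).

Definition qring : Type := {malg K[G]}.
HB.instance Definition _ := GRing.Zmodule.on qring.
HB.instance Definition _ := GRing.Zmodule_isPzRing.Build qring
  (twisted_mulA (@fa_actD G K) (@fa_actM G K) (@fa_actA G K))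
  (twisted_mul1l (@fa_actD G K) (@fa_act1 G K))
  (twisted_mul1r (@fa_actD G K) (@fa_act_1 G K))
  (twisted_mulDl (@fa_actD G K)) (twisted_mulDr (@fa_actD G K)).

Implicit Types a b : qring.

Definition qcst c : qring := << c *g 1%g >>.
Definition qdl g : qring := << 1 *g g >>.
Definition qcoef g a : K := mcoeff g a.

Lemma qcoefB g a b : qcoef g (a - b) = qcoef g a - qcoef g b.
Proof. exact: monalg.mcoeffB. Qed.
Lemma qcoefP a b : (forall g, qcoef g a = qcoef g b) -> a = b.
Proof. by move=> E; apply/malgP. Qed.

Lemma qcoef_dl g h : qcoef g (qdl h) = (h == g)%:R.
Proof. by rewrite /qcoef /qdl mcoeffU. Qed.
Lemma qcoef_dlM h a g : qcoef g (qdl h * a) = ac h (qcoef (h^-1 * g)%g a).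
Proof. by rewrite /qcoef twisted_coefUM ?mul1r //; apply: (@fa_actD G K). Qed.
Lemma qcoef_Mdl h a g : qcoef g (a * qdl h) = qcoef (g * h^-1)%g a.
Proof.
by rewrite /qcoef twisted_coefMU ?(@fa_act_1 G K) ?mulr1 //; apply: (@fa_actD G K).
Qed.
Lemma qcoef_cstM c a g : qcoef g (qcst c * a) = c * qcoef g a.
Proof.
rewrite /qcoef twisted_coefUM ?invg1 ?mul1g ?(@fa_act1 G K) //; exact: (@fa_actD G K).
Qed.
Lemma qcoef_Mcst c a g : qcoef g (a * qcst c) = qcoef g a * ac g c.
Proof.
rewrite /qcoef twisted_coefMU ?invg1 ?mulg1 //; exact: (@fa_actD G K).
Qed.
Lemma qcoef_mul a b g : qcoef g (a * b) != 0 ->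
  exists u v, [/\ qcoef u a != 0, qcoef v b != 0 & g = (u * v)%g].
Proof. by apply: twisted_coefM. Qed.

Lemma qdlM g h : qdl (g * h)%g = qdl g * qdl h.
Proof.
by apply: qcoefP => x; rewrite qcoef_Mdl !qcoef_dl -(can2_eq (mulgK h) (mulgVK h)).
Qed.
Lemma qdl1 : qdl 1%g = 1.
Proof. by []. Qed.

Lemma qcoef_cst g c : qcoef g (qcst c) = if 1%g == g then c else 0.
Proof. by rewrite /qcoef /qcst mcoeffU; case: eqP. Qed.

Lemma qcst_is_zmod_morphism : zmod_morphism qcst.
Proof. exact: monalgUB. Qed.
Lemma qcst_is_monoid_morphism : monoid_morphism qcst.
Proof.
split=> [|c d]; first by rewrite -qdl1.
apply: qcoefP => g; rewrite qcoef_cstM (qcoef_cst g (c * d)) (qcoef_cst g d).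
by case: eqP; rewrite ?mulr0.
Qed.
Lemma qcstM c d : qcst (c * d) = qcst c * qcst d.
Proof. by case: qcst_is_monoid_morphism => _; apply. Qed.
Lemma qcst1 : qcst 1 = 1. Proof. by case: qcst_is_monoid_morphism. Qed.
Lemma qcstB c d : qcst (c - d) = qcst c - qcst d.
Proof. exact: qcst_is_zmod_morphism. Qed.

Lemma qdl_cst g c : qdl g * qcst c = qcst (ac g c) * qdl g.
Proof.
apply: qcoefP => x; rewrite qcoef_Mcst qcoef_cstM qcoef_dl mulrC.
by case: eqP => [->|]; rewrite ?mulr0.
Qed.

(** The augmentation restricted to [p]: the sum of the coefficients at the group elements satisfying
    [p]. For [p] a coset of W these are the augmentations that separate elements supported on
    translations. *)
Definition qaug p a : K := monalg.mmap (@idfun K) (fun g => (p g)%:R) a.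

Lemma qaugB p a b : qaug p (a - b) = qaug p a - qaug p b.
Proof. exact: monalg.mmapB. Qed.

Lemma qring_decomp a : a = \sum_(g <- monalg.msupp a) qcst (qcoef g a) * qdl g.
Proof.
rewrite {1}[a : {malg K[G]}]monalgE; apply: eq_bigr => g _; apply: qcoefP => h.
by rewrite qcoef_cstM qcoef_dl /qcoef mcoeffU; case: eqP; rewrite ?mulr1 ?mulr0.
Qed.

Lemma qaug_mono p c g : qaug p (qcst c * qdl g) = c * (p g)%:R.
Proof.
have -> : qcst c * qdl g = << c *g g >> :> qring.
  apply: qcoefP => h; rewrite qcoef_cstM qcoef_dl /qcoef mcoeffU.
  by case: eqP; rewrite ?mulr1 ?mulr0.
by rewrite /qaug mmapU.
Qed.

End TwistedRing.

Arguments qcst {G K} c.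
Arguments qcoef {G K} g a.
Arguments qdl {G} K g.

(* The ring operations of [qring] unfold to convolution sums, which makes
   unification on them expensive; algebra is done over this interface instead. *)
Record twistedRing (G : groupType) (K : fieldAction G) := TwistedRing {
  tw_ring :> pzRingType;
  tw_cst : K -> tw_ring;
  tw_dl : G -> tw_ring;
  tw_coef : G -> tw_ring -> K;
  tw_aug : pred G -> tw_ring -> K;
  tw_coefP : forall a b, (forall g, tw_coef g a = tw_coef g b) -> a = b;
  tw_coefB : forall g a b, tw_coef g (a - b) = tw_coef g a - tw_coef g b;
  tw_coef_dl : forall g h, tw_coef g (tw_dl h) = (h == g)%:R;
  tw_coef_dlM : forall h a g,
    tw_coef g (tw_dl h * a) = fa_act h (tw_coef (h^-1 * g)%g a);
  tw_coef_Mdl : forall h a g, tw_coef g (a * tw_dl h) = tw_coef (g * h^-1)%g a;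
  tw_coef_cstM : forall c a g, tw_coef g (tw_cst c * a) = c * tw_coef g a;
  tw_coef_Mcst : forall c a g,
    tw_coef g (a * tw_cst c) = tw_coef g a * fa_act g c;
  tw_coef_mul : forall a b g, tw_coef g (a * b) != 0 -> exists u v,
    [/\ tw_coef u a != 0, tw_coef v b != 0 & g = (u * v)%g];
  tw_dlM : forall g h, tw_dl (g * h)%g = tw_dl g * tw_dl h;
  tw_dl1 : tw_dl 1%g = 1;
  tw_cstB : forall c d, tw_cst (c - d) = tw_cst c - tw_cst d;
  tw_cstM : forall c d, tw_cst (c * d) = tw_cst c * tw_cst d;
  tw_cst1 : tw_cst 1 = 1;
  tw_dl_cst : forall g c, tw_dl g * tw_cst c = tw_cst (fa_act g c) * tw_dl g;
  tw_decomp : forall a, exists2 s : seq G, uniq s &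
    a = \sum_(g <- s) tw_cst (tw_coef g a) * tw_dl g;
  tw_augB : forall p a b, tw_aug p (a - b) = tw_aug p a - tw_aug p b;
  tw_aug_mono : forall p c g, tw_aug p (tw_cst c * tw_dl g) = c * (p g)%:R }.

Fact qring_decomp_uniq (G : groupType) (K : fieldAction G) (a : qring K) :
  exists2 s : seq G, uniq s & a = \sum_(g <- s) qcst (qcoef g a) * qdl K g.
Proof.
by exists (monalg.msupp a); [apply: fset_uniq | apply: qring_decomp].
Qed.

Definition twisted_ring (G : groupType) (K : fieldAction G) : twistedRing K :=
  TwistedRing (@qcoefP G K) (@qcoefB G K) (@qcoef_dl G K) (@qcoef_dlM G K)
    (@qcoef_Mdl G K) (@qcoef_cstM G K) (@qcoef_Mcst G K) (@qcoef_mul G K)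
    (@qdlM G K) (@qdl1 G K) (@qcstB G K) (@qcstM G K) (@qcst1 G K)
    (@qdl_cst G K) (@qring_decomp_uniq G K) (@qaugB G K) (@qaug_mono G K).

(** * The action on Sym(P) and its extension to the fraction field *)

Section LevelZeroAction.
Variable r : nat.
Implicit Types (g h : aff r) (m : 'cV[int]_r) (p q : symP r) (c d : fracP r).

Lemma linM g h : lin (g * h)%g = lin g *m lin h. Proof. by []. Qed.
Lemma lin1 : lin (1%g : aff r) = 1%:M. Proof. by []. Qed.
Lemma linVE g : lin (g^-1)%g = linV g. Proof. by []. Qed.

Lemma wtD : {morph @wt r : m n / m + n}.
Proof.
by move=> m n; rewrite /wt -big_split; apply: eq_bigr => i _; rewrite mxE scalerDl.
Qed.

Lemma wtZ (n : int) m : wt (n *: m) = n%:~R * wt m.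
Proof.
rewrite /wt mulr_sumr; apply: eq_bigr => i _.
by rewrite mxE mulrzl scalerMzl mulrzz mulrC.
Qed.

Lemma wtN m : wt (- m) = - wt m.
Proof. by rewrite -scaleN1r wtZ rmorphN mulN1r. Qed.

Lemma wtB m n : wt (m - n) = wt m - wt n.
Proof. by rewrite wtD wtN. Qed.

Lemma wt_inj : injective (@wt r).
Proof.
have K0 m : wt m = 0 -> m = 0.
  move=> E; apply/colP => i; rewrite mxE.
  have := congr1 (mpoly.mcoeff U_(i)%MM) E; rewrite mpoly.mcoeff0 => <-.
  rewrite /wt raddf_sum (bigD1 i) //= mpoly.mcoeffZ mpoly.mcoeffX eqxx mulr1.
  rewrite big1 ?addr0 // => j /negbTE ji.
  by rewrite mpoly.mcoeffZ mpoly.mcoeffX eq_mnm1 ji mulr0.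
by move=> m n E; apply/eqP; rewrite -subr_eq0; apply/eqP/K0; rewrite wtB E subrr.
Qed.

Lemma act_wt g m : act g (wt m) = wt (lin g *m m).
Proof.
rewrite /act /wt raddf_sum /=.
under eq_bigr => i _ do
  rewrite comp_mpolyZ comp_mpolyXU -tnth_nth tnth_mktuple /wt scaler_sumr.
rewrite exchange_big /=; apply: eq_bigr => i _.
rewrite mxE scaler_suml; apply: eq_bigr => k _.
by rewrite mxE scalerA mulrC.
Qed.

HB.instance Definition _ g := GRing.RMorphism.copy (@act r g)
  (comp_mpoly [tuple wt (col i (lin g)) | i < r]).

Lemma actX g (i : 'I_r) : act g ('X_i) = wt (col i (lin g)).
Proof. by rewrite /act comp_mpolyXU -tnth_nth tnth_mktuple. Qed.

(** The coefficients are integers, which every ring morphism respects, so the values on the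
    variables decide. *)
Lemma rmorph_mpoly_ext (R : pzRingType) (f f' : {rmorphism symP r -> R}) :
  (forall i, f 'X_i = f' 'X_i) -> f =1 f'.
Proof.
move=> E p; rewrite [p]mpolyE !raddf_sum; apply: eq_bigr => m _ /=.
rewrite -mul_mpolyC !rmorphM /=; congr (_ * _).
  by rewrite -[p@_m]intz !rmorph_int.
rewrite mpolyXE_id !rmorph_prod; apply: eq_bigr => i _.
by rewrite !rmorphXn E.
Qed.

Lemma act1 p : act 1%g p = p.
Proof.
apply: (@rmorph_mpoly_ext _ (act (1%g : aff r)) idfun) => i /=.
rewrite actX /wt (bigD1 i) //= !mxE eqxx scale1r big1 ?addr0 // => j ji.
by rewrite !mxE (negbTE ji) scale0r.
Qed.

Lemma actM g h p : act (g * h)%g p = act g (act h p).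
Proof.
apply: (@rmorph_mpoly_ext _ (act (g * h)%g) (act g \o act h)) => i /=.
by rewrite !actX act_wt linM !colE mulmxA.
Qed.

Lemma actK g : cancel (act g) (act g^-1%g).
Proof. by move=> p; rewrite -actM mulVg act1. Qed.

Lemma act_eq0 g p : (act g p == 0) = (p == 0).
Proof.
apply/eqP/eqP => [E|->]; last exact: rmorph0.
by rewrite -[p](actK g) E rmorph0.
Qed.

Lemma act_lin g h p : lin g = lin h -> act g p = act h p.
Proof. by rewrite /act => ->. Qed.

Lemma frac_repr (R : idomainType) (f : {fraction R}) :
  f = tofrac (repr f).1 / tofrac (repr f).2.
Proof.
have d0 : (repr f).2 != 0 by apply: denom_ratioP.
apply: (canRL (mulfK _)); first by rewrite tofrac_eq0.
rewrite -{1}[f]reprK; unlock FracField.tofrac.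
rewrite -[LHS]FracField.pi_mul; apply/eqmodP; rewrite /= FracField.equivfE.
by rewrite /FracField.mulf !numden_Ratio ?mulr1 ?oner_eq0 // mulrC.
Qed.

(** [act_frac] is defined on a chosen representative; the choice is harmless because [act g] is an
    injective ring morphism and so preserves equality of cross products. *)
Lemma act_frac_div g p q : q != 0 ->
  act_frac g (tofrac p / tofrac q) = tofrac (act g p) / tofrac (act g q).
Proof.
move=> q0; rewrite /act_frac; set x := tofrac p / tofrac q.
have d0 : (repr x).2 != 0 by apply: denom_ratioP.
have : tofrac p / tofrac q == tofrac (repr x).1 / tofrac (repr x).2.
  by apply/eqP; exact: frac_repr x.
rewrite eqr_div ?tofrac_eq0 // -!tofracM tofrac_eq => /eqP E.
apply/eqP; rewrite eqr_div ?tofrac_eq0 ?act_eq0 //.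
by rewrite -!tofracM tofrac_eq -!rmorphM /= E.
Qed.

Lemma frac_ind (P : fracP r -> Prop) :
  (forall p q, q != 0 -> P (tofrac p / tofrac q)) -> forall c, P c.
Proof.
by move=> H c; rewrite [c]frac_repr; apply: H; apply: denom_ratioP.
Qed.

Lemma act_frac_tofrac g p : act_frac g (tofrac p) = tofrac (act g p).
Proof.
by have := act_frac_div g p (oner_neq0 _); rewrite !rmorph1 !divr1.
Qed.

Lemma act_fracD g : {morph act_frac g : x y / x + y}.
Proof.
elim/frac_ind=> p q q0; elim/frac_ind=> p' q' q0'.
rewrite addf_div ?tofrac_eq0 // -!tofracM -tofracD.
rewrite !act_frac_div ?mulf_neq0 // !(rmorphD, rmorphM) /=.
by rewrite addf_div ?tofrac_eq0 ?act_eq0.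
Qed.

Lemma act_fracM g : {morph act_frac g : x y / x * y}.
Proof.
elim/frac_ind=> p q q0; elim/frac_ind=> p' q' q0'.
rewrite mulf_div -!tofracM !act_frac_div ?mulf_neq0 // !rmorphM /=.
by rewrite mulf_div.
Qed.

Lemma act_frac_1 g : act_frac g 1 = 1.
Proof. by rewrite -tofrac1 act_frac_tofrac !rmorph1. Qed.

Lemma act_frac1 c : act_frac 1%g c = c.
Proof. by elim/frac_ind: c => p q q0; rewrite act_frac_div // !act1. Qed.

Lemma act_fracA g h c : act_frac (g * h)%g c = act_frac g (act_frac h c).
Proof.
by elim/frac_ind: c => p q q0; rewrite !act_frac_div ?act_eq0 // !actM.
Qed.

Definition frac_action : fieldAction (aff r) :=
  FieldAction act_fracD act_fracM act_frac_1 act_frac1 act_fracA.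

End LevelZeroAction.

(** * Affine roots *)

Section Pairings.
Variable r : nat.
Implicit Types (x y : 'rV[rat]_r) (m n : 'cV[int]_r) (c : 'rV[int]_r).

Lemma qpairDl x y m : qpair (x + y) m = qpair x m + qpair y m.
Proof. by rewrite /qpair mulmxDl mxE. Qed.
Lemma qpairNl x m : qpair (- x) m = - qpair x m.
Proof. by rewrite /qpair mulNmx mxE. Qed.
Lemma qpairZl k x m : qpair (k *: x) m = k * qpair x m.
Proof. by rewrite /qpair -scalemxAl mxE. Qed.
Lemma qpair0l m : qpair 0 m = 0.
Proof. by rewrite /qpair mul0mx mxE. Qed.
Lemma qpairDr x m n : qpair x (m + n) = qpair x m + qpair x n.
Proof. by rewrite /qpair map_mxD mulmxDr mxE. Qed.
Lemma qpairNr x m : qpair x (- m) = - qpair x m.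
Proof. by rewrite /qpair map_mxN mulmxN mxE. Qed.
Lemma qpairBr x m n : qpair x (m - n) = qpair x m - qpair x n.
Proof. by rewrite qpairDr qpairNr. Qed.
Lemma qpair0r x : qpair x 0 = 0.
Proof. by rewrite /qpair map_mx0 mulmx0 mxE. Qed.
Lemma qpairZr (k : int) x m : qpair x (k *: m) = k%:~R * qpair x m.
Proof. by rewrite /qpair map_mxZ -scalemxAr mxE. Qed.
Lemma qpairMnr k x m : qpair x (m *+ k) = k%:R * qpair x m.
Proof.
elim: k => [|k IH]; first by rewrite mulr0n qpair0r mul0r.
by rewrite mulrS qpairDr IH mulrS mulrDl mul1r.
Qed.
Lemma qpair_sumr I (s : seq I) (F : I -> 'cV[int]_r) x :
  qpair x (\sum_(i <- s) F i) = \sum_(i <- s) qpair x (F i).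
Proof.
exact: (big_morph (qpair x) (qpairDr x) (qpair0r x)).
Qed.
Lemma qpair_mx x (M : 'M[int]_r) m :
  qpair (x *m map_mx intr M) m = qpair x (M *m m).
Proof. by rewrite /qpair map_mxM mulmxA. Qed.
Lemma qpair_intr c m : qpair (map_mx intr c) m = (pair c m)%:~R.
Proof. by rewrite /qpair -map_mxM mxE. Qed.
Lemma pairB c m n : pair c (m - n) = pair c m - pair c n.
Proof. by rewrite /pair mulmxBr !mxE. Qed.
Lemma pairN c m : pair c (- m) = - pair c m.
Proof. by rewrite /pair mulmxN !mxE. Qed.
Lemma pairNl c m : pair (- c) m = - pair c m.
Proof. by rewrite /pair mulNmx !mxE. Qed.
Lemma pairZ k c m : pair c (k *: m) = k * pair c m.
Proof. by rewrite /pair -scalemxAr !mxE. Qed.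
Lemma pair_mx c (M : 'M[int]_r) m : pair (c *m M) m = pair c (M *m m).
Proof. by rewrite /pair mulmxA. Qed.
Lemma pair_outer (a : 'cV[int]_r) c m : a *m c *m m = pair c m *: a.
Proof.
by rewrite -mulmxA (mx11_scalar (c *m m)) mul_mx_scalar.
Qed.

End Pairings.

Section RootSystem.
Variables (r : nat) (D : simple_datum r).
Implicit Types (a b m : 'cV[int]_r) (i j k : 'I_r).
Local Notation roots := (Defs.roots D).
Local Notation coroot := (coroot D).
Local Notation simple := (simple D).
Local Notation Theta := (highest D).
Local Notation fund := (fund_cowt D).

(** A singular integer matrix kills a nonzero integer vector, which here would be an integer
    relation between simple roots. Freeness over the integers thus gives invertibility over the
    rationals. *)
Lemma simple_mx_unit : (\matrix_(j, k) (simple k j 0)%:~R : 'M[rat]_r) \in unitmx.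
Proof.
rewrite -unitmx_tr unitmxE unitfE.
rewrite (_ : _^T = map_mx intr (\matrix_(k, j) simple k j 0)); last first.
  by apply/matrixP => i j; rewrite !mxE.
rewrite det_map_mx intr_eq0; apply/negP => /det0P[v v0 /rowP v1].
case/eqP: v0; apply/rowP => i; rewrite mxE.
apply: (simple_free (c := fun i => v 0 i)).
apply/colP => j; move: (v1 j); rewrite !mxE => <-.
by rewrite summxE; apply: eq_bigr => k _; rewrite !mxE.
Qed.

Lemma fund_simple i j : qpair (fund i) (simple j) = (i == j)%:R.
Proof.
rewrite /fund_cowt; set M := \matrix_(_, _) _.
transitivity ((invmx M *m M) i j); last by rewrite mulVmx ?simple_mx_unit // mxE.
by rewrite /qpair !mxE; apply: eq_bigr => k _; rewrite !mxE.
Qed.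

Lemma cf_inj a b : (forall i, qpair (fund i) a = qpair (fund i) b) -> a = b.
Proof.
move=> E; set M : 'M[rat]_r := \matrix_(j, k) (simple k j 0)%:~R.
have H : invmx M *m map_mx intr a = invmx M *m map_mx intr b.
  apply/colP => i; have := E i; rewrite /qpair /fund_cowt -/M -!row_mul.
  by rewrite !mxE.
apply/colP => i; apply/eqP; rewrite -(eqr_int rat).
have /colP/(_ i) := congr1 (mulmx M) H.
by rewrite !mulmxA mulmxV ?simple_mx_unit // !mul1mx !mxE => ->.
Qed.

Definition ht a : rat := \sum_i qpair (fund i) a.

Lemma htD a b : ht (a + b) = ht a + ht b.
Proof. by rewrite /ht -big_split; apply: eq_bigr => i _; rewrite qpairDr. Qed.
Lemma htN a : ht (- a) = - ht a.
Proof. by rewrite /ht -sumrN; apply: eq_bigr => i _; rewrite qpairNr. Qed.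
Lemma htB a b : ht (a - b) = ht a - ht b.
Proof. by rewrite htD htN. Qed.
Lemma htZ (n : int) a : ht (n *: a) = n%:~R * ht a.
Proof. by rewrite /ht mulr_sumr; apply: eq_bigr => i _; rewrite qpairZr. Qed.
Lemma ht0 : ht 0 = 0.
Proof. by rewrite /ht big1 // => i _; rewrite qpair0r. Qed.
Lemma ht_simple i : ht (simple i) = 1.
Proof.
rewrite /ht (bigD1 i) //= fund_simple eqxx big1 ?addr0 // => j ji.
by rewrite fund_simple (negbTE ji).
Qed.

Lemma cf_comb (c : 'I_r -> nat) i :
  qpair (fund i) (\sum_j simple j *+ c j) = (c i)%:R.
Proof.
rewrite qpair_sumr (bigD1 i) //= qpairMnr fund_simple eqxx mulr1.
rewrite big1 ?addr0 // => j ji.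
by rewrite qpairMnr fund_simple eq_sym (negbTE ji) mulr0.
Qed.

Lemma nat_comb_cf a i : nat_comb simple a -> exists n : nat, qpair (fund i) a = n%:R.
Proof. by case=> c ->; exists (c i); rewrite cf_comb. Qed.

Lemma nat_comb_cf_ge0 a i : nat_comb simple a -> 0 <= qpair (fund i) a.
Proof. by move/(nat_comb_cf i) => [n ->]; rewrite ler0n. Qed.

Lemma nat_comb_ht a : nat_comb simple a -> 0 <= ht a.
Proof. by move=> H; apply: sumr_ge0 => i _; apply: nat_comb_cf_ge0. Qed.

Lemma cf_root_int a i : a \in roots -> qpair (fund i) a \is a Num.int.
Proof.
move=> aR; case: (roots_signed aR) => /(nat_comb_cf i)[n].
  by move->; rewrite rpred_nat.
by rewrite qpairNr => /(canRL (@opprK _)) ->; rewrite rpredN rpred_nat.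
Qed.

Lemma root_neq0 a : a \in roots -> a != 0.
Proof.
move=> aR; apply/eqP => a0; have := pair_coroot aR.
by rewrite {2}a0 /pair mulmx0 mxE.
Qed.

Lemma root_opp a : a \in roots -> - a \in roots.
Proof.
move=> aR; have := roots_reflect aR aR; rewrite pair_coroot //.
by rewrite scaler_nat mulr2n opprD addrA subrr sub0r.
Qed.

Lemma root_oppE a : (- a \in roots) = (a \in roots).
Proof. by apply/idP/idP => /root_opp //; rewrite opprK. Qed.

Lemma corootN a : a \in roots -> coroot (- a) = - coroot a.
Proof.
move=> aR; have := coroots_reflect aR aR; rewrite pair_coroot //.
by rewrite !scaler_nat !mulr2n !opprD !addrA !subrr !sub0r.
Qed.

Lemma root_ht_neq0 a : a \in roots -> ht a != 0.
Proof.
have K b : nat_comb simple b -> ht b = 0 -> b = 0.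
  move=> H /eqP; rewrite psumr_eq0 => [/allP b0|i _]; last exact: nat_comb_cf_ge0.
  apply: cf_inj => i; rewrite qpair0r; apply/eqP.
  exact: b0 (mem_index_enum i).
move=> aR; apply/eqP => a0; have /eqP := root_neq0 aR; apply.
case: (roots_signed aR) => H; first exact: K.
by rewrite -[a]opprK (K _ H) ?oppr0 // htN a0 oppr0.
Qed.

Lemma root_pos a : a \in roots -> 0 < ht a -> nat_comb simple a.
Proof.
move=> aR a0; case: (roots_signed aR) => // /nat_comb_ht.
by rewrite htN oppr_ge0 leNgt a0.
Qed.

Lemma root_pos_cf a i : a \in roots -> 0 < ht a -> 0 <= qpair (fund i) a.
Proof. by move=> aR a0; apply/nat_comb_cf_ge0/root_pos. Qed.

Lemma root_cf_pos a i : a \in roots -> 0 < qpair (fund i) a -> 0 < ht a.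
Proof.
move=> aR a0; have := root_ht_neq0 aR; rewrite neq_lt => /orP[H|//].
have : 0 <= qpair (fund i) (- a) by rewrite root_pos_cf ?root_opp // htN oppr_gt0.
by rewrite qpairNr oppr_ge0 leNgt a0.
Qed.

Lemma root_ht_int a : a \in roots -> ht a \is a Num.int.
Proof. by move=> aR; apply: rpred_sum => i _; apply: cf_root_int. Qed.

Lemma cf_highest a i : a \in roots -> qpair (fund i) a <= qpair (fund i) Theta.
Proof.
move=> aR; rewrite -subr_ge0 -qpairBr; apply: nat_comb_cf_ge0.
exact: highest_max.
Qed.

Lemma ht_highest a : a \in roots -> ht a <= ht Theta.
Proof. by move=> aR; apply: ler_sum => i _; apply: cf_highest. Qed.

Let ThetaR : Theta \in roots := highest_root D.

Lemma ht_highest_gt0 : 0 < ht Theta.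
Proof.
have := ht_highest (simple_root D (Ordinal (rank_gt0 D))).
by rewrite ht_simple; apply: lt_le_trans.
Qed.

(* A pair [(a, k)] stands for the affine function [y |-> <y, a> + k], and [aht]
   is the linear functional with value 1 on each affine simple root, so that the
   sign of [aht f] is the sign of the affine root [f] (lemma [aht_gt0]). *)
Definition aht (f : 'cV[int]_r * rat) : rat := ht f.1 + (1 + ht Theta) * f.2.
Definition is_aroot (f : 'cV[int]_r * rat) := (f.1 \in roots) && (f.2 \is a Num.int).
(** Composition of the affine function [f] with the inverse of [g], as [aval_aaction] confirms. *)
Definition aaction (g : aff r) (f : 'cV[int]_r * rat) :=
  (lin g *m f.1, f.2 - qpair (tr g) (lin g *m f.1)).
(** The affine reflection in the hyperplane where [f] vanishes; see [act_areflection]. *)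
Definition areflection (f : 'cV[int]_r * rat) : aff r :=
  (transl (- f.2 *: map_mx intr (coroot f.1)) * refl D f.1)%g.
Definition asimple (o : option 'I_r) : 'cV[int]_r * rat :=
  if o is Some i then (simple i, 0) else (- Theta, 1).
Implicit Types (x y : 'rV[rat]_r) (f : 'cV[int]_r * rat) (o : option 'I_r) (g h : aff r).

(* The automorphisms of the affine root system, among them the elements of the
   extended affine Weyl group. *)
Definition good g := [/\ forall a, (lin g *m a \in roots) = (a \in roots),
  {in roots, forall a, coroot (lin g *m a) = coroot a *m linV g} &
  {in roots, forall a, qpair (tr g) a \is a Num.int}].

Lemma linKm g a : linV g *m (lin g *m a) = a.
Proof. by rewrite mulmxA linVK mul1mx. Qed.
Lemma linVKm g a : lin g *m (linV g *m a) = a.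
Proof. by rewrite mulmxA linK mul1mx. Qed.

Lemma trM g h : tr (g * h)%g = act_cowt g (tr h).
Proof. by []. Qed.

Lemma qpair_act g x m :
  qpair (act_cowt g x) m = qpair x (linV g *m m) + qpair (tr g) m.
Proof. by rewrite qpairDl qpair_mx. Qed.

Lemma act_cowtM g h x : act_cowt (g * h)%g x = act_cowt g (act_cowt h x).
Proof.
by rewrite /act_cowt mulmxDl -mulmxA -map_mxM addrA.
Qed.

Lemma act_cowt1 x : act_cowt (1%g : aff r) x = x.
Proof. by rewrite /act_cowt map_mx1 mulmx1 addr0. Qed.

Lemma good1 : good 1%g.
Proof.
by split=> [a|a _|a _]; rewrite ?mul1mx ?mulmx1 // qpair0l.
Qed.

Lemma goodM g h : good g -> good h -> good (g * h)%g.
Proof.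
move=> [g1 g2 g3] [h1 h2 h3]; split=> [a|a aR|a aR].
- by rewrite linM -mulmxA g1 h1.
- by rewrite linM -mulmxA g2 ?h1 // h2 // mulmxA.
have aR' : linV g *m a \in roots by rewrite -g1 linVKm.
by rewrite trM qpair_act; apply: rpredD; [apply: h3|apply: g3].
Qed.

Lemma goodV g : good g -> good (g^-1)%g.
Proof.
move=> [g1 g2 g3]; split=> [a|a aR|a aR].
- by rewrite linVE -[LHS]g1 linVKm.
- have aR' : linV g *m a \in roots by rewrite -g1 linVKm.
  have := g2 _ aR'; rewrite linVKm => ->.
  by rewrite -mulmxA (_ : linV g *m linV g^-1%g = 1%:M) ?mulmx1 //; apply: linVK.
by rewrite qpairNl rpredN qpair_mx g3 ?g1.
Qed.

Lemma good_transl y : coweight_lattice D y -> good (transl y).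
Proof. by move=> yP; split=> [a|a _|a]; rewrite ?mul1mx ?mulmx1 //; apply: yP. Qed.

Lemma outer_reflK a : a \in roots ->
  (1%:M - a *m coroot a) *m (1%:M - a *m coroot a) = 1%:M.
Proof.
move=> aR.
have E : a *m coroot a *m (a *m coroot a) = 2 *: (a *m coroot a).
  by rewrite mulmxA pair_outer pair_coroot // scalemxAl.
rewrite mulmxBl mul1mx mulmxBr mulmx1 E scaler_nat mulr2n.
by rewrite opprB addrK subrK.
Qed.

Lemma refl_val a : a \in roots ->
  val (refl D a) = (1%:M - a *m coroot a, 1%:M - a *m coroot a, 0).
Proof.
move=> aR; rewrite /refl /reflection /insubd insubT //=.
by rewrite outer_reflK.
Qed.

Lemma lin_refl a m : a \in roots ->
  lin (refl D a) *m m = m - pair (coroot a) m *: a.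
Proof.
by move=> aR; rewrite /lin refl_val //= mulmxBl mul1mx pair_outer.
Qed.

Lemma linV_refl a : a \in roots -> linV (refl D a) = lin (refl D a).
Proof. by move=> aR; rewrite /lin /linV refl_val. Qed.

Lemma tr_refl a : a \in roots -> tr (refl D a) = 0.
Proof. by move=> aR; rewrite /tr refl_val. Qed.

Lemma coroot_mul_refl a c : a \in roots ->
  c *m linV (refl D a) = c - pair c a *: coroot a.
Proof.
move=> aR; rewrite /linV refl_val //= mulmxBr mulmx1 mulmxA.
by rewrite (mx11_scalar (c *m a)) mul_scalar_mx.
Qed.

Lemma refl_invol a : a \in roots -> (refl D a * refl D a = 1)%g.
Proof.
move=> aR; apply: val_inj; rewrite /= /act_cowt /lin /linV /tr refl_val //=.
by rewrite outer_reflK // mul0mx addr0.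
Qed.

Lemma good_refl a : a \in roots -> good (refl D a).
Proof.
move=> aR; have S b : b \in roots -> lin (refl D a) *m b \in roots.
  by move=> bR; rewrite lin_refl // roots_reflect.
split=> [b|b bR|b bR].
- apply/idP/idP => [|/S//]; move/S.
  by rewrite mulmxA -linM refl_invol // lin1 mul1mx.
- by rewrite lin_refl // coroots_reflect // coroot_mul_refl.
by rewrite tr_refl // qpair0l.
Qed.

Lemma linV_conj_outer g a : a \in roots -> good g ->
  lin g *m (1%:M - a *m coroot a) *m linV g =
  1%:M - (lin g *m a) *m coroot (lin g *m a).
Proof.
move=> aR [_ g2 _]; rewrite g2 // mulmxBr mulmx1 mulmxBl linK.
by rewrite !mulmxA.
Qed.

Lemma aff_eq g h : lin g = lin h -> tr g = tr h -> g = h.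
Proof.
move=> E1 E2; have E3 : linV g = linV h.
  by rewrite -[linV g]mulmx1 -(linK h) -E1 mulmxA linVK mul1mx.
by apply: val_inj; rewrite [val g]surjective_pairing [(val g).1]surjective_pairing
  [val h]surjective_pairing [(val h).1]surjective_pairing; congr (_, _, _).
Qed.

Lemma lin_areflection f : f.1 \in roots ->
  lin (areflection f) = 1%:M - f.1 *m coroot f.1.
Proof. by move=> aR; rewrite linM mul1mx /lin refl_val. Qed.

Lemma linV_areflection f : f.1 \in roots ->
  linV (areflection f) = 1%:M - f.1 *m coroot f.1.
Proof. by move=> aR; rewrite /linV /= mulmx1 /linV refl_val. Qed.

Lemma tr_areflection f : f.1 \in roots ->
  tr (areflection f) = - f.2 *: map_mx intr (coroot f.1).
Proof.
by move=> aR; rewrite trM /act_cowt tr_refl // mul0mx add0r.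
Qed.

Lemma act_areflection f x : f.1 \in roots ->
  act_cowt (areflection f) x =
  x - (qpair x f.1 + f.2) *: map_mx intr (coroot f.1).
Proof.
move=> aR; rewrite /act_cowt linV_areflection // tr_areflection //.
rewrite map_mxB map_mx1 mulmxBr mulmx1 map_mxM mulmxA.
by rewrite (mx11_scalar (x *m _)) mul_scalar_mx scaleNr -addrA -opprD -scalerDl.
Qed.

Lemma lin_areflection_mul f m : f.1 \in roots ->
  lin (areflection f) *m m = m - pair (coroot f.1) m *: f.1.
Proof. by move=> aR; rewrite lin_areflection // mulmxBl mul1mx pair_outer. Qed.

Lemma areflection_conj g f : good g -> is_aroot f ->
  (g * areflection f * g^-1 = areflection (aaction g f))%g.
Proof.
case: f => a k gg /andP[/= aR kZ]; have [g1 g2 g3] := gg.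
apply: aff_eq.
  by rewrite (linM (g * _)%g) (linM g) !lin_areflection /= ?g1 // linVE linV_conj_outer.
rewrite (trM (g * _)%g) act_cowtM act_areflection //= tr_areflection ?g1 //=.
rewrite qpairNl qpair_mx g2 // map_mxM /act_cowt mulmxBl mulNmx -!mulmxA.
rewrite -(map_mxM _ (lin g)) linK map_mx1 mulmx1 -scalemxAl addrAC addNr add0r -scaleNr.
by rewrite !opprD !opprK addrC.
Qed.

Lemma aaction1 f : aaction 1%g f = f.
Proof. by case: f => a k; rewrite /aaction /= mul1mx qpair0l subr0. Qed.

Lemma aactionM g h f : aaction (g * h)%g f = aaction g (aaction h f).
Proof.
case: f => a k; rewrite /aaction /= linM mulmxA; congr (_, _).
by rewrite trM qpair_act -!mulmxA linKm opprD addrA.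
Qed.

Lemma aroot_aaction g f : good g -> is_aroot (aaction g f) = is_aroot f.
Proof.
case: f => a k [g1 g2 g3]; rewrite /is_aroot /= g1.
by case aR : (a \in roots) => //=; rewrite rpredBr ?g3 ?g1.
Qed.

Definition aopp f := (- f.1, - f.2).

Lemma aht_opp f : aht (aopp f) = - aht f.
Proof. by rewrite /aht /= htN mulrN opprD. Qed.
Lemma aroot_opp f : is_aroot (aopp f) = is_aroot f.
Proof. by rewrite /is_aroot /= root_oppE rpredN. Qed.
Lemma aaction_opp g f : aaction g (aopp f) = aopp (aaction g f).
Proof. by rewrite /aaction /aopp /= mulmxN qpairNr opprD opprK. Qed.

Lemma aval_aaction g f x :
  qpair (act_cowt g x) (aaction g f).1 + (aaction g f).2 = qpair x f.1 + f.2.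
Proof. by rewrite /aaction /= qpair_act linKm addrA addrAC addrK. Qed.

Lemma asimple_root o : is_aroot (asimple o).
Proof.
case: o => [i|]; rewrite /is_aroot /=; first by rewrite simple_root.
by rewrite root_oppE ThetaR.
Qed.

Lemma aht_asimple o : aht (asimple o) = 1.
Proof.
case: o => [i|]; rewrite /aht /=; first by rewrite ht_simple mulr0 addr0.
by rewrite htN mulr1 addrCA addNr addr0.
Qed.

Lemma affine_gen_areflection o : affine_gen D o = areflection (asimple o).
Proof.
case: o => [i|].
  have aR := simple_root D i; apply: aff_eq.
    by rewrite lin_areflection // /lin refl_val.
  by rewrite tr_areflection //= tr_refl // oppr0 scale0r.
have aR : - Theta \in roots by rewrite root_oppE.
apply: aff_eq.
  rewrite lin_areflection //= (linM (transl _)) mul1mx /lin refl_val //.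
  by rewrite corootN // mulNmx mulmxN opprK.
rewrite tr_areflection //= (trM (transl _)) /act_cowt tr_refl // mul0mx add0r.
by rewrite corootN // map_mxN scaleN1r opprK.
Qed.

Lemma good_gen o : good (affine_gen D o).
Proof.
case: o => [i|] /=; first by apply: good_refl; apply: simple_root.
apply: goodM; last exact: good_refl.
by apply: good_transl => a aR; rewrite qpair_intr rpred_int.
Qed.

Lemma areflection_invol f : f.1 \in roots -> (areflection f * areflection f = 1)%g.
Proof.
move=> aR; apply: aff_eq.
  by rewrite linM lin_areflection // outer_reflK.
rewrite trM act_areflection // tr_areflection // qpairZl qpair_intr pair_coroot //.
rewrite -[X in X - _]scale1r scalerA -scalerBl.
by rewrite (_ : _ - _ = 0) ?scale0r //; ring.
Qed.

Lemma genK o : (affine_gen D o * affine_gen D o = 1)%g.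
Proof.
rewrite affine_gen_areflection areflection_invol //.
by case/andP: (asimple_root o).
Qed.

Lemma genV o : ((affine_gen D o)^-1 = affine_gen D o)%g.
Proof. by rewrite -[RHS]mul1g -(mulVg (affine_gen D o)) -mulgA genK mulg1. Qed.

Lemma aaction_reflection f f' : f.1 \in roots ->
  aaction (areflection f) f' =
  (f'.1 - pair (coroot f.1) f'.1 *: f.1, f'.2 - (pair (coroot f.1) f'.1)%:~R * f.2).
Proof.
move=> aR; rewrite /aaction lin_areflection_mul //= tr_areflection //.
rewrite qpairZl qpair_intr pairB pairZ pair_coroot //; congr (_, _).
by rewrite rmorphB rmorphM /=; ring.
Qed.

Lemma aaction_refl_self f : f.1 \in roots -> aaction (areflection f) f = aopp f.
Proof.
move=> aR; rewrite aaction_reflection // pair_coroot // /aopp; congr (_, _).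
  by rewrite scaler_nat mulr2n opprD addrA subrr sub0r.
by ring.
Qed.

Lemma asimple_inj : injective asimple.
Proof.
move=> [i|] [j|] //=.
case=> /(congr1 (qpair (fund i))); rewrite !fund_simple eqxx.
by case: eqP => [->|_ /eqP]; rewrite ?oner_eq0.
Qed.

Let bound_pos (T x z : rat) :
  - x <= T -> 0 < T -> 1 <= z -> 0 < x + (1 + T) * z.
Proof.
move=> h1 h2 h3; have : 0 <= T * (z - 1) by rewrite mulr_ge0 ?subr_ge0 // ltW.
by lra.
Qed.

(** Heights of roots lie between [- ht Theta] and [ht Theta], so with the factor [1 + ht Theta] a
    nonzero integer constant term outweighs the height. *)
Lemma aht_gt0 f : is_aroot f -> (0 < aht f) = (0 < f.2) || (f.2 == 0) && (0 < ht f.1).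
Proof.
case: f => a k /andP[/= aR /intrP[z ->]].
have h1 := ht_highest aR; have h2 := ht_highest (root_opp aR).
have hT := ht_highest_gt0; rewrite htN in h2.
rewrite /aht /= intr_eq0 ltr0z; case: (ltrgt0P z) => /= z0.
- by apply: bound_pos => //; rewrite (ler_int _ 1); lia.
- apply/negbTE; rewrite -leNgt -oppr_ge0 opprD -mulrN ltW //.
  by apply: bound_pos; rewrite ?opprK // -rmorphN (ler_int _ 1); lia.
by rewrite z0 mulr0 addr0.
Qed.

Lemma aht_neq0 f : is_aroot f -> aht f != 0.
Proof.
move=> fR; have := aht_gt0 fR; have := @aht_gt0 (aopp f).
rewrite aroot_opp fR aht_opp oppr_gt0 => /(_ isT) /=.
case: f fR => a k /andP[/= /root_ht_neq0 h0 _].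
rewrite htN !oppr_gt0 oppr_eq0.
case: (ltrgt0P k) => _ /=; last case: (ltrgt0P (ht a)) h0 => //= _ _;
  by case: ltrgt0P.
Qed.

Lemma aht_opp_gt0 f : is_aroot f -> (0 < aht (aopp f)) = ~~ (0 < aht f).
Proof.
by move=> /aht_neq0 f0; rewrite aht_opp oppr_gt0 -leNgt le_eqVlt (negbTE f0).
Qed.

(** With a negative pairing, reflecting [a] in [Theta] would give a root higher than [Theta]. *)
Lemma cartan_highest_ge0 a : a \in roots -> 0 < ht a -> 0 <= pair (coroot Theta) a.
Proof.
move=> aR a0; rewrite leNgt; apply/negP => n0.
have := ht_highest (roots_reflect ThetaR aR).
have {}n0 : (pair (coroot Theta) a)%:~R <= -1 :> rat.
  by rewrite (ler_int _ _ (-1)); lia.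
have hT := ht_highest_gt0; rewrite htB htZ => H; nra.
Qed.

(** With [n] the pairing, [n Theta - a] is again a root, so its coefficients are at most those of
    [Theta]; for [n] at least 2 this pushes the coefficients of [a] up to those of [Theta]. *)
Lemma cartan_highest_ge2 a : a \in roots -> 2 <= pair (coroot Theta) a -> a = Theta.
Proof.
move=> aR n2; apply: cf_inj => i; apply/eqP; rewrite eq_le cf_highest //=.
have := cf_highest i (root_opp (roots_reflect ThetaR aR)).
rewrite qpairNr qpairBr qpairZr.
have T0 := root_pos_cf i ThetaR ht_highest_gt0.
have {}n2 : 2 <= (pair (coroot Theta) a)%:~R :> rat by rewrite (ler_int _ 2).
by move=> H; nra.
Qed.

(** The source of all length computations: a simple reflection permutes the positive affine roots
    other than its own. *)
Lemma gen_preserves_pos o f : is_aroot f -> f != asimple o ->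
  0 < aht f -> 0 < aht (aaction (affine_gen D o) f).
Proof.
move=> fR fo f0; have := fR; rewrite -(aroot_aaction _ (good_gen o)) => f'R.
rewrite (aht_gt0 f'R); move: f0; rewrite (aht_gt0 fR).
have oR : (asimple o).1 \in roots by case/andP: (asimple_root o).
rewrite affine_gen_areflection aaction_reflection // in f'R *.
case: f fR fo f'R => a k /andP[/= aR /intrP[z ->]] fo /andP[/= a'R _].
case: o oR fo a'R => [i|] /= oR fo a'R.
  rewrite mulr0 subr0; case/orP => [->//|/andP[z0 a0]].
  rewrite z0 orbC /=; apply/orP; left; move: z0 fo; rewrite intr_eq0 => /eqP -> fo.
  (* The reflection changes only the coefficient on [simple i]. A positive coefficient elsewhere
     survives; without one, [a] is a multiple of [simple i] and reducedness of the root system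
     applies. *)
  have [[j /andP[ji aj]]|H] := pselect (exists j, (j != i) && (0 < qpair (fund j) a)).
    apply: (root_cf_pos (i := j)) => //.
    by rewrite qpairBr qpairZr fund_simple (negbTE ji) mulr0 subr0.
  have aj j : j != i -> qpair (fund j) a = 0.
    move=> ji; apply/eqP; rewrite eq_le root_pos_cf // andbT leNgt.
    by apply/negP => aj; apply: H; exists j; rewrite ji.
  have /intrP[n En] := cf_root_int i aR.
  have Ea : a = n *: simple i.
    apply: cf_inj => j; rewrite qpairZr fund_simple.
    by case: eqVneq => [->|ji]; rewrite ?mulr1 ?mulr0 ?En ?aj.
  have [E|E] : simple i = a \/ simple i = - a.
    have H1 := roots_reduced aR (simple_root D i).
    by apply: (H1 1 n); rewrite ?scale1r.
  - by move: fo; rewrite -E eqxx.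
  - by move: a0; rewrite -[a]opprK -E htN ht_simple.
rewrite corootN // pairNl scaleNr scalerN opprK rmorphN mulNr mulr1 opprK.
set n := pair (coroot Theta) a.
have {}a'R : a - n *: Theta \in roots by apply: roots_reflect.
rewrite -(rmorphD intr) /= !intr_eq0 !ltr0z.
(* The image is [(a - n Theta, z + n)]. If [n] is negative then so is [a], hence [z] is positive;
   and [n <= -2] occurs only for [a = - Theta], where [z = 1] is the excluded simple root. *)
have [n0 P|n0|n0] := ltrgt0P n; last 1 first.
- by rewrite n0 addr0 scale0r subr0.
- by apply/orP; left; case/orP: P => [|/andP[/eqP]]; lia.
have a0 : ht a < 0.
  have := root_ht_neq0 aR; rewrite neq_lt => /orP[//|/(cartan_highest_ge0 aR)].
  by rewrite -/n; lia.
have := a0; rewrite ltNge le_eqVlt => /norP[_ /negbTE ->].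
rewrite andbF orbF => z0; case: (ltrgtP (z + n) 0) => //= zn.
  have n2 : 2 <= pair (coroot Theta) (- a) by rewrite pairN -/n; lia.
  have E := cartan_highest_ge2 (root_opp aR) n2.
  have En : n = -2 by rewrite /n -[a]opprK E pairN pair_coroot.
  have z1 : z = 1 by lia.
  by move: fo; rewrite z1 -E opprK eqxx.
have En : (n = -1 \/ n <= -2)%R by lia.
have := root_ht_neq0 a'R; rewrite neq_lt => /orP[|//]; rewrite htB htZ => H.
have := ht_highest (root_opp aR); rewrite htN.
case: En H => [->|n2 _ _]; first by lra.
have {}n2 : 2 <= pair (coroot Theta) (- a) by rewrite pairN -/n; lia.
have E := cartan_highest_ge2 (root_opp aR) n2.
have -> : n = -2 by rewrite /n -[a]opprK E pairN pair_coroot.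
by rewrite -[a]opprK E htN; have := ht_highest_gt0; lra.
Qed.

Lemma aaction_gen_asimple o : aaction (affine_gen D o) (asimple o) = aopp (asimple o).
Proof.
rewrite affine_gen_areflection aaction_refl_self //.
by case/andP: (asimple_root o).
Qed.

End RootSystem.

(** * Words and reflections *)

Section Words.
Local Open Scope group_scope.
Variables (I : choiceType) (G : groupType) (s : I -> G).
Hypothesis sK : forall i, (s i * s i = 1)%g.
Implicit Types (g h : G) (t : seq I).

Lemma word_nil : word s [::] = 1.
Proof. by rewrite /word big_nil. Qed.
Lemma word_cons i t : word s (i :: t) = s i * word s t.
Proof. by rewrite /word big_cons. Qed.
Lemma word_cat t t' : word s (t ++ t') = word s t * word s t'.
Proof. by rewrite /word big_cat. Qed.
Lemma word1 i : word s [:: i] = s i.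
Proof. by rewrite word_cons word_nil mulg1. Qed.
Lemma word_rcons t i : word s (rcons t i) = word s t * s i.
Proof. by rewrite -cats1 word_cat word1. Qed.

Lemma involV i : (s i)^-1 = s i.
Proof. by rewrite -[RHS]mul1g -(mulVg (s i)) -mulgA sK mulg1. Qed.

Lemma word_rev t : word s (rev t) = (word s t)^-1.
Proof.
elim: t => [|i t IH]; first by rewrite word_nil invg1.
by rewrite rev_cons word_rcons IH word_cons invgM involV.
Qed.

Definition generated g := exists t, word s t = g.

Lemma generated1 : generated 1. Proof. by exists [::]; rewrite word_nil. Qed.
Lemma generated_gen i : generated (s i). Proof. by exists [:: i]; rewrite word1. Qed.
Lemma generatedM g h : generated g -> generated h -> generated (g * h).
Proof. by move=> [t <-] [t' <-]; exists (t ++ t'); rewrite word_cat. Qed.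
Lemma generatedV g : generated g -> generated g^-1.
Proof. by move=> [t <-]; exists (rev t); rewrite word_rev. Qed.
Lemma generated_word t : generated (word s t). Proof. by exists t. Qed.

Lemma lengthP g : generated g ->
  (exists t, word s t = g /\ size t = length s g) /\
  forall t, word s t = g -> (length s g <= size t)%N.
Proof.
move=> [t0 gt0]; rewrite /length; case: pselect => [ex|[]]; last first.
  by exists (size t0); apply/asboolP; exists t0.
case: ex_minnP => n /asboolP H min; split=> // t gt.
by apply: min; apply/asboolP; exists t.
Qed.

Lemma reduced_exists g : generated g -> exists t, reduced_word s g t.
Proof. by case/lengthP. Qed.

Lemma length_word t : (length s (word s t) <= size t)%N.
Proof. by case: (lengthP (generated_word t)) => _; apply. Qed.

Lemma length1 : length s 1 = 0.
Proof. by have := length_word [::]; rewrite word_nil /=; case: length. Qed.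

Lemma length_eq0 g : generated g -> length s g = 0 -> g = 1.
Proof.
move=> /reduced_exists[t [<- E]] L; move: E; rewrite L => /size0nil ->.
exact: word_nil.
Qed.

Lemma lengthM g h : generated g -> generated h ->
  (length s (g * h) <= length s g + length s h)%N.
Proof.
move=> /reduced_exists[t [<- <-]] /reduced_exists[t' [<- <-]].
by rewrite -word_cat -size_cat length_word.
Qed.

Lemma lengthV g : generated g -> length s g^-1 = length s g.
Proof.
have H h : generated h -> (length s h^-1 <= length s h)%N.
  by move=> /reduced_exists[t [<- <-]]; rewrite -word_rev -(size_rev t) length_word.
move=> gg; apply/eqP; rewrite eqn_leq H //=.
by rewrite -{1}[g]invgK H //; apply: generatedV.
Qed.

Lemma reduced_cat t t' : reduced_word s (word s (t ++ t')) (t ++ t') ->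
  reduced_word s (word s t) t /\ reduced_word s (word s t') t'.
Proof.
move=> [_]; rewrite size_cat word_cat => E.
have := lengthM (generated_word t) (generated_word t').
have := length_word t; have := length_word t'.
by move=> h1 h2 h3; split; split=> //; lia.
Qed.

Lemma reduced_rev g t : reduced_word s g t -> reduced_word s g^-1 (rev t).
Proof.
move=> [gt st]; split; first by rewrite word_rev gt.
by rewrite size_rev st lengthV // -gt; apply: generated_word.
Qed.

End Words.

(** * The exchange condition and additivity of lengths *)

Section Coxeter.
Local Open Scope group_scope.
(** The map [e] selects the generators: [Some] gives the finite Weyl group and [id] the affine one,
    so one set of lemmas serves both length functions. *)
Variables (r : nat) (D : simple_datum r) (I : choiceType) (e : I -> option 'I_r).
Local Notation gen := (fun i => affine_gen D (e i)).
Local Notation al i := (asimple D (e i)).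
Local Notation aht := (aht D).
Local Notation roots := (Defs.roots D).
Local Notation good := (good D).
Local Notation refl := (areflection D).
Local Notation is_aroot := (is_aroot D).
Implicit Types (f : 'cV[int]_r * rat) (i j : I) (t : seq I) (g h x : aff r).

Let genK i : (gen i * gen i = 1)%g := genK D (e i).

Lemma good_word t : good (word gen t).
Proof.
elim: t => [|i t IH]; first by rewrite word_nil; apply: good1.
by rewrite word_cons; apply: goodM => //; apply: good_gen.
Qed.

Lemma good_generated g : generated gen g -> good g.
Proof. by move=> [t <-]; apply: good_word. Qed.

Lemma aroot_word t f : is_aroot f -> is_aroot (aaction (word gen t) f).
Proof. by move=> fR; rewrite aroot_aaction //; apply: good_word. Qed.

Lemma areflectionV f : f.1 \in roots -> (refl f)^-1%g = refl f.
Proof.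
move=> fR; rewrite -[RHS]mul1g -(mulVg (refl f)) -mulgA areflection_invol //.
by rewrite mulg1.
Qed.

Lemma areflection_move g f : good g -> is_aroot f ->
  (refl (aaction g f) * g = g * refl f)%g.
Proof. by move=> gg fR; rewrite -areflection_conj // mulgVK. Qed.

(** Follow [f] through the letters: by [gen_preserves_pos] it turns negative only at a letter whose
    simple root it has become, and there [refl f] deletes that letter. *)
Lemma left_exchange t f : is_aroot f -> 0 < aht f ->
  ~~ (0 < aht (aaction (word gen t)^-1%g f)) ->
  exists k, (k < size t)%N /\ (refl f * word gen t = word gen (take k t ++ drop k.+1 t))%g.
Proof.
elim: t f => [|i t IH] f fR f0.
  by rewrite word_nil invg1 aaction1 f0.
rewrite word_cons invgM aactionM genV => H.
have [Ef|fi] := eqVneq f (al i).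
  exists 0; split=> //=; rewrite drop0 Ef -affine_gen_areflection mulgA genK.
  by rewrite mul1g.
have fR' : is_aroot (aaction (gen i) f) by rewrite aroot_aaction //; apply: good_gen.
have [k [kt E]] := IH _ fR' (gen_preserves_pos fR fi f0) H.
exists k.+1; split=> //=; rewrite word_cons -E /=.
have := areflection_move (good_gen D (e i)) fR'.
by rewrite -aactionM genK aaction1 /= => M; rewrite [LHS]mulgA M -mulgA.
Qed.

Lemma size_remove (T : eqType) k (t : seq T) : (k < size t)%N ->
  (size (take k t ++ drop k.+1 t)).+1 = size t.
Proof. by move=> kt; rewrite size_cat size_take size_drop kt; lia. Qed.

Lemma length_reflection_lt g f : generated gen g -> is_aroot f -> 0 < aht f ->
  ~~ (0 < aht (aaction g^-1%g f)) ->
  generated gen (refl f * g)%g /\ (length gen (refl f * g)%g < length gen g)%N.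
Proof.
move=> /reduced_exists[t [gt st]] fR f0; rewrite -gt => /(left_exchange fR f0)[k [kt ->]].
split; first exact: generated_word.
by rewrite gt -st -(size_remove kt) ltnS length_word.
Qed.

Lemma genL_length_lt i g : generated gen g -> ~~ (0 < aht (aaction g^-1%g (al i))) ->
  length gen g = (length gen (gen i * g)%g).+1.
Proof.
move=> gg H; have := length_reflection_lt gg (asimple_root D (e i)) _ H.
rewrite aht_asimple ltr01 => /(_ isT)[_]; rewrite -affine_gen_areflection => L.
have := lengthM (generated_gen gen i) (generatedM (generated_gen gen i) gg).
rewrite mulgA genK mul1g; have := length_word gen [:: i]; rewrite word1 /=.
move: L => /=; move: (length _ g) (length _ (affine_gen D (e i) * g)%g).
by move: (length _ (affine_gen D (e i))) => a b c; lia.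
Qed.

Lemma genL_length_gt i g : generated gen g -> 0 < aht (aaction g^-1%g (al i)) ->
  length gen (gen i * g)%g = (length gen g).+1.
Proof.
move=> gg H; have sg := generatedM (generated_gen gen i) gg.
rewrite (@genL_length_lt i) //; first by rewrite mulgA genK mul1g.
rewrite invgM aactionM genV aaction_gen_asimple aaction_opp aht_opp_gt0 ?negbK //.
rewrite aroot_aaction ?asimple_root //.
by apply: good_generated; apply: (generatedV genK).
Qed.

Lemma genR_length i g : generated gen g -> length gen (g * gen i)%g =
  length gen (gen i * g^-1)%g.
Proof.
move=> gg; rewrite -[LHS](lengthV genK) //; first by rewrite invgM genV.
by apply: generatedM => //; apply: generated_gen.
Qed.

Lemma genR_length_lt i g : generated gen g -> ~~ (0 < aht (aaction g (al i))) ->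
  length gen g = (length gen (g * gen i)%g).+1.
Proof.
move=> gg H; rewrite genR_length // -(lengthV genK gg).
by apply: genL_length_lt; rewrite ?invgK //; apply: (generatedV genK).
Qed.

Lemma genR_length_gt i g : generated gen g -> 0 < aht (aaction g (al i)) ->
  length gen (g * gen i)%g = (length gen g).+1.
Proof.
move=> gg H; rewrite genR_length // -(lengthV genK gg).
by apply: genL_length_gt; rewrite ?invgK //; apply: (generatedV genK).
Qed.

Lemma genR_desc i g : generated gen g ->
  (0 < aht (aaction g (al i))) = (length gen g < length gen (g * gen i)%g)%N.
Proof.
move=> gg; have [H|H] := boolP (0 < aht _); first by rewrite genR_length_gt ?ltnSn.
by have := genR_length_lt gg H => /= ->; rewrite ltnNge leqnSn.
Qed.

(* If [f] is an inversion of [h] but not of [g * h], then [- h f] is an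
   inversion of [g], and deleting a letter from each of [g] and [h] leaves a
   word for [g * h]. *)
Lemma additive_inversion g h f : generated gen g -> generated gen h ->
  length gen (g * h)%g = (length gen g + length gen h)%N ->
  is_aroot f -> 0 < aht f -> ~~ (0 < aht (aaction h f)) ->
  ~~ (0 < aht (aaction (g * h)%g f)).
Proof.
move=> gg gh L fR f0 hf; apply/negP => ghf.
set f' := aopp (aaction h f).
have hfR : is_aroot (aaction h f) by rewrite aroot_aaction //; apply: good_generated.
have f'R : is_aroot f' by rewrite aroot_opp.
have f'0 : 0 < aht f' by rewrite aht_opp_gt0.
have refl_opp b : is_aroot b -> refl (aopp b) = refl b.
  case: b => a k /andP[/= aR _]; apply: aff_eq.
    by rewrite !lin_areflection ?root_oppE //= corootN // mulmxN mulNmx opprK.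
  by rewrite !tr_areflection ?root_oppE //= corootN // map_mxN scaleNr scalerN opprK.
have Vg := generatedV genK gg; have Vh := generatedV genK gh.
have [|G1 L1] := @length_reflection_lt g^-1%g f' Vg f'R f'0.
  rewrite invgK aaction_opp -aactionM aht_opp_gt0 ?negbK //.
  by rewrite aroot_aaction //; apply/good_generated/generatedM.
have [|G2 L2] := @length_reflection_lt h f' gh f'R f'0.
  by rewrite aaction_opp -aactionM mulVg aaction1 aht_opp_gt0 // f0.
have {G1 L1} [G1 L1] : generated gen (g * refl f')%g /\
    (length gen (g * refl f')%g < length gen g)%N.
  have E : (g * refl f' = (refl f' * g^-1)^-1)%g.
    by rewrite invgM invgK areflectionV //; case/andP: f'R.
  by rewrite E; split; [apply: generatedV|rewrite (lengthV genK) // -(lengthV genK gg)].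
have := lengthM G1 G2; rewrite mulgA -(mulgA g) areflection_invol ?mulg1 ?L.
  by move: L1 L2; move: (length _ _) (length _ _) (length _ g) (length _ h) => *; lia.
by case/andP: f'R.
Qed.

(** Induction on a reduced word of [h]. If [h = h' s_i], the inversions of [h^-1] are those of
    [h'^-1] and the root [h' (al i)]; the first feed the induction, the last says that appending
    [s_i] to [g h'] lengthens it. *)
Lemma length_additive g h : generated gen g -> generated gen h ->
  (forall f, is_aroot f -> 0 < aht f -> ~~ (0 < aht (aaction h^-1%g f)) ->
     0 < aht (aaction g f)) ->
  length gen (g * h)%g = (length gen g + length gen h)%N.
Proof.
move=> gg /reduced_exists[t]; move: t h.
elim/last_ind => [|t i IH] h [ht st] H.
  by rewrite -ht word_nil mulg1 length1 addn0.
move: ht st; rewrite word_rcons size_rcons => ht st.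
have gh : generated gen h.
  by rewrite -ht; apply: generatedM (generated_gen _ _); apply: generated_word.
set h' := word gen t in ht; have gh' : generated gen h' by apply: generated_word.
have hi : 0 < aht (aaction h' (al i)).
  rewrite genR_desc // ht -st ltnS; exact: length_word.
have Lh : length gen h = (length gen h').+1 by rewrite -ht genR_length_gt.
have hiR : is_aroot (aaction h' (al i)) by apply: aroot_word; apply: asimple_root.
have E : length gen (g * h')%g = (length gen g + length gen h')%N.
  apply: IH; first by split=> //; lia.
  move=> f fR f0 hf; apply: H => //; rewrite -ht invgM genV aactionM.
  have hfR0 : is_aroot (aaction h'^-1%g f).
    by rewrite aroot_aaction //; apply/good_generated/(generatedV genK).
  have hfR : is_aroot (aopp (aaction h'^-1%g f)) by rewrite aroot_opp.
  have := @gen_preserves_pos _ D (e i) _ hfR.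
  rewrite aaction_opp !aht_opp_gt0 //; last first.
    by rewrite aroot_aaction //; apply: good_gen.
  apply=> //; apply/eqP => Ef.
  move: hi; rewrite -Ef aaction_opp -aactionM mulgV aaction1 aht_opp_gt0 //.
  by rewrite f0.
rewrite Lh -{1}ht mulgA genR_length_gt ?E ?addnS //.
  exact: generatedM.
rewrite aactionM; apply: H => //.
rewrite -ht invgM -aactionM mulgVK genV aaction_gen_asimple aht_opp_gt0 ?asimple_root //.
by rewrite aht_asimple ltr01.
Qed.

(** For an inversion [f] of [h^-1], the root [- h^-1 f] is an inversion of [h], hence of [g]; so
    [g h^-1] keeps [f] positive and [length_additive] applies to [g h^-1] and [h]. *)
Lemma length_additive_sub g h : generated gen g -> generated gen h ->
  (forall f, is_aroot f -> 0 < aht f -> ~~ (0 < aht (aaction h f)) ->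
     ~~ (0 < aht (aaction g f))) ->
  length gen g = (length gen (g * h^-1)%g + length gen h)%N.
Proof.
move=> gg gh H; rewrite -length_additive ?mulgVK //.
  by apply: generatedM => //; apply: (generatedV genK).
move=> f fR f0 hf; set f' := aopp (aaction h^-1%g f).
have hfR : is_aroot (aaction h^-1%g f).
  by rewrite aroot_aaction //; apply/good_generated/(generatedV genK).
have f'R : is_aroot f' by rewrite aroot_opp.
have := H f' f'R; rewrite aht_opp_gt0 // hf => /(_ isT).
rewrite !aaction_opp -!aactionM mulgV aaction1 aht_opp_gt0 // f0 => /(_ isT).
rewrite aht_opp_gt0 ?negbK // aroot_aaction //.
by apply/good_generated/generatedM => //; apply: (generatedV genK).
Qed.

End Coxeter.

(** * The finite Weyl group *)

Section WeylGroup.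
Variables (r : nat) (D : simple_datum r).
Implicit Types (a b m : 'cV[int]_r) (i j k : 'I_r) (w g h : aff r).
Local Notation roots := (Defs.roots D).
Local Notation coroot := (Defs.coroot D).
Local Notation simple := (Defs.simple D).
Local Notation ht := (ht D).
Local Notation sW := (fun i => affine_gen D (Some i)).

(** The canonical invariant form, needed to show that [<a^v, b>] and [<b^v, a>] have the same sign.
    The list of roots may have repetitions; [undup] makes the sum run over a set permuted by
    reflections. *)
Definition invariant_form a b : int :=
  \sum_(c <- undup roots) pair (coroot c) a * pair (coroot c) b.

Lemma invariant_form_refl c a b : c \in roots ->
  invariant_form (lin (refl D c) *m a) (lin (refl D c) *m b) = invariant_form a b.
Proof.
move=> cR; have [g1 g2 _] := good_refl cR.
have E d m : d \in roots -> pair (coroot d) (lin (refl D c) *m m) =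
    pair (coroot (lin (refl D c) *m d)) m.
  by move=> dR; rewrite g2 // linV_refl // pair_mx.
rewrite /invariant_form (eq_big_seq (fun d => pair (coroot (lin (refl D c) *m d)) a *
    pair (coroot (lin (refl D c) *m d)) b)); last first.
  by move=> d; rewrite mem_undup => dR; rewrite !E.
rewrite -(big_map (fun d => lin (refl D c) *m d) xpredT
  (fun d => pair (coroot d) a * pair (coroot d) b)).
apply/perm_big/uniq_perm; rewrite ?undup_uniq ?map_inj_uniq ?undup_uniq //.
  by move=> x y /(congr1 (mulmx (linV (refl D c)))); rewrite !linKm.
move=> x; rewrite mem_undup; apply/mapP/idP => [[y]|xR].
  by rewrite mem_undup => yR ->; rewrite g1.
exists (linV (refl D c) *m x); last by rewrite linVKm.
by rewrite mem_undup linV_refl // g1.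
Qed.

Lemma invariant_formC a b : invariant_form a b = invariant_form b a.
Proof. by apply: eq_bigr => c _; rewrite mulrC. Qed.

Lemma invariant_form_gt0 a : a \in roots -> 0 < invariant_form a a.
Proof.
move=> aR; rewrite /invariant_form (bigD1_seq a) ?mem_undup ?undup_uniq //=.
rewrite pair_coroot // ltr_wpDr //; apply: sumr_ge0 => c _.
by rewrite -expr2 sqr_ge0.
Qed.

Lemma invariant_form_coroot a b : b \in roots ->
  2 * invariant_form a b = pair (coroot b) a * invariant_form b b.
Proof.
move=> bR; have := invariant_form_refl a b bR.
rewrite !lin_refl // pair_coroot // (_ : b - 2 *: b = - b); last first.
  by rewrite scaler_nat mulr2n opprD addrA subrr sub0r.
set n := pair _ a => E.
suff F : invariant_form (a - n *: b) (- b) = n * invariant_form b b - invariant_form a b.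
  by move: E; rewrite F => E; lia.
rewrite /invariant_form mulr_sumr -sumrB; apply: eq_bigr => c _.
by rewrite pairB pairN pairZ; ring.
Qed.

Lemma pair_coroot_gt0 a b : a \in roots -> b \in roots ->
  0 < pair (coroot a) b -> 0 < pair (coroot b) a.
Proof.
move=> aR bR H; have := invariant_form_coroot b aR; have := invariant_form_coroot a bR.
rewrite invariant_formC => -> E.
have : 0 < pair (coroot b) a * invariant_form b b.
  by rewrite E mulr_gt0 // invariant_form_gt0.
by rewrite pmulr_lgt0 // invariant_form_gt0.
Qed.

(** Expanding [<a^v, a> = 2] along the simple roots, some [<a^v, simple j>] must be positive, and
    exchanging the two roots preserves the sign. *)
Lemma nonsimple_descent a : a \in roots -> 0 < ht a ->
  exists j, 0 < pair (coroot (simple j)) a.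
Proof.
move=> aR a0; have [c Ec] := root_pos aR a0.
apply: contrapT => H; have : pair (coroot a) a <= 0; last by rewrite pair_coroot.
rewrite {2}Ec /pair mulmx_sumr summxE; apply: sumr_le0 => j _.
rewrite -scaler_nat -scalemxAr mxE mulr_ge0_le0 // leNgt; apply/negP => H'.
by apply: H; exists j; apply: pair_coroot_gt0 H'; rewrite ?simple_root.
Qed.

Lemma refl_areflection a : a \in roots -> refl D a = areflection D (a, 0).
Proof.
move=> aR; apply: aff_eq; first by rewrite lin_areflection //= /lin refl_val.
by rewrite tr_refl // tr_areflection //= oppr0 scale0r.
Qed.

Lemma aht_root a : aht D (a, 0) = ht a.
Proof. by rewrite /aht mulr0 addr0. Qed.

Lemma aroot_root a : is_aroot D (a, 0) = (a \in roots).
Proof. by rewrite /is_aroot rpred0 andbT. Qed.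

Lemma refl_opp a : a \in roots -> refl D (- a) = refl D a.
Proof.
move=> aR; apply: val_inj; rewrite !refl_val ?root_oppE //.
by rewrite corootN // mulmxN mulNmx opprK.
Qed.

(** Induction on the height: a simple reflection from [nonsimple_descent] lowers a nonsimple
    positive root, keeps it positive, and conjugates the two reflections. *)
Lemma refl_generated a : a \in roots -> generated sW (refl D a).
Proof.
have Hpos n : forall b, b \in roots -> 0 < ht b -> ht b <= n%:R ->
    generated sW (refl D b).
  elim: n => [|n IH] b bR b0 bn; first by have := lt_le_trans b0 bn; rewrite ltxx.
  have [[j ->]|nsimple] := pselect (exists j, b = simple j).
    exact: (generated_gen sW j).
  have [j jb] := nonsimple_descent bR b0.
  have jR := simple_root D j.
  set c := lin (refl D (simple j)) *m b.
  have Ec : c = b - pair (coroot (simple j)) b *: simple j by rewrite /c lin_refl.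
  have gj : good D (refl D (simple j)) by apply: good_refl.
  have cR : c \in roots by have [-> _ _] := gj.
  have Eac : aaction (refl D (simple j)) (b, 0) = (c, 0).
    by rewrite /aaction tr_refl // qpair0l subr0.
  have c0 : 0 < ht c.
    rewrite -aht_root -Eac; apply: (gen_preserves_pos (o := Some j)).
    - by rewrite aroot_root.
    - by apply/eqP => -[E]; apply: nsimple; exists j.
    - by rewrite aht_root.
  have cn : ht c <= n%:R.
    have : 1 <= (pair (coroot (simple j)) b)%:~R :> rat by rewrite (ler_int _ 1); lia.
    by move: bn; rewrite Ec htB htZ ht_simple mulr1 -natr1; lra.
  have Eb : refl D b = (refl D (simple j) * refl D c * refl D (simple j))%g.
    rewrite (refl_areflection cR) -Eac -areflection_conj ?aroot_root //.
    rewrite (_ : (refl D (simple j))^-1 = refl D (simple j))%g; last exact: (genV D (Some j)).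
    rewrite -refl_areflection // !mulgA refl_invol // mul1g -mulgA refl_invol //.
    by rewrite mulg1.
  have gs := generated_gen sW j.
  rewrite Eb; apply: (generatedM _ gs).
  by apply: (generatedM gs); apply: IH.
have H b : b \in roots -> 0 < ht b -> generated sW (refl D b).
  move=> bR b0; have /intrP[z zE] := root_ht_int bR.
  apply: (Hpos `|z|%N) => //; rewrite zE -[X in X <= _]/(z%:~R) pmulrn ler_int; lia.
move=> aR; have := root_ht_neq0 aR; rewrite neq_lt => /orP[a0|]; last exact: H.
by rewrite -refl_opp //; apply: H; rewrite ?root_oppE // htN oppr_gt0.
Qed.

Lemma weylP w : weyl D w <-> generated sW w.
Proof.
split=> [[t tR ->]|[t <-]].
  elim: t tR => [|a t IH] tR; first by rewrite big_nil; apply: generated1.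
  rewrite big_cons; apply: generatedM.
    by apply: refl_generated; apply: tR; rewrite mem_head.
  by apply: IH => b bt; apply: tR; rewrite in_cons bt orbT.
exists [seq simple i | i <- t]; last by rewrite big_map.
by move=> a /mapP[i _ ->]; apply: simple_root.
Qed.

Lemma weyl1 : weyl D 1%g.
Proof. by apply/weylP; apply: generated1. Qed.
Lemma weylM g h : weyl D g -> weyl D h -> weyl D (g * h)%g.
Proof. by move=> /weylP gg /weylP gh; apply/weylP; apply: generatedM. Qed.
Lemma weylV g : weyl D g -> weyl D g^-1%g.
Proof.
by move=> /weylP gg; apply/weylP; apply: generatedV gg => i; apply: (genK D (Some i)).
Qed.
Lemma weyl_genW i : weyl D (weyl_gen D i).
Proof. by apply/weylP; apply: (generated_gen sW i). Qed.

Lemma weyl_good w : weyl D w -> good D w.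
Proof. by move=> /weylP; apply: good_generated. Qed.

Lemma weyl_tr w : weyl D w -> tr w = 0.
Proof.
move=> /weylP[t <-]; elim: t => [|i t IH]; first by rewrite word_nil.
by rewrite word_cons trM IH /act_cowt mul0mx add0r tr_refl ?simple_root.
Qed.

Lemma weyl_aaction w a (k : rat) : weyl D w -> aaction w (a, k) = (lin w *m a, k).
Proof. by move=> ww; rewrite /aaction weyl_tr //= qpair0l subr0. Qed.

Lemma lin_eq_simple g h : (forall i, lin g *m simple i = lin h *m simple i) ->
  lin g = lin h.
Proof.
move=> E; set M : 'M[rat]_r := \matrix_(j, k) (simple k j 0)%:~R.
have H : map_mx intr (lin g) *m M = map_mx intr (lin h) *m M.
  apply/matrixP => i j; move/colP/(_ i): (E j) => /(congr1 (intr : int -> rat)) => F.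
  move: F; rewrite !mxE !rmorph_sum /= => F.
  transitivity (\sum_k (lin g i k * simple j k 0)%:~R : rat).
    by apply: eq_bigr => k _; rewrite !mxE rmorphM.
  by rewrite F; apply: eq_bigr => k _; rewrite !mxE rmorphM.
have {}H := congr1 (fun A => A *m invmx M) H.
move: H; rewrite !mulmxK ?simple_mx_unit // => H.
apply/matrixP => i j; move/matrixP/(_ i j): H; rewrite !mxE => /eqP.
by rewrite eqr_int => /eqP.
Qed.

Local Open Scope classical_set_scope.

(** An element is determined by the images of the simple roots, that is by a function from the nodes
    to positions in the list of roots. *)
Lemma finite_weyl : finite_set [set w | weyl D w].
Proof.
pose F (k : {ffun 'I_r -> 'I_(size roots)}) : aff r := xget 1%g
  [set w | weyl D w /\ forall i, lin w *m simple i = nth 0 roots (k i)].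
apply: (@sub_finite_set _ _ (F @` [set: {ffun 'I_r -> 'I_(size roots)}])).
  move=> w /= ww.
  have wi i : (index (lin w *m simple i) roots < size roots)%N.
    by rewrite index_mem; have [-> _ _] := weyl_good ww; apply: simple_root.
  exists [ffun i => Ordinal (wi i)] => //; rewrite /F; case: xgetP => [w' _|].
    move=> [ww' H]; apply: aff_eq; last by rewrite !weyl_tr.
    apply: lin_eq_simple => i; rewrite H ffunE /= nth_index //.
    by rewrite -index_mem.
  move=> /(_ w) /=; case; split=> // i; rewrite ffunE /= nth_index //.
  by rewrite -index_mem.
by apply: finite_image; apply: finite_finset.
Qed.

End WeylGroup.

(** * The nil-Hecke relations *)

Section TwistedRingTheory.
Variables (G : groupType) (K : fieldAction G) (T : twistedRing K).
Implicit Types (a b : T) (c d : K) (g h : G) (p : pred G).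
Local Notation cst := (tw_cst T).
Local Notation dl := (tw_dl T).
Local Notation coef := (@tw_coef _ _ T).
Local Notation aug := (@tw_aug _ _ T).

Lemma tw_coef0 g : coef g 0 = 0.
Proof. by rewrite -[X in coef g X](subrr 0) tw_coefB subrr. Qed.
Lemma tw_coefN g a : coef g (- a) = - coef g a.
Proof. by rewrite -[- a]add0r tw_coefB tw_coef0 sub0r. Qed.
Lemma tw_coefD g a b : coef g (a + b) = coef g a + coef g b.
Proof. by rewrite -[b in LHS]opprK tw_coefB tw_coefN opprK. Qed.
Lemma tw_coef_sum I (s : seq I) (P : pred I) (f : I -> T) g :
  coef g (\sum_(i <- s | P i) f i) = \sum_(i <- s | P i) coef g (f i).
Proof. exact: (big_morph (coef g) (tw_coefD g) (tw_coef0 g)). Qed.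
Lemma coef_monom g c h : coef g (cst c * dl h) = c * (h == g)%:R.
Proof. by rewrite tw_coef_cstM tw_coef_dl. Qed.

Lemma cst0 : cst 0 = 0.
Proof. by rewrite -[X in cst X](subrr 0) tw_cstB subrr. Qed.
Lemma cstN c : cst (- c) = - cst c.
Proof. by rewrite -[- c]add0r tw_cstB cst0 sub0r. Qed.
Lemma cstD c d : cst (c + d) = cst c + cst d.
Proof. by rewrite -[d in LHS]opprK tw_cstB cstN opprK. Qed.
Lemma cst_int (n : int) : cst n%:~R = n%:~R.
Proof.
have H (k : nat) : cst k%:R = k%:R.
  by elim: k => [|k IH]; rewrite ?cst0 // -!natr1 cstD IH tw_cst1.
by case: n => k; rewrite ?NegzE ?rmorphN ?cstN; rewrite -?pmulrn H.
Qed.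

Lemma aug0 p : aug p 0 = 0.
Proof. by rewrite -[X in aug p X](subrr 0) tw_augB subrr. Qed.
Lemma augD p a b : aug p (a + b) = aug p a + aug p b.
Proof.
have N x : aug p (- x) = - aug p x by rewrite -[- x]add0r tw_augB aug0 sub0r.
by rewrite -[b in LHS]opprK tw_augB N opprK.
Qed.
Lemma aug_sum p I (s : seq I) (P : pred I) (f : I -> T) :
  aug p (\sum_(i <- s | P i) f i) = \sum_(i <- s | P i) aug p (f i).
Proof. exact: (big_morph (aug p) (augD p) (aug0 p)). Qed.

Lemma aug_Mdl p a h : (forall g, p (g * h)%g = p g) -> aug p (a * dl h) = aug p a.
Proof.
move=> ph; have [s _ ->] := tw_decomp a.
rewrite mulr_suml !aug_sum; apply: eq_bigr => g _.
by rewrite -mulrA -tw_dlM !tw_aug_mono ph.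
Qed.

Lemma aug_single p a h : p h -> (forall g, coef g a != 0 -> p g -> g = h) ->
  aug p a = coef h a.
Proof.
move=> ph H; have [s us Ea] := tw_decomp a.
have E : aug p a = \sum_(g <- s) coef g a * (g == h)%:R.
  rewrite {1}Ea aug_sum; apply: eq_bigr => g _; rewrite tw_aug_mono.
  have [->|g0] := eqVneq (coef g a) 0; first by rewrite !mul0r.
  by case: eqP => [->|gh]; [rewrite ph|case: (boolP (p g)) => // /(H _ g0)].
rewrite E {2}Ea tw_coef_sum; apply: eq_bigr => g _.
by rewrite coef_monom.
Qed.

End TwistedRingTheory.

(** * Groups generated by two involutions *)

Section Dihedral.
Variables (G : groupType) (a b : G) (q : nat).
Hypotheses (aa : (a * a = 1)%g) (bb : (b * b = 1)%g) (abq : ((a * b) ^+ q.+1 = 1)%g).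
Local Open Scope group_scope.

Lemma dihedral_flip k : a * (a * b) ^+ k = ((a * b) ^+ k)^-1 * a.
Proof.
elim: k => [|k IH]; first by rewrite invg1 mul1g mulg1.
have E : a * (a * b) = (a * b)^-1 * a.
  by rewrite mulgA aa mul1g invgM mulgVK; apply: (mulgI b); rewrite bb mulgV.
by rewrite expgS mulgA E -mulgA IH mulgA -invgM -expgSr -expgS.
Qed.

(** A product of the two involutions is a rotation or a reflection. Through [translation_torsion]
    this excludes nontrivial translations from the group generated by two generators in a braid
    relation. *)
Lemma dihedral_order t : {subset t <= [:: a; b]} ->
  (\prod_(x <- t) x) ^+ q.+1 = 1 \/ (\prod_(x <- t) x) ^+ 2 = 1.
Proof.
have cV k : exists k', ((a * b) ^+ k)^-1 = (a * b) ^+ k'.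
  exists (k * q)%N; apply: (mulgI ((a * b) ^+ k)).
  by rewrite mulgV -expgnDr -mulnS mulnC expgnA abq expg1n.
have a_step k : exists k', a * (a * b) ^+ k = (a * b) ^+ k' * a.
  by have [k' E] := cV k; exists k'; rewrite dihedral_flip E.
have H : {subset t <= [:: a; b]} -> exists k,
    \prod_(x <- t) x = (a * b) ^+ k \/ \prod_(x <- t) x = (a * b) ^+ k * a.
  elim: t => [|x t IH] st; first by exists 0; left; rewrite big_nil.
  have [|k E] := IH; first by move=> y yt; apply: st; rewrite in_cons yt orbT.
  have Pa y : (exists k, y = (a * b) ^+ k \/ y = (a * b) ^+ k * a) ->
      exists k, a * y = (a * b) ^+ k \/ a * y = (a * b) ^+ k * a.
    move=> [n []->]; have [k' E'] := a_step n; exists k'; first by right.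
    by left; rewrite mulgA E' -mulgA aa mulg1.
  rewrite big_cons; have := st x (mem_head _ _).
  rewrite !inE => /orP[/eqP->|/eqP->]; first by apply: Pa; exists k.
  set y := \prod_(_ <- _) _ in E *.
  have -> : b * y = a * ((a * b) * y) by rewrite !mulgA aa mul1g.
  by apply: Pa; exists k.+1; rewrite expgS -!mulgA; case: E => ->; [left|right].
move=> /H[k [->|->]]; [left|right].
  by rewrite -expgnA mulnC expgnA abq expg1n.
rewrite expg2 -mulgA (mulgA a) dihedral_flip -(mulgA _ a) aa mulg1.
by rewrite mulgV.
Qed.

End Dihedral.

Lemma anticomm_sqr0 (R : pzRingType) (x s : R) :
  s * x = - x * s -> s * s = 1 -> (x * (1 - s)) * (x * (1 - s)) = 0.
Proof.
move=> sx ss; have E : (1 - s) * x = x * (1 + s).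
  by rewrite mulrBl mulrDr mul1r mulr1 sx mulNr opprK.
rewrite -mulrA (mulrA (1 - s)) E -mulrA mulrBr mulr1 mulrDl mul1r ss.
by rewrite (addrC s) subrr !mulr0.
Qed.

(** * Braid relations and independence of the reduced word *)

Section NilHeckeAlgebra.
Variables (r : nat) (D : simple_datum r) (K : fieldAction (aff r)).
Variable T : twistedRing K.
Variable wtK : 'cV[int]_r -> K.
Hypothesis wtKB : {morph wtK : m n / m - n}.
Hypothesis wtK_inj : injective wtK.
Hypothesis act_wtK : forall g m, fa_act g (wtK m) = wtK (lin g *m m).
Implicit Types (o i j : option 'I_r) (t : seq (option 'I_r)) (m : 'cV[int]_r).
Implicit Types (g h x : aff r) (a b : T) (c : K).
Local Notation cst := (tw_cst T).
Local Notation dl := (tw_dl T).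
Local Notation coef := (@tw_coef _ _ T).
Local Notation aug := (@tw_aug _ _ T).

Local Notation gen := (affine_gen D).
Local Notation al o := (asimple D o).
Local Notation aht := (aht D).
Local Notation wt m := (cst (wtK m)).

Lemma wtK0 : wtK 0 = 0.
Proof. by rewrite -[X in wtK X](subrr 0) wtKB subrr. Qed.
Lemma wtKN m : wtK (- m) = - wtK m.
Proof. by rewrite -[- m]add0r wtKB wtK0 sub0r. Qed.
Lemma wtKD m n : wtK (m + n) = wtK m + wtK n.
Proof. by rewrite -[n in LHS]opprK wtKB wtKN opprK. Qed.
Lemma wtKZ (n : int) m : wtK (n *: m) = n%:~R * wtK m.
Proof.
have H (k : nat) : wtK (m *+ k) = wtK m *+ k.
  by elim: k => [|k IH]; rewrite ?wtK0 // !mulrS wtKD IH.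
case: n => k; first by rewrite -[Posz k]natz scaler_nat H rmorph_nat mulr_natl.
rewrite NegzE scaleNr wtKN -[Posz k.+1]natz scaler_nat H rmorphN mulNr /=.
by rewrite rmorph_nat mulr_natl.
Qed.

Lemma al_root o : (al o).1 \in Defs.roots D.
Proof. by case/andP: (asimple_root D o). Qed.

Lemma al_wt_neq0 o : wtK (al o).1 != 0.
Proof. by rewrite -wtK0 (inj_eq wtK_inj) (root_neq0 (al_root o)). Qed.

Lemma lin_gen o m : lin (gen o) *m m = m - pair (coroot D (al o).1) m *: (al o).1.
Proof. by rewrite affine_gen_areflection lin_areflection_mul ?al_root. Qed.

(** Since [asimple D None] is [(- Theta, 1)], one formula covers all nodes: the sign in [A_0] comes
    from the weight [- Theta]. The lock stops unwanted unfolding. *)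
Definition nilA o : T := locked (cst (wtK (al o).1)^-1 * (1 - dl (gen o))).

Lemma nilAE o : nilA o = cst (wtK (al o).1)^-1 * (1 - dl (gen o)).
Proof. by rewrite /nilA -lock. Qed.

Lemma act_gen_al o : fa_act (gen o) (wtK (al o).1) = - wtK (al o).1.
Proof.
rewrite act_wtK lin_gen pair_coroot ?al_root // scaler_nat mulr2n opprD addrA.
by rewrite subrr sub0r wtKN.
Qed.

Lemma dl_genK o : dl (gen o) * dl (gen o) = 1.
Proof. by rewrite -tw_dlM genK tw_dl1. Qed.

Lemma nilA_sqr o : nilA o * nilA o = 0.
Proof.
rewrite nilAE; apply: anticomm_sqr0 (dl_genK o).
by rewrite tw_dl_cst fmorphV /= act_gen_al invrN cstN.
Qed.

Lemma nilA_wt o m : nilA o * wt m =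
  wt (lin (gen o) *m m) * nilA o + (pair (coroot D (al o).1) m)%:~R.
Proof.
rewrite !nilAE; set c := (wtK _)^-1; set n := pair _ _.
rewrite -mulrA mulrBl mul1r tw_dl_cst act_wtK lin_gen -/n.
have -> : n%:~R = cst c * wt (n *: (al o).1).
  by rewrite -tw_cstM wtKZ mulrCA mulVf ?al_wt_neq0 // mulr1 cst_int.
rewrite mulrA -(tw_cstM T (wtK (m - _)) c) (mulrC (wtK _)) tw_cstM -mulrA -mulrDr.
by congr (_ * _); rewrite mulrBr mulr1 addrAC wtKB tw_cstB subrK.
Qed.

Definition nilword t : T := locked (\prod_(o <- t) nilA o).

Lemma nilwordE t : nilword t = \prod_(o <- t) nilA o.
Proof. by rewrite /nilword -lock. Qed.

Lemma nilword_cons o t : nilword (o :: t) = nilA o * nilword t.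
Proof. by rewrite !nilwordE big_cons. Qed.
Lemma nilword_nil : nilword [::] = 1.
Proof. by rewrite !nilwordE big_nil. Qed.
Lemma nilword_cat t t' : nilword (t ++ t') = nilword t * nilword t'.
Proof. by rewrite !nilwordE big_cat. Qed.
Lemma nilword_rcons t o : nilword (rcons t o) = nilword t * nilA o.
Proof. by rewrite -cats1 nilword_cat nilword_cons nilword_nil mulr1. Qed.

Lemma coef_nilA o g : coef g (nilA o) != 0 -> g = 1%g \/ g = gen o.
Proof.
rewrite nilAE tw_coef_cstM tw_coefB -tw_dl1 !tw_coef_dl.
by case: (1%g =P g) => [|_]; [left|case: (gen o =P g) => [|_]; [right|rewrite subr0 mulr0 eqxx]].
Qed.

Lemma coef_nilword t g : coef g (nilword t) != 0 ->
  exists2 t', subseq t' t & word gen t' = g.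
Proof.
elim: t g => [|o t IH] g.
  rewrite nilword_nil -tw_dl1 tw_coef_dl; case: (1%g =P g) => [<- _|_]; last by rewrite eqxx.
  by exists [::]; rewrite ?word_nil.
rewrite nilword_cons => /tw_coef_mul[u [v [/coef_nilA uP /IH[t' st <-] ->]]].
case: uP => ->; first by exists t'; rewrite ?mul1g // (subseq_trans st) ?subseq_cons.
by exists (o :: t'); rewrite ?word_cons //= eqxx.
Qed.

Lemma aug_nilA p a o : (forall g, p (g * gen o)%g = p g) -> aug p (a * nilA o) = 0.
Proof. by move=> H; rewrite nilAE mulrA mulrBr mulr1 tw_augB aug_Mdl // subrr. Qed.

Lemma aug_nilword t : t != [::] -> aug predT (nilword t) = 0.
Proof. by case/lastP: t => // t o _; rewrite nilword_rcons aug_nilA. Qed.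

Fixpoint alt n i j := if n is n'.+1 then i :: alt n' j i else [::].
Fixpoint altlast n i j := if n is n'.+1 then altlast n' j i else i.

Lemma size_alt n i j : size (alt n i j) = n.
Proof. by elim: n i j => //= n IH i j; rewrite IH. Qed.

Lemma alt_rcons n i j : alt n.+1 i j = rcons (alt n i j) (altlast n i j).
Proof. by elim: n i j => //= n IH i j; rewrite -IH. Qed.

(* In the commutator with a weight all words but the two of length [n.+1] vanish,
   the others containing a square; hence the difference of the two sides of a
   braid relation of length [n.+2] skew-commutes with the weights. *)
Lemma nilword_alt_wt n i j m :
  nilword (alt n.+2 i j) * wt m =
  wt (lin (word gen (alt n.+2 i j)) *m m) * nilword (alt n.+2 i j) +
  nilword (alt n.+1 j i) *~
    pair (coroot D (al i).1) (lin (word gen (alt n.+1 j i)) *m m) +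
  nilword (alt n.+1 i j) *~ pair (coroot D (al (altlast n.+1 i j)).1) m.
Proof.
elim: n i j m => [|n IH] i j m.
  rewrite /= !nilword_cons nilword_nil !mulr1 -mulrA nilA_wt mulrDr mulrA nilA_wt.
  rewrite mulrDl -mulrA !word_cons word_nil mulg1 linM -mulmxA.
  by rewrite mulrzl mulrzr.
have -> : alt n.+3 i j = i :: alt n.+2 j i by [].
rewrite nilword_cons -mulrA IH !mulrDr mulrA nilA_wt mulrDl -!mulrA !mulrzAr.
have -> : nilA i * nilword (alt n.+1 i j) = 0.
  by rewrite /= nilword_cons mulrA nilA_sqr mul0r.
rewrite mul0rz addr0 (word_cons gen i (alt n.+2 j i)) linM -mulmxA mulrzl.
by rewrite -(nilword_cons i (alt n.+1 j i)).
Qed.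

Lemma alt_subset n i j : {subset alt n i j <= [:: i; j]}.
Proof.
elim: n i j => //= n IH i j o; rewrite in_cons => /orP[/eqP->|/IH].
  by rewrite mem_head.
by rewrite !inE orbC.
Qed.

Lemma word_alt_coxeter n i j :
  (word gen (alt n i j) * (word gen (alt n j i))^-1 = (gen i * gen j) ^+ n)%g.
Proof.
have H (a b : aff r) k : (a * (b * a) ^+ k * b = (a * b) ^+ k.+1)%g.
  elim: k => [|k IH]; first by rewrite mulg1.
  by rewrite expgS !mulgA -(mulgA _ _ b) -(mulgA (a * b)%g) (mulgA a) IH -expgS.
elim: n i j => [|n IH] i j; first by rewrite word_nil mul1g invg1.
by rewrite !word_cons invgM genV mulgA -(mulgA (gen i)) IH H.
Qed.

Lemma translation_torsion x n : lin x = 1%:M -> (x ^+ n.+1 = 1)%g -> x = 1%g.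
Proof.
move=> lx xn; have lVx : linV x = 1%:M by rewrite -[LHS]mul1mx -lx linK.
have H k : tr (x ^+ k)%g = tr x *+ k.
  elim: k => [|k IH]; first by rewrite mulr0n.
  by rewrite expgS trM IH /act_cowt lVx map_mx1 mulmx1 mulrSr.
apply: aff_eq => //; have := H n.+1; rewrite xn => /esym/eqP.
rewrite -scaler_nat scaler_eq0 pnatr_eq0 /= => /eqP ->.
by [].
Qed.

Definition reducedA t := length gen (word gen t) = size t.

Let gK o : (gen o * gen o = 1)%g. Proof. exact: genK. Qed.

Lemma reducedA_cat t t' : reducedA (t ++ t') -> reducedA t /\ reducedA t'.
Proof.
move=> E; have [] := @reduced_cat _ _ gen t t' (conj erefl (esym E)).
by move=> [_ h1] [_ h2]; split; apply: esym.
Qed.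

Lemma reducedA_rcons_pos t o : reducedA (rcons t o) -> 0 < aht (aaction (word gen t) (al o)).
Proof.
move=> R; have [Rt _] : reducedA t /\ reducedA [:: o].
  by apply: reducedA_cat; rewrite cats1.
have := @genR_desc _ D _ id o (word gen t) (generated_word gen t) => /= ->.
by move: Rt R; rewrite /reducedA word_rcons size_rcons => -> ->.
Qed.

(** The relation makes [gen i] negate the positive root [y (al o)], and [al i] is the only positive
    root that [gen i] makes negative. *)
Lemma simple_transport y i o : generated gen y ->
  (y * gen o = gen i * y)%g -> 0 < aht (aaction y (al o)) -> aaction y (al o) = al i.
Proof.
move=> gy E f0; have gdy : good D y by apply: (@good_generated _ D _ id).
set f := aaction y (al o) in f0 *.
have fR : is_aroot D f by rewrite aroot_aaction // asimple_root.
have Ef : aaction (gen i) f = aopp f.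
  by rewrite /f -aactionM -E aactionM aaction_gen_asimple aaction_opp.
apply/eqP; apply: contraT => fi; have := gen_preserves_pos fR fi f0.
by rewrite Ef aht_opp_gt0 // f0.
Qed.

Lemma pair_transport y i o m : generated gen y -> aaction y (al o) = al i ->
  pair (coroot D (al i).1) (lin y *m m) = pair (coroot D (al o).1) m.
Proof.
move=> gy <-; have [_ g2 _] : good D y by apply: (@good_generated _ D _ id).
by rewrite /= g2 ?al_root // -pair_mx -mulmxA linVK mulmx1.
Qed.

(** Let [E] be the difference and [x] the common group element. From [E m = x(m) E] for weights [m],
    every [g] in the support of [E] has the linear part of [x]; then [g x^-1] is a translation of
    finite order, so [g = x]. The one remaining coefficient is the total augmentation of [E], which
    is zero. *)
Lemma braid q i j : i <> j -> word gen (alt q i j) = word gen (alt q j i) ->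
  reducedA (alt q i j) -> reducedA (alt q j i) ->
  nilword (alt q i j) = nilword (alt q j i).
Proof.
move=> ij Ew R1 R2; case: q => [//|[|n]] in Ew R1 R2 *.
  (* Words of one letter: equal reflections would have equal simple roots. *)
  case: ij; apply: (@asimple_inj _ D).
  have := @simple_transport 1%g j i (generated1 gen); rewrite aaction1; apply.
    by move: Ew; rewrite /= !word1 mul1g mulg1.
  by rewrite aht_asimple.
set x := word gen (alt n.+2 i j) in Ew R1.
(* The word of length [n.+1] carries the simple root of its successor letter to that of [i'], so the
   lower terms from [nilword_alt_wt] cancel between the two sides. *)
have cR i' j' : word gen (alt n.+2 i' j') = word gen (alt n.+2 j' i') ->
    reducedA (alt n.+2 j' i') -> forall m,
    pair (coroot D (al i').1) (lin (word gen (alt n.+1 j' i')) *m m) =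
    pair (coroot D (al (altlast n.+1 j' i')).1) m.
  move=> E R m; apply: pair_transport; first exact: generated_word.
  apply: simple_transport; first exact: generated_word.
    by rewrite -word_rcons -alt_rcons -E word_cons.
  by apply: reducedA_rcons_pos; rewrite -alt_rcons.
set E := nilword (alt n.+2 i j) - nilword (alt n.+2 j i).
have comm m : E * wt m = wt (lin x *m m) * E.
  rewrite mulrBl mulrBr !nilword_alt_wt -Ew (cR i j) // (cR j i) //.
  rewrite [X in _ - X = _]addrAC.
  set u := nilword (alt n.+1 j i) *~ _; set v := nilword (alt n.+1 i j) *~ _.
  by rewrite -(addrA _ u) -(addrA _ u) opprD addrACA subrr addr0.
have linE g : coef g E != 0 -> lin g = lin x.
  move=> g0; apply: (@lin_eq_simple _ D) => k; apply: wtK_inj.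
  have := congr1 (coef g) (comm (simple D k)).
  rewrite tw_coef_Mcst tw_coef_cstM act_wtK mulrC => /(mulIf g0).
  exact.
have supp g : coef g E != 0 -> exists2 t, {subset t <= [:: i; j]} & word gen t = g.
  rewrite tw_coefB => H.
  have [H'|H'] : coef g (nilword (alt n.+2 i j)) != 0 \/
      coef g (nilword (alt n.+2 j i)) != 0.
  - apply/orP; rewrite -negb_and; apply/andP => -[/eqP E1 /eqP E2].
    by rewrite E1 E2 subrr eqxx in H.
  - have [t st <-] := coef_nilword H'; exists t => // o /(mem_subseq st).
    exact: alt_subset.
  have [t st <-] := coef_nilword H'; exists t => // o /(mem_subseq st) /alt_subset.
  by rewrite !inE orbC.
have cox : ((gen i * gen j) ^+ n.+2 = 1)%g by rewrite -word_alt_coxeter -Ew mulgV.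
have E1 g : coef g E != 0 -> g = x.
  move=> g0; have [t st Et] := supp g g0.
  have z1 : (g * x^-1 = 1)%g.
    have lz : lin (g * x^-1)%g = 1%:M.
      by rewrite linM (linE g g0) linVE linK.
    have zE : (g * x^-1 = \prod_(y <- map gen (t ++ rev (alt n.+2 i j))) y)%g.
      by rewrite big_map -[RHS]/(word gen _) word_cat (word_rev gK) Et.
    have zS : {subset map gen (t ++ rev (alt n.+2 i j)) <= [:: gen i; gen j]}.
      move=> y /mapP[o ot ->]; rewrite -[[:: gen i; gen j]]/(map gen [:: i; j]).
      apply: map_f; move: ot; rewrite mem_cat mem_rev => /orP[/st//|].
      exact: alt_subset.
    have := dihedral_order (gK i) (gK j) cox zS; rewrite -zE.
    by case; apply: translation_torsion.
  by rewrite -[g](mulgVK x) z1 mul1g.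
have : aug predT E = coef x E by apply: aug_single => // g g0 _; apply: E1.
rewrite tw_augB !aug_nilword // subrr => /esym Ex.
apply/eqP; rewrite -subr_eq0; apply/eqP; apply: (@tw_coefP _ _ T) => g; rewrite tw_coef0.
by have [//|g0] := eqVneq (coef g E) 0; rewrite (E1 g g0).
Qed.

Definition word_indep n := forall t t', size t = n -> reducedA t -> reducedA t' ->
  word gen t = word gen t' -> nilword t = nilword t'.

Lemma reducedA_size t t' : reducedA t -> reducedA t' -> word gen t = word gen t' ->
  size t = size t'.
Proof. by move=> <- <- ->. Qed.

Lemma reducedA_of_size t t' : reducedA t -> word gen t' = word gen t ->
  size t' = size t -> reducedA t'.
Proof. by rewrite /reducedA => <- -> ->. Qed.

(* The step of Matsumoto's argument: exchanging the last letter of [S] for a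
   first letter [j] yields a reduced word of the same element with a different
   product. Iterating with two letters in turn leads to an alternating word. *)
Lemma word_indep_step n S j t : word_indep n -> size S = n.+1 -> reducedA S ->
  reducedA (j :: t) -> word gen S = word gen (j :: t) ->
  nilword S <> nilword (j :: t) ->
  [/\ reducedA (take n.+1 (j :: S)), word gen (take n.+1 (j :: S)) = word gen S
    & nilword (take n.+1 (j :: S)) <> nilword S].
Proof.
move=> IH sS RS RT Ew NE.
have sT : size t = n by have := reducedA_size RS RT Ew; rewrite sS => -[].
have [_ Rt] : reducedA [:: j] /\ reducedA t by apply: reducedA_cat.
have neg : ~~ (0 < aht (aaction (word gen S)^-1%g (al j))).
  apply/negP => H; have := @genL_length_gt _ D _ id j (word gen S) (generated_word gen S) H.
  rewrite /= Ew -word_cons {1}word_cons word_cons mulgA genK mul1g.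
  by move: Rt RT; rewrite /reducedA word_cons /= => -> ->; lia.
have [|k [kS Ek]] := @left_exchange _ D _ id S (al j) (asimple_root D j) _ neg.
  by rewrite aht_asimple.
rewrite -affine_gen_areflection /= in Ek.
set U := take k S ++ drop k.+1 S in Ek.
have sU : size U = n.
  by apply: succn_inj; rewrite (size_remove kS).
have wU : word gen U = word gen t.
  by rewrite -Ek Ew word_cons mulgA genK mul1g.
have RU : reducedA U by apply: reducedA_of_size Rt _ _; rewrite ?sU ?sT.
have EU : nilword U = nilword t by apply: IH.
have wjU : word gen (j :: U) = word gen S by rewrite word_cons wU -word_cons Ew.
have RjU : reducedA (j :: U) by apply: reducedA_of_size RS _ _; rewrite //= sU sS.
have NjU : nilword (j :: U) <> nilword S by rewrite nilword_cons EU -nilword_cons => E; apply: NE.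
(* If the deleted letter is not the last, [j :: U] and [S] end in the same letter; the induction
   hypothesis then makes their products equal, against [NjU]. *)
have [kn|kn] := ltnP k n; last first.
  have Ekn : k = n by apply/eqP; rewrite eqn_leq kn andbT -ltnS -sS.
  by move: RjU wjU NjU; rewrite /U Ekn drop_oversize ?sS // cats0.
have [S1 [l ES]] : exists S1 l, S = rcons S1 l.
  by case/lastP: (S) sS => // S1 l _; exists S1, l.
have sS1 : size S1 = n by move: sS; rewrite ES size_rcons => -[].
have EU1 : j :: U = rcons (j :: take k S1 ++ drop k.+1 S1) l.
  rewrite /U ES drop_rcons ?sS1 // -{1}cats1 takel_cat ?sS1 1?ltnW //.
  by rewrite rcons_cons rcons_cat.
case: NjU; rewrite EU1 ES !nilword_rcons; congr (_ * _).
have R1 t' : reducedA (rcons t' l) -> reducedA t'.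
  by rewrite -cats1 => /reducedA_cat[].
apply: IH; first by rewrite /= size_remove ?sS1.
- by apply: R1; rewrite -EU1.
- by apply: R1; rewrite -ES.
by move: wjU; rewrite EU1 ES !word_rcons => /mulIg.
Qed.

Lemma nilword_indep t t' : reducedA t -> reducedA t' -> word gen t = word gen t' ->
  nilword t = nilword t'.
Proof.
have [n] := ubnP (size t); move En : (size t) => q; elim: n q t t' En => // n IHn q.
move=> t t' st qn.
have IH k : (k < q)%N -> word_indep k.
  by move=> kq u u' su; apply: (IHn k) su _; apply: leq_trans kq _; rewrite -ltnS.
case: q => [|q] in st qn IH *; first by
  move=> /reducedA_size H /H{}H /H; rewrite st; case: t' {H} => //; case: (t) st.
move=> Rt Rt' E; have {}IH := IH q (ltnSn q).
case: t' Rt' E => [|j t'] Rt' E.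
  by have := reducedA_size Rt Rt' E; rewrite st.
apply: contrapT => NE; case Et : t st Rt E NE => [//|i t1]; rewrite -Et => st Rt E NE.
(* The word reached after [k] exchanges: [k] alternating letters put in front, and as many dropped
   at the end of [t]. *)
pose pre k i' j' := take q.+1 (alt k i' j' ++ t).
have size_pre k i' j' : size (pre k i' j') = q.+1.
  by rewrite /pre size_takel // size_cat size_alt st leq_addl.
have preS k i' j' : take q.+1 (i' :: pre k j' i') = pre k.+1 i' j'.
  by rewrite /pre /=; congr (_ :: _); rewrite take_takel.
have chain k : exists i' j', [/\ reducedA (pre k i' j'), reducedA (pre k.+1 j' i'),
    word gen (pre k.+1 j' i') = word gen t /\ word gen (pre k i' j') = word gen t,
    nilword (pre k.+1 j' i') <> nilword (pre k i' j')
    & exists U, pre k i' j' = i' :: U].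
  elim: k => [|k [i' [j' [RU RV [wV wU] NUV [U EU]]]]].
    exists i, j; have E0 : pre 0 i j = t by rewrite /pre take_oversize ?st.
    have [R1 w1 N1] := word_indep_step IH st Rt Rt' E NE.
    by rewrite -preS !E0; split=> //; exists t1.
  exists j', i'; have := @word_indep_step q (pre k.+1 j' i') i' U IH.
  rewrite size_pre -EU preS => /(_ erefl RV RU).
  rewrite wV wU => /(_ erefl NUV) [R1 w1 N1]; split=> //.
  by exists (take q (alt k i' j' ++ t)).
have [i' [j' [RU RV [wV wU] NUV _]]] := chain q.+1.
(* After [q.+1] exchanges no letter of [t] is left, so two consecutive words are the two sides of a
   braid relation. *)
have altq u v k : (q.+1 <= k)%N -> pre k u v = alt q.+1 u v.
  rewrite /pre; elim: (q.+1) k u v => [|q' IHq] [|k] u v //=.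
    by rewrite take0.
  by rewrite ltnS => /IHq ->.
move: RU RV wV wU NUV; rewrite !altq // => RU RV wV wU NUV; apply: NUV.
have [-> //|ij] := eqVneq i' j'.
by apply/esym; apply: braid => //; [apply/eqP|rewrite wV wU].
Qed.

(* A nonreduced word has a first letter that is a left descent of its reduced
   tail, so its product contains the square of some [nilA o]. *)
Lemma nilword_nonreduced t : ~ reducedA t -> nilword t = 0.
Proof.
elim: t => [|o t IH] NR.
  by case: NR; rewrite /reducedA word_nil length1.
rewrite nilword_cons; have [Rt|/IH->] := pselect (reducedA t); last by rewrite mulr0.
have H : ~~ (0 < aht (aaction (word gen t)^-1%g (al o))).
  apply/negP => /(@genL_length_gt _ D _ id o _ (generated_word gen t)) E; apply: NR.
  by rewrite /reducedA word_cons E /= Rt.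
have E := @genL_length_lt _ D _ id o _ (generated_word gen t) H.
have [u [wu su]] := reduced_exists (generatedM (generated_gen gen o) (generated_word gen t)).
have wou : word gen (o :: u) = word gen t.
  by rewrite word_cons wu mulgA genK mul1g.
have Rou : reducedA (o :: u) by rewrite /reducedA wou E /= su.
by rewrite (nilword_indep Rt Rou) // nilword_cons mulrA nilA_sqr mul0r.
Qed.

Definition nilE x : T := nilword (xget [::] [set t | reduced_word gen x t]%classic).

Lemma nilE_word t : reducedA t -> nilE (word gen t) = nilword t.
Proof.
move=> Rt; rewrite /nilE; case: xgetP => [t' _ [wt' st']|].
  by apply: nilword_indep => //; rewrite /reducedA wt' st'.
by move=> /(_ t) []; split=> //; apply: esym.
Qed.

Lemma nilE1 : nilE 1%g = 1.
Proof.
rewrite -[X in nilE X](word_nil gen) nilE_word ?nilword_nil //.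
by rewrite /reducedA word_nil length1.
Qed.

Lemma nilEM x y : generated gen x -> generated gen y ->
  length gen (x * y)%g = (length gen x + length gen y)%N ->
  nilE x * nilE y = nilE (x * y)%g.
Proof.
move=> /reduced_exists[t [<- st]] /reduced_exists[t' [<- st']].
rewrite -word_cat -st -st' -size_cat => R.
by rewrite !nilE_word ?nilword_cat // /reducedA -?st -?st'.
Qed.

Lemma nilE_gen o : nilE (gen o) = nilA o.
Proof.
rewrite -word1 nilE_word ?nilword_cons ?nilword_nil ?mulr1 // /reducedA word1.
have := @genR_length_gt _ D _ id o 1%g (generated1 _).
by rewrite aaction1 aht_asimple mul1g length1; apply.
Qed.

Lemma nilA_nilE o x : generated gen x -> nilA o * nilE x =
  if 0 < aht (aaction x^-1%g (al o)) then nilE (gen o * x)%g else 0.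
Proof.
move=> /[dup] gx /reduced_exists[t [wt st]]; case: ifP => H.
  rewrite -nilE_gen nilEM //; first exact: generated_gen.
  have := @genR_length_gt _ D _ id o 1%g (generated1 _).
  rewrite aaction1 aht_asimple mul1g length1 /= => -> //.
  by rewrite (@genL_length_gt _ D _ id o _ gx H) add1n.
rewrite -wt nilE_word; last by rewrite /reducedA wt.
rewrite -nilword_cons nilword_nonreduced // => R.
have := @genL_length_lt _ D _ id o _ gx (negbT H).
move: R; rewrite /reducedA word_cons wt /= st => ->.
by move: (length _ _) => k; lia.
Qed.

Lemma nilE_nilA o x : generated gen x -> nilE x * nilA o =
  if 0 < aht (aaction x (al o)) then nilE (x * gen o)%g else 0.
Proof.
move=> /[dup] gx /reduced_exists[t [wt st]]; case: ifP => H.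
  rewrite -nilE_gen nilEM //; first exact: generated_gen.
  have := @genR_length_gt _ D _ id o 1%g (generated1 _).
  rewrite aaction1 aht_asimple mul1g length1 /= => -> //.
  by rewrite (@genR_length_gt _ D _ id o _ gx H) addn1.
rewrite -wt nilE_word; last by rewrite /reducedA wt.
rewrite -nilword_rcons nilword_nonreduced // => R.
have := @genR_length_lt _ D _ id o _ gx (negbT H).
move: R; rewrite /reducedA word_rcons wt size_rcons st /= => ->.
by move: (length _ _) => k; lia.
Qed.

End NilHeckeAlgebra.

(** * The alcove stabilizer element *)

Section WeylInAffine.
Variables (r : nat) (D : simple_datum r).
Implicit Types (a b m : 'cV[int]_r) (w g h : aff r) (f : 'cV[int]_r * rat) (t : seq 'I_r).
Local Notation roots := (Defs.roots D).
Local Notation simple := (Defs.simple D).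
Local Notation ht := (ht D).
Local Notation aht := (aht D).
Local Notation fund := (fund_cowt D).
Local Notation gen := (affine_gen D).
Local Notation sW := (fun i => affine_gen D (Some i)).

Let sK i : (sW i * sW i = 1)%g := genK D (Some i).

Lemma word_map_Some t : word gen (map Some t) = word sW t.
Proof. by rewrite /word big_map. Qed.

Lemma weyl_generatedA w : weyl D w -> generated gen w.
Proof. by move=> /weylP[t <-]; exists (map Some t); rewrite word_map_Some. Qed.

(** The finite Weyl group leaves constant terms alone, so it can change a sign only where the
    constant term is zero. *)
Lemma weyl_aroot_neg w f : weyl D w -> is_aroot D f -> 0 < aht f ->
  ~~ (0 < aht (aaction w f)) -> [/\ f.2 = 0, 0 < ht f.1 & ht (lin w *m f.1) < 0].
Proof.
case: f => a k ww fR; rewrite (weyl_aaction a k ww) => f0.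
have wfR : is_aroot D (lin w *m a, k).
  by rewrite -(weyl_aaction a k ww) aroot_aaction //; apply: weyl_good.
have [aR kZ] := andP fR; have /root_ht_neq0 := (andP wfR).1 => /= wa.
move: f0; rewrite !aht_gt0 //= => /orP[->//|/andP[/eqP k0 a0]].
by rewrite k0 ltxx eqxx /= -leNgt le_eqVlt (negbTE wa).
Qed.

Lemma aht_weyl w a : weyl D w -> aht (aaction w (a, 0)) = ht (lin w *m a).
Proof. by move=> ww; rewrite (weyl_aaction a 0 ww) aht_root. Qed.

(** In both groups the length grows at a letter exactly when the same affine root is positive. *)
Lemma reduced_map_Some t : length sW (word sW t) = size t ->
  length gen (word gen (map Some t)) = size t.
Proof.
elim/last_ind: t => [|t i IH]; first by rewrite /= !word_nil !length1.
move=> R; have [] := @reduced_cat _ _ sW t [:: i].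
  by rewrite cats1; split=> //; rewrite R.
move=> [_ Rt] _; rewrite map_rcons word_rcons size_rcons.
have := @genR_desc _ D _ Some i (word sW t) (generated_word _ t).
rewrite /= -word_rcons R -Rt size_rcons ltnSn => H.
have := @genR_length_gt _ D _ id (Some i) (word gen (map Some t)) (generated_word _ _).
by rewrite /= IH ?Rt // => -> //; rewrite word_map_Some.
Qed.

Lemma lenW_word w : weyl D w -> exists t, [/\ word sW t = w, size t = lenW D w
  & length gen (word gen (map Some t)) = size t].
Proof.
move=> /weylP /reduced_exists[t [wt st]]; exists t; split=> //.
by apply: reduced_map_Some; rewrite wt st.
Qed.

Lemma ht_comb_ge (L : 'cV[int]_r -> rat) a : L 0 = 0 ->
  (forall x y, L (x + y) = L x + L y) ->
  a \in roots -> 0 < ht a ->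
  exists c : 'I_r -> nat, [/\ a = \sum_j simple j *+ c j,
    forall j, qpair (fund j) a = (c j)%:R & L a = \sum_j L (simple j) *+ c j].
Proof.
move=> L0 LD aR a0; have [c Ec] := root_pos aR a0; exists c; split=> //.
  by move=> j; rewrite Ec cf_comb.
rewrite {1}Ec (big_morph L LD L0); apply: eq_bigr => j _.
by elim: (c j) => [|n IH]; rewrite ?mulr0n ?L0 // !mulrS LD IH.
Qed.

Lemma big_option (V : nmodType) (J : finType) (F : option J -> V) :
  \sum_o F o = F None + \sum_j F (Some j).
Proof.
rewrite (bigD1 None) //=; congr (_ + _).
rewrite (reindex_omap Some id) => [|[j|]//].
by apply: eq_bigl => j; rewrite /= eqxx.
Qed.

(** Indecomposability of simple roots in numerical form: it serves to show that a positive root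
    which becomes simple under some transformation was already simple. *)
Lemma unit_comb (J : finType) (c : J -> nat) (L : J -> rat) :
  \sum_p L p *+ c p = 1 -> (forall p, c p != 0 -> 1 <= L p) ->
  exists p, c p = 1 /\ forall q, q != p -> c q = 0.
Proof.
move=> E HL; have [p cp] : exists p, c p != 0.
  apply: contrapT => H; have : \sum_p L p *+ c p = 0.
    rewrite big1 // => p _; have [->|cp] := eqVneq (c p) 0; first by rewrite mulr0n.
    by case: H; exists p.
  by rewrite E => /eqP; rewrite oner_eq0.
have ge q : (c q)%:R <= L q *+ c q.
  have [->|cq] := eqVneq (c q) 0; first by rewrite mulr0n.
  by rewrite lerMn2r HL ?orbT.
have : \sum_q (c q)%:R <= 1 :> rat by rewrite -[X in _ <= X]E; apply: ler_sum => q _; apply: ge.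
rewrite -natr_sum (bigD1 p) //= lern1 => H; exists p; split; first by lia.
move=> q qp; have : (\sum_(i | i != p) c i = 0)%N by lia.
by move/eqP; rewrite sum_nat_eq0 => /forallP/(_ q); rewrite qp => /eqP.
Qed.

Lemma weyl_qpair_act w (x : 'rV[rat]_r) a : weyl D w ->
  qpair (act_cowt w x) (lin w *m a) = qpair x a.
Proof. by move=> ww; rewrite qpair_act linKm (weyl_tr ww) qpair0l addr0. Qed.

Lemma act_transl (x y : 'rV[rat]_r) : act_cowt (transl y) x = x + y.
Proof. by rewrite /act_cowt map_mx1 mulmx1. Qed.

Lemma generated_affine_weyl g : generated gen g -> affine_weyl D g.
Proof.
case=> t <-; elim: t => [|o t [y [w [[z Ez] ww Et]]]].
  rewrite word_nil; exists 0, 1%g; split; [by exists 0; rewrite map_mx0|exact: weyl1|].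
  by apply: aff_eq => //; rewrite mulg1.
have H h y' : weyl D h -> coroot_lattice y' ->
    affine_weyl D (transl y' * h * (transl y * w))%g.
  move=> hw [z' Ez']; exists (y' + act_cowt h y), (h * w)%g; split.
  - exists (z' + z *m linV h); rewrite Ez' Ez /act_cowt (weyl_tr hw) addr0.
    by rewrite map_mxD map_mxM.
  - exact: weylM.
  apply: aff_eq; first by rewrite !linM !mul1mx.
  rewrite (trM (_ * _)%g) act_cowtM (trM (transl y)) !act_transl (weyl_tr ww) add0r.
  by rewrite (trM (transl _)) act_transl (weyl_tr (weylM hw ww)) add0r addrC.
rewrite word_cons {}Et; case: o => [i|] /=.
  have -> : weyl_gen D i = (transl 0 * weyl_gen D i)%g.
    by rewrite -[LHS]mul1g; congr (_ * _)%g; apply: aff_eq.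
  by apply: H; [apply: weyl_genW|exists 0; rewrite map_mx0].
apply: H; last by exists (coroot D (highest D)).
by apply/weylP/refl_generated/highest_root.
Qed.

End WeylInAffine.

Lemma conj_morph (G : groupType) (g x y : G) :
  (g * (x * y) * g^-1 = (g * x * g^-1) * (g * y * g^-1))%g.
Proof. by rewrite !mulgA mulgVK. Qed.

Section Tau.
Variables (r : nat) (D : simple_datum r).
Local Notation roots := (Defs.roots D).
Local Notation simple := (Defs.simple D).
Local Notation ht := (ht D).
Local Notation aht := (aht D).
Local Notation al o := (asimple D o).
Local Notation gen := (affine_gen D).
Local Notation sW := (fun i => affine_gen D (Some i)).
Variables (w0 : aff r) (i : 'I_r) (v : aff r).
Hypotheses (w0_longest : longest D w0) (ci : cominuscule D i) (Wv : weyl D v).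
Hypothesis v_w0 : act_cowt v (fund_cowt D i) = act_cowt w0 (fund_cowt D i).
Hypothesis v_min : forall u, weyl D u ->
  act_cowt u (fund_cowt D i) = act_cowt w0 (fund_cowt D i) -> bruhat D v u.
Implicit Types (a b m : 'cV[int]_r) (j k : 'I_r) (w u g h x : aff r) (o p : option 'I_r).
Implicit Types (f : 'cV[int]_r * rat).

Local Notation fi := (fund_cowt D i).
(** The coefficient of [a] on [simple i]. Cominuscule means that it is 0 or 1 on positive roots. *)
Definition lev a : rat := qpair fi a.
Definition tau : aff r := locked (v * transl (- fi))%g.

Lemma tauE : tau = (v * transl (- fi))%g.
Proof. by rewrite /tau -lock. Qed.

Let sK j : (sW j * sW j = 1)%g := genK D (Some j).

Lemma lev_pos a : a \in roots -> 0 < ht a -> lev a = 0 \/ lev a = 1.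
Proof. by move=> aR a0; apply: ci; split=> //; apply: root_pos. Qed.

Lemma levN a : lev (- a) = - lev a. Proof. exact: qpairNr. Qed.

Lemma lev_gt0 a : a \in roots -> 0 < lev a -> 0 < ht a.
Proof. exact: root_cf_pos. Qed.

(** Every Bruhat step increases the length, so Bruhat minimality makes [v] shortest among the
    elements with the same image of [fi]. *)
Lemma v_length_min u : weyl D u -> act_cowt u fi = act_cowt v fi ->
  (lenW D v <= lenW D u)%N.
Proof.
rewrite v_w0 => uW uE; have := v_min uW uE; move: (v) => v'.
elim=> [x y [a _ [_ /ltnW]]|//|x y z _ h1 _ h2] //.
exact: leq_trans h1 h2.
Qed.

(** For [j] other than [i], [s_j] fixes [fi], so [v s_j] competes with [v] and cannot be shorter. *)
Lemma v_simple_pos j : j != i -> 0 < ht (lin v *m simple j).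
Proof.
move=> ji; have Wvj : weyl D (v * weyl_gen D j)%g by apply: weylM => //; apply: weyl_genW.
rewrite -(aht_weyl _ Wv).
have gv : generated sW v by apply/weylP.
have [//|H] := boolP (0 < _); have /= E := @genR_length_lt _ D _ Some j v gv H.
have := v_length_min Wvj; rewrite act_cowtM /weyl_gen refl_areflection ?simple_root //.
rewrite act_areflection ?simple_root //= fund_simple eq_sym (negbTE ji) addr0 scale0r subr0.
move=> /(_ erefl); rewrite /lenW.
have -> : areflection D (simple j, 0) = weyl_gen D j.
  by rewrite /weyl_gen refl_areflection ?simple_root.
by move: E; rewrite -[length (weyl_gen D) v]/(length sW v) => ->; rewrite ltnn.
Qed.

Lemma ht_lin_comb w a : weyl D w -> a \in roots -> 0 < ht a ->
  exists c : 'I_r -> nat, [/\ a = \sum_j simple j *+ c j,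
    forall j, qpair (fund_cowt D j) a = (c j)%:R &
    ht (lin w *m a) = \sum_j ht (lin w *m simple j) *+ c j].
Proof.
move=> ww; apply: (@ht_comb_ge _ D (fun a => ht (lin w *m a))).
  by rewrite mulmx0 ht0.
by move=> x y; rewrite mulmxDr htD.
Qed.

Lemma v_lev0 a : a \in roots -> 0 < ht a -> lev a = 0 -> 0 < ht (lin v *m a).
Proof.
move=> aR a0 la; have [c [_ Hc E]] := ht_lin_comb Wv aR a0.
have vR : lin v *m a \in roots by have [-> _ _] := weyl_good Wv.
rewrite lt_neqAle eq_sym root_ht_neq0 //= E; apply: sumr_ge0 => j _.
have [->|ji] := eqVneq j i; last by rewrite mulrn_wge0 // ltW // v_simple_pos.
by have := Hc i; rewrite -/(lev a) la => /eqP; rewrite eq_sym pnatr_eq0 => /eqP ->.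
Qed.

(** If [w0] kept a simple root positive, multiplying by that reflection would lengthen it. *)
Lemma w0_neg a : a \in roots -> 0 < ht a -> ht (lin w0 *m a) < 0.
Proof.
have [Ww0 maxw0] := w0_longest; have gw0 : generated sW w0 by apply/weylP.
have neg j : ht (lin w0 *m simple j) < 0.
  have jR : lin w0 *m simple j \in roots.
    by have [-> _ _] := weyl_good Ww0; apply: simple_root.
  rewrite lt_neqAle root_ht_neq0 //= leNgt -(aht_weyl _ Ww0); apply/negP => H.
  have := @genR_length_gt _ D _ Some j w0 gw0 H => /= E.
  have := maxw0 (w0 * weyl_gen D j)%g (weylM Ww0 (weyl_genW D j)).
  by rewrite /lenW -[length _ _]/(length sW (w0 * weyl_gen D j)%g) E ltnn.
move=> aR a0; have [c [Ea Hc E]] := ht_lin_comb Ww0 aR a0.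
have vR : lin w0 *m a \in roots by have [-> _ _] := weyl_good Ww0.
rewrite lt_neqAle root_ht_neq0 //= E; apply: sumr_le0 => j _.
by rewrite mulrn_wle0 // ltW.
Qed.

(** Because [v] and [w0] agree on [fi], [w0^-1 v a] again has level 1; it is therefore positive, and
    [w0] makes it negative. *)
Lemma v_lev1 a : a \in roots -> lev a = 1 -> ht (lin v *m a) < 0.
Proof.
move=> aR la; have [Ww0 _] := w0_longest.
have bR : linV w0 *m (lin v *m a) \in roots.
  have [<- _ _] := weyl_good Ww0; rewrite linVKm.
  by have [-> _ _] := weyl_good Wv.
rewrite -[lin v *m a](linVKm w0); apply: w0_neg => //; apply: lev_gt0 => //.
rewrite /lev -(weyl_qpair_act fi _ Ww0) linVKm -v_w0 (weyl_qpair_act fi _ Wv) -/(lev a) la.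
exact: ltr01.
Qed.

Lemma v_neg a : a \in roots -> 0 < ht a -> (ht (lin v *m a) < 0) = (lev a == 1).
Proof.
move=> aR a0; case: (lev_pos aR a0) => la; rewrite la.
  by rewrite ltNge ltW ?v_lev0 // eq_sym oner_eq0.
by rewrite v_lev1 // eqxx.
Qed.

Lemma fund_coweight : coweight_lattice D fi.
Proof. by move=> a aR; apply: cf_root_int. Qed.

Lemma coweightN y : coweight_lattice D y -> coweight_lattice D (- y).
Proof. by move=> yP a aR; rewrite qpairNl rpredN yP. Qed.

Lemma good_tau : good D tau.
Proof.
rewrite tauE; apply: goodM; first exact: weyl_good.
exact/good_transl/coweightN/fund_coweight.
Qed.

Lemma lin_tau : lin tau = lin v.
Proof. by rewrite tauE linM mulmx1. Qed.

Lemma tr_tauV : tr tau^-1%g = fi.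
Proof.
rewrite tauE invgM trM /act_cowt (weyl_tr (weylV Wv)) mul0mx add0r.
by rewrite /tr /= map_mx1 mulmx1 opprK.
Qed.

Lemma aaction_tau f : aaction tau f = (lin v *m f.1, f.2 + lev f.1).
Proof.
case: f => a k; rewrite tauE aactionM {2}/aaction /= mul1mx qpairNl opprK.
by rewrite (weyl_aaction _ _ Wv).
Qed.

Lemma aaction_tauV f : aaction tau^-1%g f = (linV v *m f.1, f.2 - lev (linV v *m f.1)).
Proof.
case: f => a k; rewrite tauE invgM aactionM (weyl_aaction _ _ (weylV Wv)).
by rewrite /aaction /= mul1mx /tr /= map_mx1 mulmx1 opprK.
Qed.

(** The shift of the constant term by [lev a] compensates the sign changes made by [v], which occur
    exactly at level 1 and -1. *)
Lemma tau_pos f : is_aroot D f -> 0 < aht f -> 0 < aht (aaction tau f).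
Proof.
move=> fR f0; have tR : is_aroot D (aaction tau f) by rewrite aroot_aaction //; apply: good_tau.
move: f0; rewrite !aht_gt0 // aaction_tau; case: f fR tR => a k fR _ /=.
have [aR /= /intrP[z Ez]] := andP fR; rewrite /= in aR.
have := root_ht_neq0 aR; rewrite neq_lt => /orP[a0|a0]; last first.
  case: (lev_pos aR a0) => la; rewrite la.
    by rewrite v_lev0 // addr0 a0.
  move=> H; have k0 : 0 <= k by case/orP: H => [/ltW//|/andP[/eqP ->]].
  by rewrite ltr_wpDl.
have a0' : 0 < ht (- a) by rewrite htN oppr_gt0.
rewrite orbC ltNge (ltW a0) andbF /= => k0.
have k1 : 1 <= k by move: k0; rewrite Ez ltr0z (ler_int _ 1); lia.
case: (lev_pos (root_opp aR) a0'); rewrite levN => la.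
  by rewrite -[lev a]opprK la oppr0 addr0 k0.
have -> : lev a = -1 by rewrite -la opprK.
have := v_lev1 (root_opp aR); rewrite levN => /(_ la); rewrite mulmxN htN oppr_lt0 => ->.
by rewrite subr_gt0 subr_eq0 andbT orbC eq_sym -le_eqVlt.
Qed.

Lemma tau_aht f : is_aroot D f -> (0 < aht (aaction tau f)) = (0 < aht f).
Proof.
move=> fR; apply/idP/idP; last exact: tau_pos.
apply: contraTT => fN; have f'R : is_aroot D (aopp f) by rewrite aroot_opp.
have := tau_pos f'R; rewrite aht_opp_gt0 // fN => /(_ isT).
by rewrite aaction_opp aht_opp_gt0 // aroot_aaction //; apply: good_tau.
Qed.

(** Turns stability of the alcove under [tau] into preservation of signs of affine roots. *)
Lemma alcoveP y : alcove D y <->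
  forall f, is_aroot D f -> 0 < aht f -> 0 < qpair y f.1 + f.2.
Proof.
split=> [[y1 y2] [a k] fR|H]; last first.
  split=> [j|]; first by have := H _ (asimple_root D (Some j)); rewrite aht_asimple /= addr0; apply.
  have := H _ (asimple_root D None); rewrite aht_asimple /= qpairNr => /(_ isT).
  by rewrite addrC subr_gt0.
have [aR /= /intrP[z Ez]] := andP fR; rewrite /= in aR.
have nonneg m : nat_comb simple m -> 0 <= qpair y m.
  move=> [c ->]; rewrite qpair_sumr; apply: sumr_ge0 => j _.
  by rewrite qpairMnr mulr_ge0 // ltW.
rewrite aht_gt0 //= => /orP[k0|/andP[/eqP -> a0]].
  have k1 : 1 <= k by move: k0; rewrite Ez ltr0z (ler_int _ 1); lia.
  have := nonneg _ (highest_max (root_opp aR)); rewrite opprK qpairDr.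
  by move: y2 => *; lra.
rewrite addr0; have [c Ea] := root_pos aR a0.
rewrite lt_neqAle eq_sym nonneg ?andbT; last by exists c.
apply/negP => /eqP E0; have := root_neq0 aR; rewrite Ea big1 ?eqxx // => j _.
have /eqP := E0; rewrite Ea qpair_sumr psumr_eq0 => [/allP/(_ j (mem_index_enum j)) /=|k' _].
  by rewrite qpairMnr mulf_eq0 (gt_eqF (y1 j)) orbF pnatr_eq0 => /eqP ->.
by rewrite qpairMnr mulr_ge0 // ltW.
Qed.

Lemma alcove_stab_tau : alcove_stab D tau.
Proof.
split; first exists (- act_cowt v fi), v; first split=> //.
- move=> a aR; rewrite qpairNl rpredN -[a](linVKm v) (weyl_qpair_act _ _ Wv).
  by apply: fund_coweight; have [<- _ _] := weyl_good Wv; rewrite linVKm.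
- apply: aff_eq; first by rewrite lin_tau linM mul1mx.
  rewrite tauE !trM /= act_transl (weyl_tr Wv) add0r /act_cowt (weyl_tr Wv) !addr0.
  by rewrite /tr /= mulNmx.
move=> y; rewrite !alcoveP; split=> H f fR f0.
  rewrite -(aval_aaction tau f y); apply: H; first by rewrite aroot_aaction //; apply: good_tau.
  exact: tau_pos.
have gV := goodV good_tau.
have E : f = aaction tau (aaction tau^-1%g f) by rewrite -aactionM mulgV aaction1.
have f'R : is_aroot D (aaction tau^-1%g f) by rewrite aroot_aaction.
rewrite {1 2}E aval_aaction; apply: H => //.
by rewrite -tau_aht // -E.
Qed.

Lemma aroot_comb f : is_aroot D f -> 0 < aht f -> exists c : option 'I_r -> nat,
  f.1 = \sum_o (al o).1 *+ c o /\ f.2 = \sum_o (al o).2 *+ c o.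
Proof.
case: f => a k fR; have [aR /= /intrP[z Ez]] := andP fR; rewrite /= in aR.
rewrite aht_gt0 //= => H.
(* Only [al None] has a constant term, so its multiplicity is [K = k]; the finite part left over is
   [a + K Theta = (Theta + a) + (K - 1) Theta] when [K] is positive. *)
have [K [k_nat Kcomb]] : exists K : nat, k = K%:R /\ nat_comb simple (a + highest D *+ K).
  case/orP: H => [k0|/andP[/eqP -> a0]]; last first.
    by exists 0; rewrite mulr0n addr0; split=> //; apply: root_pos.
  have : (0 < z)%R by move: k0; rewrite Ez ltr0z.
  case: z Ez => // [[//|n]] Ez _; exists n.+1; split; first by rewrite Ez -pmulrn.
  have [c1 E1] := highest_max (root_opp aR); rewrite opprK in E1.
  have [c2 E2] := root_pos (highest_root D) (ht_highest_gt0 D).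
  exists (fun j => c1 j + n * c2 j)%N; rewrite mulrS addrA (addrC a) E1 {1}E2.
  rewrite -sumrMnl -big_split; apply: eq_bigr => j _ /=.
  by rewrite -mulrnA mulrnDr mulnC.
have [c Ec] := Kcomb; exists (fun o => if o is Some j then c j else K); split=> /=.
  rewrite big_option /= mulNrn -[RHS]addrC -Ec.
  by rewrite addrK.
by rewrite big_option /= big1 ?addr0 // => j _; rewrite mul0rn.
Qed.

Lemma aht_ge1 f : is_aroot D f -> 0 < aht f -> 1 <= aht f.
Proof.
case: f => a k /andP[/= aR /intrP[z ->]].
have /intrP[n En] := root_ht_int aR; have /intrP[h Eh] := root_ht_int (highest_root D).
by rewrite /aht /= En Eh -(rmorphD intr 1 h) -rmorphM -rmorphD ltr0z (ler_int _ 1).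
Qed.

(** Expand the positive root [tau (al o)] in affine simple roots and pull back by [tau^-1]: each
    pulled-back term has height at least 1 and the total is 1, which leaves a single term. *)
Lemma tau_simple o : exists p, aaction tau (al o) = al p.
Proof.
have oR := asimple_root D o; have tR : is_aroot D (aaction tau (al o)).
  by rewrite aroot_aaction //; apply: good_tau.
have t0 : 0 < aht (aaction tau (al o)) by rewrite tau_aht // aht_asimple.
have [c [E1 E2]] := aroot_comb tR t0.
pose L f := aht (aaction tau^-1%g f).
have LD f f' : L (f.1 + f'.1, f.2 + f'.2) = L f + L f'.
  rewrite /L /aht !aaction_tauV /= mulmxDr htD /lev qpairDr; ring.
have EL : \sum_p L (al p) *+ c p = 1.
  rewrite -(aht_asimple D o) -[al o](aaction1) -(mulVg tau) aactionM -/(L _).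
  rewrite [aaction tau _]surjective_pairing E1 E2.
  have L0 : L (0, 0) = 0.
    by rewrite /L /aht aaction_tauV /= /lev mulmx0 ht0 qpair0r subr0 mulr0 addr0.
  have LMn f n : L (f.1 *+ n, f.2 *+ n) = L f *+ n.
    by elim: n => [|n IH]; rewrite ?mulr0n // !mulrS (LD f (_, _)) IH.
  elim: (index_enum _) => [|p s IH]; first by rewrite !big_nil.
  by rewrite !big_cons (LD (_, _) (_, _)) -IH LMn.
have [p|p [cp cq]] := unit_comb EL.
  move=> _; apply: aht_ge1; first by rewrite aroot_aaction ?asimple_root //; apply/goodV/good_tau.
  rewrite -tau_aht; first by rewrite -aactionM mulgV aaction1 aht_asimple.
  by rewrite aroot_aaction ?asimple_root //; apply/goodV/good_tau.
exists p; rewrite [LHS]surjective_pairing [RHS]surjective_pairing E1 E2.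
congr (_, _); rewrite (bigD1 p) //= cp mulr1n big1 ?addr0 // => q qp;
  by rewrite cq // mulr0n.
Qed.

(** The diagram automorphism induced by [tau]. The default [o] is never taken, by [sigP]. *)
Definition sig o : option 'I_r := odflt o [pick p | aaction tau (al o) == al p].

Lemma sigP o : aaction tau (al o) = al (sig o).
Proof.
rewrite /sig; case: pickP => [p /eqP//|H].
by have [p E] := tau_simple o; have := H p; rewrite E eqxx.
Qed.

Lemma tau_gen o : (tau * gen o * tau^-1 = gen (sig o))%g.
Proof.
rewrite !affine_gen_areflection areflection_conj ?sigP ?asimple_root //.
exact: good_tau.
Qed.

Definition ctau x : aff r := (tau * x * tau^-1)%g.

Lemma ctauM x y : ctau (x * y)%g = (ctau x * ctau y)%g.
Proof. exact: conj_morph. Qed.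

Lemma ctau_word t : ctau (word gen t) = word gen (map sig t).
Proof.
elim: t => [|o t IH]; first by rewrite /ctau word_nil mulg1 mulgV.
by rewrite word_cons ctauM IH /= word_cons -tau_gen.
Qed.

Lemma ctau_generated x : generated gen x -> generated gen (ctau x).
Proof. by move=> [t <-]; exists (map sig t); rewrite ctau_word. Qed.

Lemma aaction_ctau x f : aaction (ctau x) (aaction tau f) = aaction tau (aaction x f).
Proof. by rewrite -!aactionM /ctau mulgVK. Qed.

Lemma reducedA_sig t : reducedA D t -> reducedA D (map sig t).
Proof.
elim/last_ind: t => [|t o IH]; first by rewrite /reducedA /= !word_nil !length1.
move=> R; have H := reducedA_rcons_pos R.
have [Rt _] : reducedA D t /\ reducedA D [:: o] by apply: reducedA_cat; rewrite cats1.
rewrite /reducedA map_rcons word_rcons size_rcons -(IH Rt).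
apply: (@genR_length_gt _ D _ id (sig o) (word gen (map sig t)) (generated_word _ _)).
rewrite /= -sigP -ctau_word aaction_ctau tau_aht // aroot_aaction ?asimple_root //.
by apply: (@good_word _ D _ id).
Qed.

(** Up to [tau], which preserves signs, the image is [(a, - lev b)] with [b = v^-1 a]. Were [lev b]
    equal to 1, then [a = v b] would be negative. Hence lengths add when [ctau v] is multiplied by
    elements of W. *)
Lemma ctau_v_pos a : a \in roots -> 0 < ht a -> 0 < aht (aaction (ctau v) (a, 0)).
Proof.
move=> aR a0; have bR : linV v *m a \in roots.
  by have [<- _ _] := weyl_good Wv; rewrite linVKm.
rewrite /ctau !aactionM aaction_tauV (weyl_aaction _ _ Wv) /= sub0r linVKm.
have fR : is_aroot D (a, - lev (linV v *m a)).
  by rewrite /is_aroot /= aR rpredN cf_root_int.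
rewrite tau_aht // aht_gt0 //= a0 andbT oppr_gt0 oppr_eq0.
have := root_ht_neq0 bR; rewrite neq_lt => /orP[b0|b0].
  have := lev_pos (root_opp bR); rewrite htN oppr_gt0 levN => /(_ b0)[].
    by move/eqP; rewrite oppr_eq0 orbC => ->.
  by move/eqP; rewrite eqr_oppLR => /eqP ->; rewrite ltrN10.
case: (lev_pos bR b0) => [-> |lb]; first by rewrite eqxx orbT.
by have := v_lev1 bR lb; rewrite linVKm ltNge ltW.
Qed.

Lemma v_generatedA : generated gen v. Proof. exact: weyl_generatedA. Qed.

Lemma ctau_v_min : affine_weyl_min D (ctau v).
Proof.
have gv := ctau_generated v_generatedA.
split; first exact: generated_affine_weyl.
move=> w ww; have gw := weyl_generatedA ww.
have := @length_additive _ D _ id _ _ gv gw => /= H.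
rewrite /lenA H ?leq_addr // => f fR f0.
move=> /(weyl_aroot_neg (weylV ww) fR f0)[k0 a0 _].
have [aR _] := andP fR.
by rewrite [f]surjective_pairing k0; apply: ctau_v_pos.
Qed.

(** Left weak order is containment of inversion sets, and the inversions of [v] are the positive
    roots of level 1. *)
Lemma weak_left_lev w : weyl D w ->
  weak_left D w v <-> (forall a, a \in roots -> 0 < ht a -> ht (lin w *m a) < 0 -> lev a = 1).
Proof.
move=> ww; have gv : generated sW v by apply/weylP.
have gw : generated sW w by apply/weylP.
split=> [E a aR a0 wa|H].
  apply/eqP; rewrite -v_neg //.
  have fR : is_aroot D (a, 0) by rewrite aroot_root.
  have vR : lin v *m a \in roots by have [-> _ _] := weyl_good Wv.
  have := @additive_inversion _ D _ Some (v * w^-1)%g w (a, 0) _ gw.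
  rewrite mulgVK (weyl_aaction _ _ ww) (weyl_aaction _ _ Wv) !aht_root.
  move=> /(_ (generatedM gv (generatedV sK gw))).
  move=> /(_ E fR a0); rewrite -leNgt ltW // -leNgt => /(_ isT).
  by rewrite le_eqVlt (negbTE (root_ht_neq0 vR)).
apply: (@length_additive_sub _ D _ Some _ _ gv gw) => f fR f0.
move=> /(weyl_aroot_neg ww fR f0)[k0 a0 wa].
have [aR _] := andP fR.
rewrite [f]surjective_pairing k0 (weyl_aaction _ _ Wv) aht_root -leNgt ltW //.
by rewrite v_neg // H.
Qed.

Lemma weak_left_simple w k : weyl D w -> weak_left D w v -> k != i ->
  0 < ht (lin w *m simple k).
Proof.
move=> ww /(weak_left_lev ww) H ki.
have wR : lin w *m simple k \in roots by have [-> _ _] := weyl_good ww; apply: simple_root.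
have := root_ht_neq0 wR; rewrite neq_lt => /orP[h|//].
have := H _ (simple_root D k) _ h; rewrite ht_simple ltr01 => /(_ isT).
by rewrite /lev fund_simple eq_sym (negbTE ki) => /eqP; rewrite eq_sym oner_eq0.
Qed.

(** Let [b] be an inversion of [(v w^-1)^-1] and [c = v^-1 b], so that [w c] is negative while [v c]
    is positive. A positive [c] would have level 1 by the weak order and [v c] would be negative; so
    [c] is negative, necessarily of level -1, and [ctau w] sends [b] to the [tau]-image of
    [(w c, 1)], which is positive. *)
Lemma weak_left_length_additive w : weyl D w -> weak_left D w v ->
  length gen (ctau w * (v * w^-1))%g = (length gen (ctau w) + length gen (v * w^-1)%g)%N.
Proof.
move=> ww wl; have wvw : weyl D (v * w^-1)%g by apply/weylM/weylV.
apply: (@length_additive _ D _ id).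
- exact/ctau_generated/weyl_generatedA.
- exact: weyl_generatedA.
move=> f fR f0 /(weyl_aroot_neg (weylV wvw) fR f0)[k0 b0].
have [bR _] := andP fR; rewrite [f]surjective_pairing k0; move: (f.1) bR b0 => b bR b0.
rewrite invgM invgK linM -mulmxA linVE => wc.
set c := linV v *m b in wc.
have Eb : b = lin v *m c by rewrite linVKm.
have cR : c \in roots by have [<- _ _] := weyl_good Wv; rewrite -Eb.
have wcR : lin w *m c \in roots by have [-> _ _] := weyl_good ww.
rewrite /ctau !aactionM aaction_tauV (weyl_aaction _ _ ww) /= sub0r -/c.
have fR' : is_aroot D (lin w *m c, - lev c) by rewrite /is_aroot /= wcR rpredN cf_root_int.
rewrite tau_aht // aht_gt0 //= oppr_gt0.
have := root_ht_neq0 cR; rewrite neq_lt => /orP[c0|c0].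
  have := lev_pos (root_opp cR); rewrite htN oppr_gt0 levN => /(_ c0)[] /eqP.
    rewrite oppr_eq0 => /eqP lc; have := v_lev0 (root_opp cR).
    rewrite htN oppr_gt0 levN lc oppr0 mulmxN -Eb htN => /(_ c0 erefl).
    by rewrite oppr_gt0 ltNge ltW.
  by rewrite eqr_oppLR => /eqP ->; rewrite ltrN10.
have lc := (weak_left_lev ww).1 wl c cR c0 wc.
by have := v_lev1 cR lc; rewrite -Eb ltNge ltW.
Qed.

End Tau.

(** * The sum over the orbit of the fundamental coweight *)

Section TranslationSum.
Variables (r : nat) (D : simple_datum r) (K : fieldAction (aff r)).
Variable T : twistedRing K.
Variable wtK : 'cV[int]_r -> K.
Hypothesis wtKB : {morph wtK : m n / m - n}.
Hypothesis wtK_inj : injective wtK.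
Hypothesis act_wtK : forall g m, fa_act g (wtK m) = wtK (lin g *m m).
Variables (w0 : aff r) (i : 'I_r) (v : aff r).
Hypotheses (w0_longest : longest D w0) (ci : cominuscule D i) (Wv : weyl D v).
Hypothesis v_w0 : act_cowt v (fund_cowt D i) = act_cowt w0 (fund_cowt D i).
Hypothesis v_min : forall u, weyl D u ->
  act_cowt u (fund_cowt D i) = act_cowt w0 (fund_cowt D i) -> bruhat D v u.

Implicit Types (a b m : 'cV[int]_r) (j k : 'I_r) (w u g h x : aff r) (o p : option 'I_r).
Implicit Types (f : 'cV[int]_r * rat).
Local Notation roots := (Defs.roots D).
Local Notation simple := (Defs.simple D).
Local Notation ht := (ht D).
Local Notation aht := (aht D).
Local Notation al o := (asimple D o).
Local Notation gen := (affine_gen D).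
Local Notation cst := (tw_cst T).
Local Notation dl := (tw_dl T).
Local Notation coef := (@tw_coef _ _ T).
Local Notation aug := (@tw_aug _ _ T).
Local Notation A := (nilE D T wtK).
Local Notation nA := (nilA D T wtK).
Local Notation tau := (tau D i v).
Local Notation ctau := (ctau D i v).
Local Notation sig := (sig D i v).
Local Notation lev := (lev D i).
Local Notation fi := (fund_cowt D i).

Let sigP o : aaction tau (al o) = al (sig o).
Proof. exact: (sigP w0_longest ci Wv v_w0 v_min). Qed.
Let tau_gen o : (tau * gen o * tau^-1 = gen (sig o))%g.
Proof. exact: (tau_gen w0_longest ci Wv v_w0 v_min). Qed.
Let weak_left_lev w : weyl D w -> weak_left D w v <->
  (forall a, a \in roots -> 0 < ht a -> ht (lin w *m a) < 0 -> lev a = 1).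
Proof. exact: (weak_left_lev w0_longest ci Wv v_w0 v_min). Qed.
Let v_lev0 a : a \in roots -> 0 < ht a -> lev a = 0 -> 0 < ht (lin v *m a).
Proof. exact: (v_lev0 Wv v_w0 v_min). Qed.
Let v_lev1 a : a \in roots -> lev a = 1 -> ht (lin v *m a) < 0.
Proof. exact: (v_lev1 w0_longest Wv v_w0). Qed.
Let nilA_nilE o x : generated gen x -> nA o * A x =
  if 0 < aht (aaction x^-1%g (al o)) then A (gen o * x)%g else 0.
Proof. exact: nilA_nilE. Qed.
Let nilE_nilA o x : generated gen x -> A x * nA o =
  if 0 < aht (aaction x (al o)) then A (x * gen o)%g else 0.
Proof. exact: nilE_nilA. Qed.

Lemma dl_tau_nilA o : dl tau * nA o = nA (sig o) * dl tau.
Proof.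
rewrite !nilAE mulrA tw_dl_cst fmorphV /= act_wtK.
have -> : lin tau *m (al o).1 = (al (sig o)).1 by rewrite -sigP.
rewrite -!mulrA; congr (_ * _); rewrite mulrBr mulrBl mulr1 mul1r -!tw_dlM.
by rewrite -tau_gen mulgVK.
Qed.

Lemma dl_tau_nilword t : dl tau * nilword D T wtK t = nilword D T wtK (map sig t) * dl tau.
Proof.
elim: t => [|o t IH]; first by rewrite /= !nilword_nil mulr1 mul1r.
rewrite map_cons !nilword_cons mulrA dl_tau_nilA -mulrA.
by rewrite -IH mulrA.
Qed.

Lemma dl_tau_nilE x : generated gen x -> dl tau * A x = A (ctau x) * dl tau.
Proof.
move=> /reduced_exists[t [<- st]].
have Rt : reducedA D t by rewrite /reducedA st.
rewrite (ctau_word w0_longest ci Wv v_w0 v_min) !nilE_word //.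
  exact: dl_tau_nilword.
exact: (reducedA_sig w0_longest ci Wv v_w0 v_min).
Qed.

Local Notation X := (dl tau^-1%g).

Lemma dl_tauK : dl tau * X = 1.
Proof. by rewrite -tw_dlM mulgV tw_dl1. Qed.
Lemma dl_tauVK : X * dl tau = 1.
Proof. by rewrite -tw_dlM mulVg tw_dl1. Qed.

Lemma nilA_dl_tauV o : nA o * X = X * nA (sig o).
Proof.
rewrite -[LHS]mul1r -dl_tauVK -mulrA (mulrA (dl tau)) dl_tau_nilA -!mulrA.
by rewrite dl_tauK mulr1.
Qed.

(* [trans_term w] is [A_(t_(w fi))], since [t_(w fi) = w tau^-1 (v w^-1)] with
   lengths adding up; stated this way it needs no [A] outside of W_aff. *)
Definition trans_term w : T := A w * X * A (v * w^-1)%g.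

Lemma trans_termE w : weyl D w -> weak_left D w v ->
  A (ctau w * v * w^-1)%g = dl tau * trans_term w.
Proof.
move=> ww wl; have gw := weyl_generatedA ww.
have wvw : weyl D (v * w^-1)%g by apply/weylM/weylV.
rewrite -(mulgA _ v) -nilEM //.
- rewrite /trans_term !mulrA dl_tau_nilE // -(mulrA _ (dl tau)).
  by rewrite dl_tauK mulr1.
- exact: (ctau_generated w0_longest ci Wv v_w0 v_min).
- exact: weyl_generatedA.
exact: (weak_left_length_additive w0_longest ci Wv v_w0 v_min).
Qed.

(* The permutation of [{w <=_L v}] induced by the action of [s_j] on the orbit of
   [fi], through the bijection [w |-> w fi]. *)
Definition swap j w : aff r :=
  if lev (linV w *m simple j) == 0 then w else (gen (Some j) * w)%g.

Lemma linV_root w a : weyl D w -> (linV w *m a \in roots) = (a \in roots).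
Proof. by move=> /weyl_good[H _ _]; rewrite -[LHS]H linVKm. Qed.

Lemma gen_lin_simple j : lin (gen (Some j)) *m simple j = - simple j.
Proof. by have [->] := aaction_gen_asimple D (Some j). Qed.

(** The only inversion that [s_j w] can have beyond those of [w] is [w^-1 (simple j)]; when the two
    differ its level is nonzero, hence 1. *)
Lemma swap_weak_left j w : weyl D w -> weak_left D w v ->
  weyl D (swap j w) /\ weak_left D (swap j w) v.
Proof.
move=> ww wl; rewrite /swap; case: eqP => // /eqP lc.
have wsw : weyl D (gen (Some j) * w)%g by apply: weylM => //; apply: weyl_genW.
split=> //; apply/weak_left_lev => // a aR a0; rewrite linM -mulmxA => sa.
have waR : lin w *m a \in roots by have [-> _ _] := weyl_good ww.
have := root_ht_neq0 waR; rewrite neq_lt => /orP[wa|wa].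
  exact: (weak_left_lev ww).1 wl a aR a0 wa.
have [E|NE] := eqVneq (lin w *m a) (simple j).
  have Ea : a = linV w *m simple j by rewrite -E linKm.
  by case: (lev_pos ci aR a0) => // la; rewrite -Ea la eqxx in lc.
have fR : is_aroot D (lin w *m a, 0) by rewrite aroot_root.
have := @gen_preserves_pos _ D (Some j) _ fR.
rewrite (weyl_aaction _ _ (weyl_genW D j)) !aht_root => H.
have : 0 < ht (lin (gen (Some j)) *m (lin w *m a)).
  by apply: H => //; apply/eqP => -[/eqP]; rewrite (negbTE NE).
by rewrite ltNge ltW.
Qed.

Lemma swapK j w : weyl D w -> swap j (swap j w) = w.
Proof.
move=> ww; case lc : (lev (linV w *m simple j) == 0); first by rewrite /swap lc lc.
rewrite /swap lc.
have -> : linV (gen (Some j) * w)%g *m simple j = - (linV w *m simple j).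
  rewrite -linVE invgM linM linVE -mulmxA genV gen_lin_simple.
  by rewrite mulmxN.
by rewrite levN oppr_eq0 lc mulgA genK mul1g.
Qed.

(** The root is positive, since otherwise [w] would invert its negative, which has level 0. It
    involves only nodes other than [i], whose simple roots [w] keeps positive; as [w] maps it to
    height 1, a single node occurs. *)
Lemma levi_simple j w : weyl D w -> weak_left D w v ->
  lev (linV w *m simple j) = 0 ->
  exists2 k, k != i & linV w *m simple j = simple k.
Proof.
move=> ww wl lc; set c := linV w *m simple j in lc *.
have cR : c \in roots by rewrite linV_root ?simple_root.
have c0 : 0 < ht c.
  have := root_ht_neq0 cR; rewrite neq_lt => /orP[c0|//].
  have := (weak_left_lev ww).1 wl (- c) (root_opp cR).
  rewrite htN oppr_gt0 mulmxN linVKm htN ht_simple levN lc oppr0 => /(_ c0 (ltrN10 _)) /eqP.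
  by rewrite eq_sym oner_eq0.
have [n [Ec Hn E]] := ht_lin_comb ww cR c0.
have ni : n i = 0 by have := Hn i; rewrite -/(lev c) lc => /eqP; rewrite eq_sym pnatr_eq0 => /eqP.
have S1 : \sum_k ht (lin w *m simple k) *+ n k = 1 by rewrite -E linVKm ht_simple.
have [k|k [nk nq]] := unit_comb S1.
  move=> nk0; have ki : k != i by apply: contraNneq nk0 => ->; rewrite ni.
  have wk0 := weak_left_simple w0_longest ci Wv v_w0 v_min ww wl ki.
  have kR : lin w *m simple k \in roots by have [-> _ _] := weyl_good ww; apply: simple_root.
  by have := @aht_ge1 _ D (lin w *m simple k, 0); rewrite aroot_root aht_root; apply.
exists k; first by apply/eqP => ki; rewrite -ki nk in ni.
by rewrite Ec (bigD1 k) //= nk mulr1n big1 ?addr0 // => q qk; rewrite nq // mulr0n.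
Qed.

(** At level 0 [tau] adds nothing to the constant term, which excludes the affine node as image. *)
Lemma sig_Some k : k != i -> exists2 k', sig (Some k) = Some k' &
  lin v *m simple k = simple k'.
Proof.
move=> ki; have := sigP (Some k); rewrite aaction_tau // add0r /lev fund_simple eq_sym.
rewrite (negbTE ki); case: (sig _) => [k'|] [] E.
  by exists k'.
by move/eqP; rewrite eq_sym oner_eq0.
Qed.

Lemma conj_gen x o p : good D x -> aaction x (al o) = al p ->
  (gen p * x = x * gen o)%g.
Proof.
move=> gx E; rewrite !affine_gen_areflection -E areflection_move //.
exact: asimple_root.
Qed.

(** The relation A_j A_(t_mu) = A_(t_(s_j mu)) A_j for [mu = w fi]. Everything depends on
    [c = w^-1 (simple j)], whose level is the pairing of [mu] with the simple root. *)
Lemma trans_term_swap j w : weyl D w -> weak_left D w v ->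
  nA (Some j) * trans_term w = trans_term (swap j w) * nA (Some j).
Proof.
move=> ww wl; have gw := weyl_generatedA ww.
have wvw : weyl D (v * w^-1)%g by apply/weylM/weylV.
have gvw := weyl_generatedA wvw.
set c := linV w *m simple j.
have cR : c \in roots by rewrite linV_root ?simple_root.
have Ew : aaction w^-1%g (al (Some j)) = (c, 0) by rewrite (weyl_aaction _ _ (weylV ww)).
have Evw : aaction (v * w^-1)%g (al (Some j)) = (lin v *m c, 0).
  by rewrite (weyl_aaction _ _ wvw) linM -mulmxA.
rewrite /trans_term !mulrA nilA_nilE // Ew aht_root /swap -/c.
(* Here [s_j] fixes [w fi]: it becomes [s_k] past [w], [s_k'] past [tau^-1], and comes back as [s_j]
   past [v w^-1], because [v s_k = s_k' v]. *)
have [lc|lc] := eqVneq (lev c) 0.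
  have [k ki Ec] := levi_simple ww wl lc; have [k' Ek' vk] := sig_Some ki.
  rewrite -/c in Ec; rewrite Ec ht_simple ltr01.
  have wk : aaction w (al (Some k)) = al (Some j).
    by rewrite (weyl_aaction _ _ ww) -Ec linVKm.
  have E1 : (gen (Some j) * w = w * gen (Some k))%g.
    by apply: conj_gen => //; apply: weyl_good.
  have E2 : A (w * gen (Some k))%g = A w * nA (Some k).
    by rewrite nilE_nilA // wk aht_asimple ltr01.
  rewrite E1 E2 -(mulrA (A w)) nilA_dl_tauV Ek' -!mulrA; congr (_ * (_ * _)).
  have E3 : (gen (Some k') * v = v * gen (Some k))%g.
    by apply: conj_gen; [apply: weyl_good|rewrite (weyl_aaction _ _ Wv) vk].
  rewrite nilA_nilE // nilE_nilA // Evw Ec vk aht_root ht_simple ltr01.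
  rewrite invgM invgK aactionM (weyl_aaction _ _ (weylV Wv)).
  rewrite -vk linVE linKm (weyl_aaction _ _ ww) aht_root -Ec linVKm ht_simple ltr01.
  rewrite mulgA E3 -!mulgA; congr (A (_ * _)%g).
  apply: (mulgI w); rewrite !mulgA mulgV mul1g.
  by rewrite -E1 -mulgA mulgV mulg1.
set s := gen (Some j); have gsw : generated gen (s * w)%g.
  exact: generatedM (generated_gen _ _) gw.
have Ev : (v * (s * w)^-1 = v * w^-1 * s)%g by rewrite invgM genV mulgA.
have gvws : generated gen (v * w^-1 * s)%g.
  by apply: generatedM => //; apply: generated_gen.
have Es : aaction (v * w^-1 * s)%g (al (Some j)) = (- (lin v *m c), 0).
  by rewrite aactionM aaction_gen_asimple aaction_opp Evw /aopp /= oppr0.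
have vcR : lin v *m c \in roots by have [-> _ _] := weyl_good Wv.
rewrite Ev -!mulrA nilE_nilA // Es aht_root htN oppr_gt0.
(* Now [c] has level 1 or -1. If it is negative both products vanish; if positive both are
   [A (s * w) * X * A (v * w^-1)]. *)
have := root_ht_neq0 cR; rewrite neq_lt => /orP[c0|c0].
  rewrite ltNge (ltW c0) /= mul0r.
  have := lev_pos ci (root_opp cR); rewrite htN oppr_gt0 levN => /(_ c0)[] lN.
    by move/eqP: lc; case; apply: oppr_inj; rewrite oppr0.
  have := v_lev1 (root_opp cR); rewrite levN mulmxN htN oppr_lt0 => /(_ lN) H.
  by rewrite ltNge (ltW H) /= !mulr0.
rewrite c0; have lc1 : lev c = 1.
  by case: (lev_pos ci cR c0) => // H; rewrite H eqxx in lc.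
by rewrite v_lev1 // -mulgA genK mulg1 mulrA.
Qed.

Local Open Scope classical_set_scope.

Definition below_v : seq (aff r) := fset_set [set w | weyl D w /\ weak_left D w v].

Lemma finite_below : finite_set [set w | weyl D w /\ weak_left D w v].
Proof. by apply: sub_finite_set (finite_weyl D) => w []. Qed.

Lemma mem_below w : w \in below_v <-> weyl D w /\ weak_left D w v.
Proof. by rewrite /below_v in_fset_set ?inE //; exact: finite_below. Qed.

(** The element J of the overview. *)
Definition trans_sum : T := \sum_(w <- below_v) trans_term w.

Lemma nilA_trans_sum j : nA (Some j) * trans_sum = trans_sum * nA (Some j).
Proof.
rewrite /trans_sum mulr_sumr mulr_suml.
rewrite (eq_big_seq (fun w => trans_term (swap j w) * nA (Some j))); last first.
  by move=> w /mem_below[ww wl]; apply: trans_term_swap.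
rewrite -(big_map (swap j) xpredT (fun w => trans_term w * nA (Some j))).
apply/perm_big/uniq_perm; rewrite ?fset_uniq //.
  rewrite map_inj_in_uniq ?fset_uniq // => x y /mem_below[wx _] /mem_below[wy _] E.
  by rewrite -(swapK j wx) E swapK.
have sw w : w \in below_v -> swap j w \in below_v.
  by move=> /mem_below[ww wl]; apply/mem_below; apply: swap_weak_left.
move=> x; apply/mapP/idP => [[y yB ->]|xB]; first exact: sw.
by exists (swap j x); [apply: sw|rewrite swapK //; have /mem_below[] := xB].
Qed.

(** [A w] is supported on the products of subwords of a reduced word of [w], and a subword of full
    length is the word itself. *)
Lemma coef_nilE_weyl w g : weyl D w -> coef g (A w) != 0 ->
  [/\ weyl D g, (lenW D g <= lenW D w)%N & lenW D g = lenW D w -> g = w].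
Proof.
move=> /lenW_word[t [<- <- Rt]].
have Rt' : reducedA D (map Some t) by rewrite /reducedA Rt size_map.
rewrite -word_map_Some nilE_word // => /coef_nilword[t' /subseqP[m _ ->] <-].
rewrite -map_mask !word_map_Some; have st : subseq (mask m t) t by apply: mask_subseq.
have L := length_word (fun i => affine_gen D (Some i)) (mask m t).
split; first by apply/weylP; apply: generated_word.
  exact: leq_trans L (size_subseq st).
move=> E; congr (word _ _).
by apply/eqP; rewrite -(size_subseq_leqif st) eqn_leq size_subseq // -E.
Qed.

Lemma tr_mul_weyl g u : weyl D u -> tr (g * u)%g = tr g.
Proof. by move=> uW; rewrite trM (weyl_tr uW) /act_cowt mul0mx add0r. Qed.

Lemma coef_trans_sum g : coef g trans_sum != 0 -> exists u (b : aff r), [/\ weyl D u, weyl D b,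
  g = (u * tau^-1 * b)%g, tr g = act_cowt u fi &
  exists w, [/\ weyl D w, weak_left D w v, coef u (A w) != 0
    & coef b (A (v * w^-1)%g) != 0]].
Proof.
move=> g0; have [w wB g0'] : exists2 w, w \in below_v & coef g (trans_term w) != 0.
  apply: contrapT => H; move/eqP: g0; apply; rewrite /trans_sum tw_coef_sum big1_seq //.
  move=> w /andP[_ wB]; apply/eqP; apply: contrapT => /negP H'; apply: H.
  by exists w.
have [ww wl] := (mem_below w).1 wB.
have wvw : weyl D (v * w^-1)%g by apply/weylM/weylV.
have [x [b [x0 b0 Eg]]] := tw_coef_mul g0'.
have [u [h [u0 h0 Ex]]] := tw_coef_mul x0.
have Eh : h = tau^-1%g.
  by move: h0; rewrite tw_coef_dl; case: (_ =P h) => [->//|_]; rewrite eqxx.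
have [Wu _ _] := coef_nilE_weyl ww u0.
have [Wb _ _] := coef_nilE_weyl wvw b0.
exists u, b; split=> //; first by rewrite Eg Ex Eh.
  by rewrite Eg Ex Eh tr_mul_weyl // trM tr_tauV.
by exists w.
Qed.

(* Only the term [w = v] contributes here, because the minimality of [v] leaves
   no room for a proper subword of [v]. *)
Lemma coef_trans_sum_base g : coef g trans_sum != 0 -> tr g = act_cowt v fi ->
  lin g = 1%:M.
Proof.
move=> /coef_trans_sum[u [b [Wu Wb Eg Et [w [ww wl u0 b0]]]]] E.
have wvw : weyl D (v * w^-1)%g by apply/weylM/weylV.
have [_ L1 E1] := coef_nilE_weyl ww u0.
have [_ L2 E2] := coef_nilE_weyl wvw b0.
have Lv : (lenW D v <= lenW D u)%N by apply: (v_length_min v_w0 v_min Wu); rewrite -Et.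
have Lw : lenW D v = (lenW D (v * w^-1)%g + lenW D w)%N by exact: wl.
have Ew : v = w.
  have : (v * w^-1 = 1)%g.
    apply: (@length_eq0 _ _ (fun i => affine_gen D (Some i))); first by apply/weylP.
    rewrite -/(lenW D _); move: Lw L1 Lv; rewrite /lenW.
    by move: (length _ _) (length _ _) (length _ _) (length _ _) => *; lia.
  by move/(congr1 (fun x => x * w)%g); rewrite mulgVK mul1g.
have Eu : u = v.
  by rewrite -Ew in L1 E1; apply: E1; apply/eqP; rewrite eqn_leq L1 Lv.
have Eb : b = 1%g.
  move: b0; rewrite -Ew mulgV nilE1 // -tw_dl1 tw_coef_dl.
  by case: (_ =P b) => [->//|_]; rewrite eqxx.
by rewrite Eg Eu Eb mulg1 linM linVE -(lin_tau D i v) linK.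
Qed.

Lemma coef_nilA_mull o (a : T) g : coef g (nA o * a) =
  (wtK (al o).1)^-1 * (coef g a - fa_act (gen o) (coef (gen o * g)%g a)).
Proof.
by rewrite nilAE -mulrA tw_coef_cstM mulrBl mul1r tw_coefB tw_coef_dlM genV.
Qed.

Lemma coef_nilA_mulr o (a : T) g : coef g (a * nA o) =
  coef g a * fa_act g (wtK (al o).1)^-1 -
  coef (g * gen o)%g a * fa_act (g * gen o)%g (wtK (al o).1)^-1.
Proof.
by rewrite nilAE mulrA mulrBr mulr1 tw_coefB tw_coef_Mcst tw_coef_Mdl tw_coef_Mcst genV.
Qed.

Lemma act_lin1 g m : lin g = 1%:M -> fa_act g (wtK m)^-1 = (wtK m)^-1.
Proof. by move=> E; rewrite fmorphV /= act_wtK E mul1mx. Qed.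

(* Comparing the coefficients of the two sides of [A_j J = J A_j] propagates
   the vanishing of the nontranslation coefficients of [J] along the simple
   reflections of the orbit of [fi]. *)
Lemma coef_trans_sum_step j (y : 'rV[rat]_r) :
  (forall g, coef g trans_sum != 0 -> tr g = y -> lin g = 1%:M) ->
  forall g, coef g trans_sum != 0 -> tr g = act_cowt (gen (Some j)) y -> lin g = 1%:M.
Proof.
move=> H h h0 th; set s := gen (Some j); set g := (s * h)%g.
have Eh : h = (s * g)%g by rewrite /g mulgA genK mul1g.
have tg : tr g = y by rewrite /g trM th -act_cowtM genK act_cowt1.
have Ws : weyl D s by apply: weyl_genW.
apply: contrapT => lh.
(* [g * s = s * h * s] lies over [y] and has a linear part conjugate to that of [h], so the
   hypothesis at [y] kills its coefficient. What remains of the comparison at [g] forces the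
   coefficient at [h] to vanish, whether or not [g] is itself in the support. *)
have gs0 : coef (g * s)%g trans_sum = 0.
  apply/eqP; apply: contraT => gs0; case: lh.
  have := H _ gs0; rewrite tr_mul_weyl // => /(_ tg); rewrite linM /g linM => E.
  have : lin s *m (lin s *m lin h *m lin s) *m lin s = 1%:M.
    by rewrite E mulmx1 -linM genK.
  by rewrite !mulmxA -linM genK mul1mx -mulmxA -linM genK mulmx1.
have := congr1 (coef g) (nilA_trans_sum j).
rewrite coef_nilA_mull coef_nilA_mulr gs0 mul0r subr0 -/s.
rewrite -Eh.
have s0 : fa_act s (coef h trans_sum) != 0 by rewrite fmorph_eq0.
have [g0|g0] := eqVneq (coef g trans_sum) 0.
  rewrite g0 mul0r sub0r => /eqP; rewrite mulf_eq0 invr_eq0 oppr_eq0.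
  by rewrite (negbTE s0) orbF -(wtK0 wtKB) (inj_eq wtK_inj) (negbTE (root_neq0 (simple_root D j))).
rewrite (act_lin1 _ (H g g0 tg)) mulrC => /(mulIf _) E.
have : coef g trans_sum - fa_act s (coef h trans_sum) = coef g trans_sum.
  apply: E; rewrite invr_eq0 -(wtK0 wtKB) (inj_eq wtK_inj).
  exact: root_neq0 (simple_root D j).
by move/eqP; rewrite subr_eq addrC -subr_eq subrr eq_sym (negbTE s0).
Qed.

Lemma coef_trans_sum_lin g : coef g trans_sum != 0 -> lin g = 1%:M.
Proof.
move=> g0; have [u [b [Wu _ _ Et _]]] := coef_trans_sum g0.
suff H : forall t, forall g, coef g trans_sum != 0 ->
    tr g = act_cowt (word (fun j => gen (Some j)) t * v)%g fi -> lin g = 1%:M.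
  have /weylP[t Et'] := weylM Wu (weylV Wv).
  by apply: (H t) => //; rewrite Et' mulgVK.
elim=> [|j t IH] h h0; first by rewrite word_nil mul1g; apply: coef_trans_sum_base.
rewrite word_cons -mulgA act_cowtM; apply: coef_trans_sum_step h0.
exact: IH.
Qed.

Lemma trans_sum_cst c : (forall g, lin g = 1%:M -> fa_act g c = c) ->
  trans_sum * cst c = cst c * trans_sum.
Proof.
move=> H; apply: (@tw_coefP _ _ T) => g; rewrite tw_coef_Mcst tw_coef_cstM.
have [->|g0] := eqVneq (coef g trans_sum) 0; first by rewrite mul0r mulr0.
by rewrite H ?coef_trans_sum_lin // mulrC.
Qed.

(** [tau] and [v] have the same linear part, so linear parts are merely conjugated. *)
Lemma coef_conj_trans_sum g :
  coef g (dl tau * trans_sum * dl v^-1%g) != 0 -> lin g = 1%:M.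
Proof.
rewrite tw_coef_Mdl tw_coef_dlM invgK fmorph_eq0 => /coef_trans_sum_lin.
rewrite !linM linVE => /(congr1 (fun M => lin tau *m M *m linV v)).
by rewrite mulmx1 !mulmxA linK mul1mx -mulmxA linK mulmx1 lin_tau linK.
Qed.

Lemma trans_expansion (s : seq (aff r)) (c : aff r -> K) :
  (forall y g, lin g = 1%:M -> fa_act g (c y) = c y) ->
  dl v^-1%g = \sum_(y <- s) cst (c y) * A y ->
  \sum_(w <- below_v) \sum_(y <- s)
     cst (fa_act tau (c y)) * A (ctau w * v * w^-1)%g * A y
  = dl tau * trans_sum * dl v^-1%g.
Proof.
move=> Hc ->; rewrite exchange_big mulr_sumr; apply: eq_bigr => y _ /=.
rewrite -mulr_suml -mulr_sumr mulrA -(mulrA (dl tau)) trans_sum_cst //; last exact: Hc.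
rewrite (mulrA (dl tau)) tw_dl_cst; congr (_ * _); rewrite -mulrA; congr (_ * _).
rewrite /trans_sum mulr_sumr; apply: eq_big_seq => w /mem_below[ww wl].
exact: trans_termE.
Qed.

Lemma aug_mul_nilE (p : pred (aff r)) (z : T) y : (forall g j, p (g * gen (Some j))%g = p g) ->
  weyl D y -> y <> 1%g -> aug p (z * A y) = 0.
Proof.
move=> Hp Wy y1; have [t [Ey _ Rt]] := lenW_word Wy.
have Rt' : reducedA D (map Some t) by rewrite /reducedA Rt size_map.
rewrite -Ey -word_map_Some nilE_word //.
case/lastP: t Ey {Rt Rt'} => [|t j] Ey; first by case: y1; rewrite -Ey word_nil.
by rewrite map_rcons nilword_rcons mulrA aug_nilA.
Qed.

(** A factor [A y] on the right with [y] nontrivial in W is killed. This removes all terms with [y]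
    other than 1, and then all with [w] other than [v], since these end in [A (v * w^-1)]. *)
Lemma aug_trans_expansion (s : seq (aff r)) (c : aff r -> K) (p : pred (aff r)) :
  (forall g j, p (g * gen (Some j))%g = p g) -> uniq s -> {in s, forall y, weyl D y} ->
  dl v^-1%g = \sum_(y <- s) cst (c y) * A y ->
  aug p (\sum_(w <- below_v) \sum_(y <- s)
     cst (fa_act tau (c y)) * A (ctau w * v * w^-1)%g * A y) = aug p (A (ctau v)).
Proof.
move=> Hp us sW Edl.
(* Total augmentation of the expansion of [v^-1]: only the term of the identity can contribute the
   value 1. *)
have c1 : 1%g \in s /\ c 1%g = 1.
  have := congr1 (aug predT) Edl; rewrite -[dl v^-1%g]mul1r -(tw_cst1 T) tw_aug_mono mulr1.
  rewrite aug_sum => E; have [s1|s1] := boolP (1%g \in s).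
    rewrite (bigD1_seq 1%g) //= big1_seq ?addr0 in E => [|y /andP[y1 ys]]; last first.
      by rewrite (@aug_mul_nilE predT _ y) //; [apply: sW|apply/eqP].
    by rewrite nilE1 // -(tw_dl1 T) tw_aug_mono mulr1 in E; rewrite -E.
  rewrite big1_seq in E => [|y /andP[_ ys]].
    by move/eqP: E; rewrite oner_eq0.
  by rewrite (@aug_mul_nilE predT _ y) //; [apply: sW|move=> y1; rewrite -y1 ys in s1].
have [s1 {}c1] := c1; rewrite aug_sum.
have vB : v \in below_v.
  apply/mem_below; split=> //; rewrite /weak_left mulgV.
  by rewrite /lenW length1.
rewrite (bigD1_seq v) ?fset_uniq //= [X in _ + X]big1_seq ?addr0; last first.
  move=> w /andP[wv /mem_below[ww wl]]; rewrite aug_sum big1_seq // => y /andP[_ ys].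
  have [->|y1] := eqVneq y 1%g; last by rewrite (aug_mul_nilE _ Hp (sW _ ys)) //; apply/eqP.
  have wvw : weyl D (v * w^-1)%g by apply/weylM/weylV.
  rewrite nilE1 // mulr1 trans_termE // /trans_term !mulrA (aug_mul_nilE _ Hp wvw) // => E.
  by case/eqP: wv; apply: (mulIg w^-1)%g; rewrite mulgV E.
rewrite aug_sum (bigD1_seq 1%g) //= [X in _ + X]big1_seq ?addr0; last first.
  by move=> y /andP[y1 ys]; rewrite (aug_mul_nilE _ Hp (sW _ ys)) //; apply/eqP.
by rewrite c1 fa_act_1 tw_cst1 mul1r nilE1 // mulr1 -mulgA mulgV mulg1.
Qed.

(** Each coset contains exactly one translation, so the augmentation over it is a single
    coefficient. *)
Lemma central_eq0 (z : T) : (forall g, coef g z != 0 -> lin g = 1%:M) ->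
  (forall y : 'rV[rat]_r, aug (fun g => tr g == y) z = 0) -> z = 0.
Proof.
move=> Hz H; apply: (@tw_coefP _ _ T) => g; rewrite tw_coef0.
have [//|g0] := eqVneq (coef g z) 0.
rewrite -(H (tr g)); apply/esym/aug_single => //= h h0 /eqP th.
by apply: aff_eq => //; rewrite !Hz.
Qed.

End TranslationSum.

(** * Specialization to Frac(S) and the definitions of the statement *)

Section ConcreteNilHecke.
Variables (r : nat) (D : simple_datum r).
Implicit Types (g h x : aff r) (m : 'cV[int]_r).

Local Notation Kr := (frac_action r).
Local Notation Tr := (twisted_ring (frac_action r)).

Definition wt_frac m : Kr := tofrac (wt m).

Lemma wt_fracB : {morph wt_frac : m n / m - n}.
Proof. by move=> m n; rewrite /wt_frac wtB rmorphB. Qed.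

Lemma wt_frac_inj : injective wt_frac.
Proof. by move=> m n /eqP; rewrite /wt_frac tofrac_eq => /eqP /wt_inj. Qed.

Lemma act_wt_frac g m : fa_act g (wt_frac m) = wt_frac (lin g *m m).
Proof. by rewrite /wt_frac /= act_frac_tofrac act_wt. Qed.

Lemma scale_twisted (c : Kr) (a : Tr) :
  (c : fracP r) *: (a : twisted r) = tw_cst Tr c * a.
Proof.
apply: (@qcoefP _ Kr) => g; rewrite [RHS]qcoef_cstM /qcoef.
exact: monalg.mcoeffZ.
Qed.

Lemma nil_genE o : nil_gen D o = nilA D Tr wt_frac o.
Proof.
rewrite nilAE /nil_gen; case: o => [i|].
  exact: (@scale_twisted (wt_frac (simple D i))^-1).
rewrite /= /wt_frac wtN rmorphN invrN mulN1r.
exact: (@scale_twisted (- (tofrac (wt (highest D)))^-1)).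
Qed.

Lemma nil_eltE x : nil_elt D x = nilE D Tr wt_frac x.
Proof.
rewrite /nil_elt /nilE nilwordE; elim: (xget _ _) => [|o t IH].
  by rewrite !big_nil.
by rewrite !big_cons IH nil_genE.
Qed.

Lemma scal_nil_elt (p : symP r) x :
  scal p (nil_elt D x) = tw_cst Tr (tofrac p) * nilE D Tr wt_frac x.
Proof. by rewrite nil_eltE; apply: (@scale_twisted (tofrac p)). Qed.

Lemma tmul_nil_elt (p : symP r) x y :
  tmul (scal p (nil_elt D x)) (nil_elt D y) =
  tw_cst Tr (tofrac p) * nilE D Tr wt_frac x * nilE D Tr wt_frac y.
Proof. by rewrite scal_nil_elt nil_eltE. Qed.

(** The two sums use the additive structures of [twisted r] and of the ring [Tr], which agree but
    are not syntactically the same. *)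
Lemma twisted_sumE I (s : seq I) (F : I -> Tr) :
  \sum_(i <- s) (F i : twisted r) = \sum_(i <- s) F i.
Proof. by elim: s => [|i s IH]; rewrite ?big_nil // !big_cons IH. Qed.

(** Commutation with the weight of a simple root, read at a nonzero coefficient, says that [g] fixes
    this root. *)
Lemma centralizes_lin (a : Tr) : centralizes_S a ->
  forall g, tw_coef g a != 0 -> lin g = 1%:M.
Proof.
move=> H g g0; apply: (@lin_eq_simple _ D g 1%g) => i; apply: wt_frac_inj.
have := H (wt (simple D i)); rewrite /scal.
rewrite (@scale_twisted (wt_frac (simple D i)) (tw_dl Tr 1%g)) tw_dl1 mulr1.
move=> /(congr1 (@tw_coef _ _ Tr g)).
rewrite [LHS]tw_coef_Mcst [RHS]tw_coef_cstM act_wt_frac mulrC lin1 mul1mx.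
by move/(mulIf g0).
Qed.

Lemma aug_weyl_ideal (y : 'rV[rat]_r) (a : Tr) : weyl_ideal D a ->
  tw_aug (fun g => tr g == y) a = 0.
Proof.
move=> [t tP ->]; rewrite (twisted_sumE _ (fun p => (p.1 : Tr) * nil_elt D p.2)).
rewrite aug_sum big1_seq // => p /andP[_ /tP[_ Wp p1]].
rewrite nil_eltE; apply: (aug_mul_nilE wt_fracB wt_frac_inj act_wt_frac _ _ Wp p1).
by move=> g j; rewrite (tr_mul_weyl _ (weyl_genW D j)).
Qed.

End ConcreteNilHecke.

Theorem proposition1p3 (r : nat) (D : simple_datum r)
    (H : algType (symP r)) (schubert : aff r -> H) (j : H -> twisted r)
    (Hj : grassmannian_homology D schubert j)
    (xi : aff r -> aff r -> symP r) (Hxi : dual_functions D xi)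
    (w0 : aff r) (Hw0 : longest D w0)
    (i : 'I_r) (Hi : cominuscule D i)
    (vi : aff r) (Wvi : weyl D vi)
    (vi_w0 : act_cowt vi (fund_cowt D i) = act_cowt w0 (fund_cowt D i))
    (vi_min : forall u, weyl D u ->
       act_cowt u (fund_cowt D i) = act_cowt w0 (fund_cowt D i) ->
       bruhat D vi u) :
  let tau : aff r := (vi * transl (- fund_cowt D i))%g in
  let ctau (x : aff r) : aff r := (tau * x * tau^-1)%g in
  [/\ alcove_stab D tau,
      affine_weyl_min D (ctau vi)
    & j (schubert (ctau vi)) =
      \sum_(w \in [set w | weyl D w /\ weak_left D w vi])
        \sum_(v \in [set v | weyl D v /\ bruhat D v (vi^-1)%g])
          tmul (scal (act tau (xi v (vi^-1)%g))
                     (nil_elt D (ctau w * vi * w^-1)%g))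
               (nil_elt D v)].
Proof.
rewrite /= -!tauE; set t := tau D i vi; set x := (t * vi * t^-1)%g.
have x_min : affine_weyl_min D x := ctau_v_min Hw0 Hi Wvi vi_w0 vi_min.
split=> //; first exact: (alcove_stab_tau Hw0 Hi Wvi vi_w0 vi_min).
pose K := frac_action r; pose T := twisted_ring K.
have finB : finite_set [set v | weyl D v /\ bruhat D v (vi^-1)%g].
  by apply: sub_finite_set (finite_weyl D) => v [].
set s : seq (aff r) := fset_set [set v | weyl D v /\ bruhat D v (vi^-1)%g].
have sW : {in s, forall y, weyl D y}.
  by move=> y; rewrite /s in_fset_set // inE => -[].
pose c y : K := tofrac (xi y (vi^-1)%g).
have Edl : tw_dl T (vi^-1)%g = \sum_(y <- s) tw_cst T (c y) * nilE D T (@wt_frac r) y.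
  have := Hxi _ (weylV Wvi); rewrite (fsbig_finite _ _ finB) -/s => E.
  rewrite [LHS]E -(twisted_sumE _ (fun y => tw_cst T (c y) * nilE D T (@wt_frac r) y)).
  by apply: eq_bigr => y _; apply: scal_nil_elt.
have Hc y g : lin g = 1%:M -> fa_act g (c y) = c y.
  by move=> lg; rewrite /c /= act_frac_tofrac (@act_lin _ g 1%g) ?act1.
pose F w y : T := tw_cst T (fa_act t (c y))
  * nilE D T (@wt_frac r) (t * w * t^-1 * vi * w^-1)%g * nilE D T (@wt_frac r) y.
pose E : T := \sum_(w <- below_v D vi) \sum_(y <- s) F w y.
rewrite (fsbig_finite _ _ (finite_below D vi)) -/(below_v D vi).
under eq_bigr => w _.
  rewrite (fsbig_finite _ _ finB) -/s.
  under eq_bigr => y _ do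
    rewrite tmul_nil_elt -act_frac_tofrac -/(F w y).
  rewrite (twisted_sumE s (F w)).
  over.
rewrite (twisted_sumE _ (fun w => \sum_(y <- s) F w y)) -/E.
have E1 : E = tw_dl T t * trans_sum D T (@wt_frac r) i vi * tw_dl T (vi^-1)%g.
  exact: (trans_expansion (@wt_fracB r) (@wt_frac_inj r) (@act_wt_frac r) Hw0 Hi
    Wvi vi_w0 vi_min Hc Edl).
apply/eqP; rewrite -subr_eq0; apply/eqP.
(* The Schubert class maps into the centralizer of S, hence is supported on translations like the
   double sum; by [central_eq0] only coset augmentations remain to be compared. *)
have [_ jcent] := (j_image Hj (j (schubert x))).2 (ex_intro _ (schubert x) erefl).
apply: (@central_eq0 r K T).
  move=> g g0; have [H1|H1] := eqVneq (tw_coef g (j (schubert x) : T)) 0; last first.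
    exact: (centralizes_lin D jcent H1).
  apply: (coef_conj_trans_sum (@wt_fracB r) (@wt_frac_inj r) (@act_wt_frac r) Hw0 Hi
    Wvi vi_w0 vi_min (T := T) (g := g)).
  rewrite -E1; apply: contraNneq g0 => H2.
  by rewrite [tw_coef _ _]tw_coefB H1 H2 subrr.
move=> y; rewrite [LHS]tw_augB.
(* The congruence modulo the left ideal gives the Schubert class the augmentations of [nil_elt D x],
   which are also those of [E]. *)
have := aug_weyl_ideal y (j_schubert Hj x_min); rewrite [LHS]tw_augB.
have -> : tw_aug (fun g => tr g == y) E = tw_aug (fun g => tr g == y) (nil_elt D x : T).
  rewrite nil_eltE.
  apply: (aug_trans_expansion (@wt_fracB r) (@wt_frac_inj r) (@act_wt_frac r) Hw0 Hi
    Wvi vi_w0 vi_min _ _ sW Edl); last exact: fset_uniq.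
  by move=> g k; rewrite (tr_mul_weyl _ (weyl_genW D k)).
by [].
Qed.
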